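(* Let $\theta_0=2\pi$, let $c\in\mathbb{R}$, let $(a,b)\in\{(1,2),(0,1),(1,\infty),(0,\infty)\}$, and let $\bm{u}=u_\theta\bm{e_\theta}+u_r\bm{e_r}\in C^2(\overline{\Omega_{a,b,2\pi}}\setminus\{\bm{0}\})$, with pressure $P$, be a solution of the stationary Euler equations in $\Omega_{a,b,2\pi}$ with $|u_r|>0$ in $\overline{\Omega_{a,b,2\pi}}\setminus\{\bm{0}\}$, $\bm{u}(r,0)=\bm{u}(r,2\pi)$ for all admissible $r$, and $$u_\theta(r,0)=u_\theta(r,2\pi)=\frac{c}{r}\quad\text{for all admissible } r .$$ Assume, according to $(a,b)$, the following. 1. If $(a,b)=(1,2)$: $c=0$, and for all $\theta\in[0,2\pi]$, $u_r(1,\theta)=2u_r(2,\theta)$, $u_\theta(1,\theta)=2u_\theta(2,\theta)$ and $\partial_ru_\theta(1,\theta)=4\partial_ru_\theta(2,\theta)$. 2. If $(a,b)=(0,1)$ or $(1,\infty)$: $u_\theta=c$ on $\{r=1\}$, and one of the following holds: (B1) $c=0$, $u_r<0$, and $\partial_\theta u_r|_{r=1}\ge\partial_r(ru_\theta)|_{r=1}$; (B2) $c=0$, $u_r>0$, and $\partial_\theta u_r|_{r=1}\le\partial_r(ru_\theta)|_{r=1}$; (B3) $c\,\bm{u}\cdot\bm{\nu}|_{r=1}>0$ and $\partial_\theta(ru_r)|_{\theta=0}=A$ for some constant $A$; (B4) $c\,\bm{u}\cdot\bm{\nu}|_{r=1}<0$ and $\partial_\theta(ru_r)|_{\theta=2\pi}=A$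 for some constant $A$; here $\bm\nu$ is the outer normal of $\partial\Omega_{a,b,2\pi}$ on $r=1$. 3. If $(a,b)=(0,\infty)$: if $c=0$, then for some $r_0>0$ either $u_r<0$ and $\partial_\theta u_r|_{r=r_0}\ge\partial_r(ru_\theta)|_{r=r_0}$, or $u_r>0$ and $\partial_\theta u_r|_{r=r_0}\le\partial_r(ru_\theta)|_{r=r_0}$; if $c\neq0$, then for some constant $A$, $\partial_\theta(ru_r)|_{\theta=0}=A$ or $\partial_\theta(ru_r)|_{\theta=2\pi}=A$. Then $\bm{u}$ is $(-1)$-homogeneous, $P$ is $(-2)$-homogeneous up to a constant translation in $\Omega_{a,b,2\pi}$, and there are constants $d\neq0$ and $C$ such that $$\bm{u}=\frac{c}{r}\bm{e_\theta}+\frac{d}{r}\bm{e_r},\qquad P=-\frac{c^2+d^2}{2r^2}+C .$$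
   Context: $(r,\theta)$ are polar coordinates in $\mathbb{R}^2$, $\bm{e_r}=(\cos\theta,\sin\theta)^T$, $\bm{e_\theta}=(-\sin\theta,\cos\theta)^T$, and a planar vector field is written $\bm{u}=u_\theta\bm{e_\theta}+u_r\bm{e_r}$. For $0\le a<b\le\infty$ and $\theta_0\in(0,2\pi]$, $\Omega_{a,b,\theta_0}=\{(r,\theta): a<r<b,\ 0<\theta<\theta_0\}$. Functions and fields on $\overline{\Omega_{a,b,2\pi}}\setminus\{\bm0\}$ are regarded as functions of $(r,\theta)$ with $0\le\theta\le2\pi$ and $r$ admissible, meaning $a\le r\le b$, $0<r<\infty$, with regularity up to the boundary. The stationary Euler equations in $\Omega$ are $\bm{u}\cdot\nabla\bm{u}=-\nabla P$, $\operatorname{div}\bm{u}=0$ in $\Omega$, with $\bm{u}$ the velocity and $P$ a scalar (pressure) function on $\Omega$; $\bm{u}$ is called a solution if these hold with some pressure $P$. $\bm{u}$ is $(-1)$-homogeneous if $\bm{u}=\frac{v(\theta)}{r}\bm{e_\theta}+\frac{f(\theta)}{r}\bm{e_r}$ for some functions $v,f$ of $\theta$ only; $P$ is $(-2)$-homogeneous up to a constant translation if $P-C$ is $r^{-2}$ times a function of $\theta$ for some constant $C$. On $r=1$, $\bm\nu=\bm{e_r}$ if $(a,b)=(0,1)$ and $\bm\nu=-\bm{e_r}$ if $(a,b)=(1,\infty)$. Conditions with $|_{r=1}$ or $|_{r=r_0}$ are required for all $\theta\in[0,2\pi]$, those with $|_{\theta=0}$ or $|_{\theta=2\pi}$ for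 all admissible $r$, and sign conditions on $u_r$ in all of $\overline{\Omega_{a,b,2\pi}}\setminus\{\bm 0\}$. *)

(* Defs.v *)
From Stdlib Require Import Reals.
From Coquelicot Require Import Coquelicot.
Open Scope R_scope.

(** Functions written [f r theta] are in polar coordinates, functions written
    [f x y] are in Cartesian coordinates. *)

Definition e_r (theta : R) : R * R := (cos theta, sin theta).
Definition e_theta (theta : R) : R * R := (- sin theta, cos theta).

Definition dot (v w : R * R) : R := fst v * fst w + snd v * snd w.

Definition polar_vector (vtheta vr theta : R) : R * R :=
  plus (scal vtheta (e_theta theta)) (scal vr (e_r theta)).

Definition polar_domain (a : R) (b : Rbar) (theta0 r theta : R) : Prop :=
  a < r /\ Rbar_lt r b /\ 0 < theta < theta0.

Definition admissible (a : R) (b : Rbar) (r : R) : Prop :=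
  0 < r /\ a <= r /\ Rbar_le r b.

(** The closure of the sector without the origin.  The sides [theta = 0] and
    [theta = theta0] are kept distinct, also when [theta0 = 2 * PI]. *)
Definition polar_closure (a : R) (b : Rbar) (theta0 r theta : R) : Prop :=
  admissible a b r /\ 0 <= theta <= theta0.

Definition Omega (a : R) (b : Rbar) (theta0 x y : R) : Prop :=
  exists r theta, polar_domain a b theta0 r theta /\
    x = r * cos theta /\ y = r * sin theta.

(** Partial derivatives relative to a set [D]: two-sided inside [D], one-sided
    on the boundary of a rectangle. *)

Definition quot_r (f : R -> R -> R) (r theta s : R) : R :=
  (f s theta - f r theta) / (s - r).
Definition quot_theta (f : R -> R -> R) (r theta s : R) : R :=
  (f r s - f r theta) / (s - theta).

Definition ex_pd_r (D : R -> R -> Prop) (f : R -> R -> R) (r theta : R) : Prop :=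
  exists l : R, filterlim (quot_r f r theta)
    (within (fun s => D s theta) (locally' r)) (locally l).
Definition ex_pd_theta (D : R -> R -> Prop) (f : R -> R -> R) (r theta : R) : Prop :=
  exists l : R, filterlim (quot_theta f r theta)
    (within (fun s => D r s) (locally' theta)) (locally l).

Definition pd_r (D : R -> R -> Prop) (f : R -> R -> R) (r theta : R) : R :=
  lim (filtermap (quot_r f r theta) (within (fun s => D s theta) (locally' r))).
Definition pd_theta (D : R -> R -> Prop) (f : R -> R -> R) (r theta : R) : R :=
  lim (filtermap (quot_theta f r theta) (within (fun s => D r s) (locally' theta))).

(** [C^k] up to the boundary.  On a product of intervals, this agrees with being
    [C^k] in the interior with all derivatives of order at most [k] extending
    continuously to the boundary. *)
Fixpoint Ck (k : nat) (D : R -> R -> Prop) (f : R -> R -> R) : Prop :=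
  continuous_on (fun p : R * R => D (fst p) (snd p)) (fun p => f (fst p) (snd p)) /\
  match k with
  | O => True
  | S k' =>
      (forall r theta, D r theta -> ex_pd_r D f r theta /\ ex_pd_theta D f r theta) /\
      Ck k' D (pd_r D f) /\ Ck k' D (pd_theta D f)
  end.

Definition Dx (f : R -> R -> R) (x y : R) : R := Derive (fun s => f s y) x.
Definition Dy (f : R -> R -> R) (x y : R) : R := Derive (fun s => f x s) y.

Definition steady_euler (O : R -> R -> Prop) (u : R -> R -> R * R) (P : R -> R -> R)
  : Prop :=
  let u1 x y := fst (u x y) in
  let u2 x y := snd (u x y) in
  forall x y, O x y ->
    (ex_derive (fun s => u1 s y) x /\ ex_derive (fun s => u1 x s) y /\
     ex_derive (fun s => u2 s y) x /\ ex_derive (fun s => u2 x s) y /\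
     ex_derive (fun s => P s y) x /\ ex_derive (fun s => P x s) y) /\
    u1 x y * Dx u1 x y + u2 x y * Dy u1 x y = - Dx P x y /\
    u1 x y * Dx u2 x y + u2 x y * Dy u2 x y = - Dy P x y /\
    Dx u1 x y + Dy u2 x y = 0.

Definition minus1_homogeneous (D : R -> R -> Prop) (utheta ur : R -> R -> R) : Prop :=
  exists v f : R -> R, forall r theta, D r theta ->
    polar_vector (utheta r theta) (ur r theta) theta =
    polar_vector (v theta / r) (f theta / r) theta.

(** Here [D] is a set of polar coordinates and [P] is Cartesian. *)
Definition minus2_homogeneous_upto_cst (D : R -> R -> Prop) (P : R -> R -> R) : Prop :=
  exists (K : R) (q : R -> R), forall r theta, D r theta ->
    P (r * cos theta) (r * sin theta) - K = q theta / r ^ 2.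

(* Main.v *)
Require Import Defs.
From Stdlib Require Import Reals Lra Psatz.
From Coquelicot Require Import Coquelicot.
Open Scope R_scope.

(** Put [t = ln r], [f = r * u_r] and [w = r * u_theta], and let [z] be the
    vorticity.  Incompressibility and the definition of the vorticity read

      [f_t + w_theta = 0]  and  [w_t - f_theta = exp (2 * t) * z],

    and the curl of the momentum equation says that [z] is carried by the flow:
    [f * z_t + w * z_theta = 0] ([sector_flow]).  The strip has
    [0 <= theta <= L] with [L = 2 * PI], and [w] equals [c] on both sides, so
    the function [q] with [q_theta = - f], [q = 0] at [theta = 0], satisfies
    [q_t = w - c]; its value [S] at [theta = L] does not depend on [t].  Since
    [f] has no zero, [q] is monotone in [theta], hence bounded by [|S|].  This
    bound replaces any decay assumption at the origin or at infinity.

    The proof first shows [z = 0].  For a quantity [m] carried by the flow, the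
    flux [int f * m dtheta] changes only by what crosses the sides
    ([flux_derive]).  This replaces the integration along stream lines.  For
    [c = 0] the sides are stream lines and the flux of every function of [z] is
    constant in [t].  With [z ^ 2] and the hypotheses on the circles of radii
    [1] and [2], where [z] differs by a factor [4], this gives [z = 0] at once
    ([vor_zero_scaled]); with the squared positive part of [z] or [- z], it
    spreads the sign of [z] from one circle to all ([vor_sign_spreads]).  For
    [c <> 0] the stream lines cross the strip from one side to the other, and
    the hypothesis on the side [e] makes [z = - A * exp (- 2 * t)] there.  As
    the logarithmic radius [tau] at which a stream line meets that side is
    itself carried by the flow, the flux of
    [(z + A * exp (- 2 * tau)) ^ 2], cut off in [tau], is monotone in [t] and
    vanishes far enough, so that [z = - A * exp (- 2 * tau)] everywhere
    ([vor_from_side]) and [z] has a sign again.  A sign of [z] makes the mean of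
    [q] over circles a convex or concave function of [t]; it is bounded, with
    zero derivative at a finite end because [w = c] there, hence constant, and
    [z = 0] ([vor_zero_of_sign]).

    Once [z = 0], the function [h = q - S * theta / L] is harmonic and vanishes
    on the sides.  Its energy [int h ^ 2 dtheta] is bounded with second
    derivative [2 * int ((w - c) ^ 2 + (f + S / L) ^ 2) dtheta], hence constant
    by the same argument (or by periodicity between the circles of radii [1]
    and [2]), so that [w = c] and [f = - S / L] ([rigid_of_vor_zero]).  The
    pressure follows by integrating its gradient ([homogeneous_pressure]). *)

(** * Calculus of continuous functions on the plane *)

(** Continuity on the whole plane. *)
Definition cont2 (K : R -> R -> R) : Prop := forall x y, continuity_2d_pt K x y.

Lemma continuity_pt_cst (k x : R) : continuity_pt (fun _ => k) x.
Proof. apply continuity_pt_const; intros u v; reflexivity. Qed.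

Lemma cont2_const (k : R) : cont2 (fun _ _ => k).
Proof. intros x y; apply continuity_2d_pt_const. Qed.

Lemma cont2_plus (f g : R -> R -> R) :
  cont2 f -> cont2 g -> cont2 (fun x y => f x y + g x y).
Proof. intros Hf Hg x y; apply continuity_2d_pt_plus; auto. Qed.

Lemma cont2_minus (f g : R -> R -> R) :
  cont2 f -> cont2 g -> cont2 (fun x y => f x y - g x y).
Proof. intros Hf Hg x y; apply continuity_2d_pt_minus; auto. Qed.

Lemma cont2_opp (f : R -> R -> R) : cont2 f -> cont2 (fun x y => - f x y).
Proof. intros Hf x y; apply continuity_2d_pt_opp; auto. Qed.

Lemma cont2_mult (f g : R -> R -> R) :
  cont2 f -> cont2 g -> cont2 (fun x y => f x y * g x y).
Proof. intros Hf Hg x y; apply continuity_2d_pt_mult; auto. Qed.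

Lemma cont2_comp (h : R -> R) (f : R -> R -> R) :
  (forall x, continuity_pt h x) -> cont2 f -> cont2 (fun x y => h (f x y)).
Proof. intros Hh Hf x y; apply continuity_1d_2d_pt_comp; auto. Qed.

Lemma cont2_fst (h : R -> R) :
  (forall x, continuity_pt h x) -> cont2 (fun x _ => h x).
Proof.
intros Hh; apply (cont2_comp h (fun x _ => x)); auto.
intros x y; apply continuity_2d_pt_id1.
Qed.

Lemma cont2_snd (h : R -> R) :
  (forall x, continuity_pt h x) -> cont2 (fun _ y => h y).
Proof.
intros Hh; apply (cont2_comp h (fun _ y => y)); auto.
intros x y; apply continuity_2d_pt_id2.
Qed.

Lemma cont2_ext (f g : R -> R -> R) :
  (forall x y, f x y = g x y) -> cont2 f -> cont2 g.
Proof. intros H Hf x y; apply (continuity_2d_pt_ext f); auto. Qed.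

Lemma cont2_slice2 (f : R -> R -> R) (x y : R) : cont2 f -> continuity_pt (f x) y.
Proof.
intros Hf; apply continuity_pt_locally; intros eps.
destruct (Hf x y eps) as [d Hd]; exists d; intros v Hv.
apply Hd; [rewrite Rminus_diag, Rabs_R0; apply cond_pos | exact Hv].
Qed.

Lemma cont2_slice1 (f : R -> R -> R) (x y : R) :
  cont2 f -> continuity_pt (fun x => f x y) x.
Proof.
intros Hf; apply continuity_pt_locally; intros eps.
destruct (Hf x y eps) as [d Hd]; exists d; intros v Hv.
apply Hd; [exact Hv | rewrite Rminus_diag, Rabs_R0; apply cond_pos].
Qed.

Lemma continuity_pt_id' (x : R) : continuity_pt (fun x => x) x.
Proof. apply continuity_pt_id. Qed.

Lemma cts_of_pt (f : R -> R) (x : R) : continuity_pt f x -> continuous f x.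
Proof. apply continuity_pt_filterlim. Qed.

Lemma ex_RInt_cts (f : R -> R) (a b : R) :
  (forall x, continuity_pt f x) -> ex_RInt f a b.
Proof.
intros Hf; apply (ex_RInt_continuous (V := R_CompleteNormedModule)).
intros x _; apply cts_of_pt, Hf.
Qed.

(** A continuous function vanishing inside an interval vanishes at its ends. *)
Lemma zero_closed (g : R -> R) (a b : R) : a < b ->
  (forall x, continuity_pt g x) -> (forall x, a < x < b -> g x = 0) ->
  forall x, a <= x <= b -> g x = 0.
Proof.
intros Hab Hc H x Hx.
destruct (Req_dec (g x) 0) as [E|E]; [exact E|exfalso].
assert (Hp : 0 < Rabs (g x)) by (apply Rabs_pos_lt; exact E).
destruct (proj1 (continuity_pt_locally g x) (Hc x) (mkposreal _ Hp)) as [d Hd].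
assert (Hy : exists y, a < y < b /\ Rabs (y - x) < d).
{ pose proof (cond_pos d).
  destruct (Rlt_dec x ((a + b) / 2)).
  - exists (x + Rmin (d / 2) ((b - a) / 4)).
    assert (0 < Rmin (d / 2) ((b - a) / 4)) by (apply Rmin_glb_lt; lra).
    pose proof (Rmin_l (d / 2) ((b - a) / 4)).
    pose proof (Rmin_r (d / 2) ((b - a) / 4)).
    split; [lra|]. rewrite Rabs_pos_eq; lra.
  - exists (x - Rmin (d / 2) ((b - a) / 4)).
    assert (0 < Rmin (d / 2) ((b - a) / 4)) by (apply Rmin_glb_lt; lra).
    pose proof (Rmin_l (d / 2) ((b - a) / 4)).
    pose proof (Rmin_r (d / 2) ((b - a) / 4)).
    split; [lra|]. rewrite Rabs_left; lra. }
destruct Hy as [y [Hy1 Hy2]].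
specialize (Hd y Hy2). rewrite (H y Hy1) in Hd. simpl in Hd.
replace (0 - g x) with (- g x) in Hd by ring. rewrite Rabs_Ropp in Hd. lra.
Qed.

(** Mean value theorem with derivatives needed only inside the interval. *)
Lemma mvt_open (g dg : R -> R) (a b : R) : a <= b ->
  (forall x, continuity_pt g x) ->
  (forall x, a < x < b -> is_derive g x (dg x)) ->
  exists x, a <= x <= b /\ g b - g a = dg x * (b - a).
Proof.
intros Hab Hc Hd.
destruct (MVT_gen g a b dg) as [x [Hx E]].
- rewrite Rmin_left, Rmax_right by exact Hab; exact Hd.
- intros x _; apply Hc.
- rewrite Rmin_left, Rmax_right in Hx by exact Hab. exists x; auto.
Qed.

Lemma constant_open (g : R -> R) (a b : R) : a <= b ->
  (forall x, continuity_pt g x) ->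
  (forall x, a < x < b -> is_derive g x 0) -> g a = g b.
Proof.
intros Hab Hc Hd.
destruct (mvt_open g (fun _ => 0) a b Hab Hc Hd) as [x [_ E]]; lra.
Qed.

Lemma increasing_open (g dg : R -> R) (a b : R) : a <= b ->
  (forall x, continuity_pt g x) ->
  (forall x, a < x < b -> is_derive g x (dg x) /\ 0 <= dg x) -> g a <= g b.
Proof.
intros Hab Hc Hd.
(* The mean point may be an end of the interval, where nothing is known of
   [dg]; hence the positive part. *)
destruct (mvt_open g (fun x => Rmax 0 (dg x)) a b Hab Hc) as [x [Hx E]].
- intros x Hx; destruct (Hd x Hx) as [H1 H2]; rewrite Rmax_right by exact H2; exact H1.
- assert (0 <= Rmax 0 (dg x)) by apply Rmax_l. nra.
Qed.

Lemma is_derive_RInt_cts (g : R -> R) (a x : R) :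
  (forall x, continuity_pt g x) -> is_derive (fun x => RInt g a x) x (g x).
Proof.
intros Hg. apply (is_derive_RInt (V := R_NormedModule) g (fun x => RInt g a x) a x).
- exists (mkposreal 1 Rlt_0_1); intros y _.
  apply (RInt_correct (V := R_CompleteNormedModule)), ex_RInt_cts, Hg.
- apply cts_of_pt, Hg.
Qed.

Lemma continuity_pt_is_derive (g : R -> R) (x l : R) :
  is_derive g x l -> continuity_pt g x.
Proof.
intros H; apply continuity_pt_filterlim.
apply (ex_derive_continuous (K := R_AbsRing) (V := R_NormedModule)).
exists l; exact H.
Qed.

(* Equations between integrals are typed in the codomain module, which hides
   the real equality from the arithmetic tactics. *)
Ltac real_eq := match goal with |- @eq _ ?x ?y => change (@eq R x y) end.

Lemma RInt_zero_fun (g : R -> R) (a b : R) : a <= b ->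
  (forall x, a < x < b -> g x = 0) -> RInt g a b = 0.
Proof.
intros Hab H. transitivity (RInt (fun _ : R => 0) a b).
- apply RInt_ext. intros x. rewrite Rmin_left, Rmax_right by exact Hab. apply H.
- rewrite RInt_const. apply Rmult_0_r.
Qed.

Lemma RInt_scal_cts (g : R -> R) (k a b : R) : (forall x, continuity_pt g x) ->
  RInt (fun x => k * g x) a b = k * RInt g a b.
Proof.
intros Hg. apply (RInt_scal (V := R_CompleteNormedModule) g), ex_RInt_cts, Hg.
Qed.

Lemma RInt_plus_cts (f g : R -> R) (a b : R) :
  (forall x, continuity_pt f x) -> (forall x, continuity_pt g x) ->
  RInt (fun x => f x + g x) a b = RInt f a b + RInt g a b.
Proof.
intros Hf Hg.
apply (RInt_plus (V := R_CompleteNormedModule) f g); apply ex_RInt_cts; assumption.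
Qed.

(** Fundamental theorem of calculus with derivatives needed only inside the
    interval. *)
Lemma RInt_derive_open (F f : R -> R) (a b : R) : a <= b ->
  (forall x, continuity_pt F x) -> (forall x, continuity_pt f x) ->
  (forall x, a < x < b -> is_derive F x (f x)) ->
  RInt f a b = F b - F a.
Proof.
intros Hab HF Hf Hd.
assert (E : RInt f a a - F a = RInt f a b - F b).
{ apply (constant_open (fun x => RInt f a x - F x) a b Hab).
  - intros x; apply continuity_pt_minus; [|apply HF].
    apply (continuity_pt_is_derive _ _ _ (is_derive_RInt_cts f a x Hf)).
  - intros x Hx. replace 0 with (minus (f x) (f x)) by (unfold minus, plus, opp; simpl; ring).
    apply (is_derive_minus (V := R_NormedModule)).
    + apply is_derive_RInt_cts, Hf.
    + apply Hd, Hx. }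
rewrite RInt_point in E. unfold zero in E; simpl in E. lra.
Qed.

Lemma RInt_zero_nonneg (g : R -> R) (a b : R) : a < b ->
  (forall x, continuity_pt g x) -> (forall x, a <= x <= b -> 0 <= g x) ->
  RInt g a b = 0 -> forall x, a <= x <= b -> g x = 0.
Proof.
intros Hab Hc Hp H0.
apply zero_closed; auto.
assert (HG : forall x, a < x < b -> RInt g a x = 0).
{ intros x Hx.
  assert (H1 : 0 <= RInt g a x).
  { apply RInt_ge_0; [lra|apply ex_RInt_cts, Hc|intros; apply Hp; lra]. }
  assert (H2 : 0 <= RInt g x b).
  { apply RInt_ge_0; [lra|apply ex_RInt_cts, Hc|intros; apply Hp; lra]. }
  pose proof (RInt_Chasles g a x b (ex_RInt_cts g a x Hc) (ex_RInt_cts g x b Hc)) as E.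
  unfold plus in E; simpl in E. lra. }
intros x Hx.
pose proof (is_derive_RInt_cts g a x Hc) as D1.
assert (D2 : is_derive (fun x => RInt g a x) x 0).
{ apply (is_derive_ext_loc (fun _ => 0)); [|apply (is_derive_const (V := R_NormedModule))].
  assert (Hpos : 0 < Rmin (x - a) (b - x)) by (apply Rmin_glb_lt; lra).
  exists (mkposreal _ Hpos); intros y Hy.
  unfold ball in Hy; simpl in Hy; unfold AbsRing_ball, abs, minus, plus, opp in Hy; simpl in Hy.
  apply Rabs_def2 in Hy.
  pose proof (Rmin_l (x - a) (b - x)). pose proof (Rmin_r (x - a) (b - x)).
  symmetry; apply HG; lra. }
rewrite <- (is_derive_unique _ _ _ D1). apply is_derive_unique, D2.
Qed.

Lemma RInt_le_abs (g : R -> R) (a b M : R) :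
  (forall x, continuity_pt g x) ->
  (forall x, Rmin a b <= x <= Rmax a b -> Rabs (g x) <= M) ->
  Rabs (RInt g a b) <= Rabs (b - a) * M.
Proof.
intros Hc.
assert (Hw : forall a b, a <= b -> (forall x, a <= x <= b -> Rabs (g x) <= M) ->
  Rabs (RInt g a b) <= (b - a) * M).
{ intros a' b' Hab HM.
  apply (norm_RInt_le_const (V := R_NormedModule) g a' b' (RInt g a' b') M Hab); [exact HM|].
  apply (RInt_correct (V := R_CompleteNormedModule)), ex_RInt_cts, Hc. }
intros HM. destruct (Rle_dec a b) as [Hab|Hab].
- rewrite Rmin_left, Rmax_right in HM by exact Hab.
  rewrite (Rabs_pos_eq (b - a)) by lra. apply Hw; auto.
- rewrite Rmin_right, Rmax_left in HM by lra.
  rewrite <- (opp_RInt_swap (V := R_CompleteNormedModule)) by (apply ex_RInt_cts; auto).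
  unfold opp; simpl; rewrite Rabs_Ropp, (Rabs_left (b - a)) by lra.
  replace (- (b - a)) with (a - b) by ring. apply Hw; auto; lra.
Qed.

Lemma bounded_above_segment (g : R -> R) (a b : R) :
  (forall x, continuity_pt g x) ->
  exists M, 0 < M /\ forall x, a <= x <= b -> Rabs (g x) <= M.
Proof.
intros Hc. destruct (Rle_dec a b) as [Hab|Hab].
- destruct (continuity_ab_maj (fun x => Rabs (g x)) a b Hab) as [Mx [HM _]].
  { intros c _. apply (continuity_pt_comp g Rabs); [apply Hc|apply Rcontinuity_abs]. }
  exists (Rabs (g Mx) + 1). split; [pose proof (Rabs_pos (g Mx)); lra|].
  intros x Hx; specialize (HM x Hx); simpl in HM; lra.
- exists 1; split; [lra|intros; lra].
Qed.

(** Joint continuity of an integral in its upper bound and a parameter. *)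
Lemma cont2_RInt (K : R -> R -> R) (a : R) :
  cont2 K -> cont2 (fun t x => RInt (K t) a x).
Proof.
intros HK t x eps.
assert (HKs : forall t x, continuity_pt (K t) x) by (intros; apply cont2_slice2, HK).
set (lo := Rmin a x - 1). set (hi := Rmax a x + 1).
pose proof (Rmin_l a x) as m1. pose proof (Rmin_r a x) as m2.
pose proof (Rmax_l a x) as m3. pose proof (Rmax_r a x) as m4.
assert (Hlen : 0 < hi - lo) by (unfold lo, hi; lra).
destruct (bounded_above_segment (K t) lo hi (HKs t)) as [M [HM0 HM]].
assert (He : 0 < eps / (2 * (hi - lo))).
{ apply Rdiv_lt_0_compat; [apply cond_pos|lra]. }
destruct (uniform_continuity_2d K (t - 1) (t + 1) lo hi (fun x y _ _ => HK x y)
  (mkposreal _ He)) as [d Hd].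
assert (Hd' : 0 < Rmin (Rmin d 1) (eps / (2 * M))).
{ apply Rmin_glb_lt; [apply Rmin_glb_lt; [apply cond_pos|lra]|].
  apply Rdiv_lt_0_compat; [apply cond_pos|lra]. }
exists (mkposreal _ Hd'). intros u v Hu Hv; simpl in Hu, Hv.
pose proof (Rmin_l (Rmin d 1) (eps / (2 * M))).
pose proof (Rmin_r (Rmin d 1) (eps / (2 * M))).
pose proof (Rmin_l d 1). pose proof (Rmin_r d 1).
assert (Hu1 : Rabs (u - t) < 1) by lra. assert (Hu2 : Rabs (u - t) < d) by lra.
assert (Hv1 : Rabs (v - x) < 1) by lra. assert (Hv2 : Rabs (v - x) < eps / (2 * M)) by lra.
apply Rabs_def2 in Hu1. apply Rabs_def2 in Hv1.
(* Move the parameter first, then the upper bound. *)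
assert (E : RInt (K u) a v - RInt (K t) a x
  = RInt (fun y => K u y - K t y) a v + RInt (K t) x v).
{ rewrite (RInt_minus (V := R_CompleteNormedModule) (K u) (K t))
    by (apply ex_RInt_cts; auto).
  pose proof (RInt_Chasles (K t) a x v
    (ex_RInt_cts _ a x (HKs t)) (ex_RInt_cts _ x v (HKs t))) as E.
  unfold plus in E; simpl in E. unfold minus, plus, opp; simpl. lra. }
rewrite E.
assert (B1 : Rabs (RInt (fun y => K u y - K t y) a v) <= eps / 2).
{ apply Rle_trans with (Rabs (v - a) * (eps / (2 * (hi - lo)))).
  - apply RInt_le_abs; [intros y; apply continuity_pt_minus; auto|].
    intros y Hy. apply Rlt_le.
    assert (lo <= y <= hi).
    { unfold lo, hi, Rmin, Rmax in *. repeat destruct Rle_dec; lra. }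
    apply (Hd t y u y); try lra. rewrite Rminus_diag, Rabs_R0; apply cond_pos.
  - replace (eps / 2) with ((hi - lo) * (eps / (2 * (hi - lo)))) by (field; lra).
    apply Rmult_le_compat_r; [lra|]. apply Rabs_le. unfold lo, hi; lra. }
assert (B2 : Rabs (RInt (K t) x v) < eps / 2).
{ apply Rle_lt_trans with (Rabs (v - x) * M).
  - apply RInt_le_abs; auto. intros y Hy; apply HM.
    unfold lo, hi, Rmin, Rmax in *. repeat destruct Rle_dec; lra.
  - replace (eps / 2) with (eps / (2 * M) * M) by (field; lra).
    apply Rmult_lt_compat_r; lra. }
eapply Rle_lt_trans; [apply Rabs_triang|]. lra.
Qed.

(** Differentiation under the integral sign. *)
Lemma is_derive_RInt_strip (K Kt : R -> R -> R) (a b t : R) : a <= b ->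
  cont2 K -> cont2 Kt ->
  locally t (fun t => forall x, a <= x <= b -> is_derive (fun t => K t x) t (Kt t x)) ->
  is_derive (fun t => RInt (K t) a b) t (RInt (Kt t) a b).
Proof.
intros Hab HK HKt HD.
set (cl x := Rmax a (Rmin b x)).
assert (Hcl : forall x, a <= cl x <= b).
{ intros x; unfold cl; split; [apply Rmax_l|]. apply Rmax_lub; [exact Hab|apply Rmin_l]. }
assert (Hcl2 : forall x, a <= x <= b -> cl x = x).
{ intros x Hx; unfold cl. rewrite Rmin_right, Rmax_right; lra. }
assert (Hclc : forall x, continuity_pt cl x).
{ intros x. apply continuity_pt_locally; intros eps; exists eps; intros y Hy.
  assert (Rabs (y - x) < eps) by exact Hy.
  unfold cl, Rmax, Rmin. apply Rabs_def2 in H. apply Rabs_def1;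
  repeat destruct Rle_dec; lra. }
(* The clamped integrand has the same integral and is differentiable for
   every value of the second variable. *)
assert (HD' : locally t (fun s => forall x, is_derive (fun t => K t (cl x)) s (Kt s (cl x)))).
{ destruct HD as [d Hd]; exists d; intros s Hs x. apply Hd; auto. }
apply (is_derive_ext (fun t => RInt (fun x => K t (cl x)) a b)).
{ intros s. apply RInt_ext. intros x. rewrite Rmin_left, Rmax_right by exact Hab.
  intros Hx; rewrite Hcl2; lra. }
replace (RInt (Kt t) a b) with (RInt (fun x => Derive (fun s => K s (cl x)) t) a b).
2:{ apply RInt_ext. intros x. rewrite Rmin_left, Rmax_right by exact Hab. intros Hx.
    transitivity (Kt t (cl x)).
    - apply is_derive_unique, (locally_singleton _ _ HD' x).
    - rewrite Hcl2; lra. }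
apply is_derive_RInt_param.
- destruct HD' as [d Hd]; exists d; intros s Hs x _. eexists; apply (Hd s Hs x).
- intros x _. apply (continuity_2d_pt_ext_loc (fun u v => Kt u (cl v))).
  + destruct HD' as [d Hd]; exists d; intros u v Hu _.
    symmetry; apply is_derive_unique. apply Hd; exact Hu.
  + intros eps. destruct (HKt t (cl x) eps) as [d Hd].
    destruct (proj1 (continuity_pt_locally cl x) (Hclc x) d) as [d2 Hd2].
    assert (H3 : 0 < Rmin d d2) by (apply Rmin_glb_lt; apply cond_pos).
    exists (mkposreal _ H3). intros u v Hu Hv; simpl in Hu, Hv.
    apply Hd; [eapply Rlt_le_trans; [exact Hu|apply Rmin_l]|].
    apply Hd2. eapply Rlt_le_trans; [exact Hv|apply Rmin_r].
- exists (mkposreal 1 Rlt_0_1); intros s _. apply ex_RInt_cts. intros x.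
  apply (continuity_pt_comp cl (K s)); [apply Hclc|apply cont2_slice2, HK].
Qed.

(** * Real-valued derivative rules *)

Lemma d_eq (f : R -> R) (x l l' : R) : l = l' -> is_derive f x l -> is_derive f x l'.
Proof. intros ->; auto. Qed.

Lemma d_plus (f g : R -> R) (x df dg : R) :
  is_derive f x df -> is_derive g x dg -> is_derive (fun x => f x + g x) x (df + dg).
Proof. apply (is_derive_plus (V := R_NormedModule)). Qed.

Lemma d_minus (f g : R -> R) (x df dg : R) :
  is_derive f x df -> is_derive g x dg -> is_derive (fun x => f x - g x) x (df - dg).
Proof. apply (is_derive_minus (V := R_NormedModule)). Qed.

Lemma d_opp (f : R -> R) (x df : R) :
  is_derive f x df -> is_derive (fun x => - f x) x (- df).
Proof. apply (is_derive_opp (V := R_NormedModule)). Qed.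

Lemma d_const (k x : R) : is_derive (fun _ => k) x 0.
Proof. apply (is_derive_const (V := R_NormedModule)). Qed.

Lemma d_id (x : R) : is_derive (fun x => x) x 1.
Proof. apply (is_derive_id (K := R_AbsRing)). Qed.

Lemma d_mult (f g : R -> R) (x df dg : R) :
  is_derive f x df -> is_derive g x dg ->
  is_derive (fun x => f x * g x) x (df * g x + f x * dg).
Proof. intros Hf Hg; apply (is_derive_mult f g x df dg Hf Hg); intros; apply Rmult_comm. Qed.

Lemma d_scal (k : R) (f : R -> R) (x df : R) :
  is_derive f x df -> is_derive (fun x => k * f x) x (k * df).
Proof. intros Hf; apply (is_derive_scal f x k df Hf). Qed.

Lemma d_comp (g f : R -> R) (x df dg : R) :
  is_derive g (f x) dg -> is_derive f x df -> is_derive (fun x => g (f x)) x (dg * df).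
Proof.
intros Hg Hf. apply (d_eq _ _ (df * dg)); [ring|].
apply (is_derive_comp (V := R_NormedModule) g f x dg df Hg Hf).
Qed.

(** * Functions on an interval with possibly infinite ends *)

(** The points strictly between two ends, and the points between them, finite
    ends included. *)
Definition inside (lo hi : Rbar) (t : R) : Prop := Rbar_lt lo t /\ Rbar_lt t hi.
Definition within_ends (lo hi : Rbar) (t : R) : Prop := Rbar_le lo t /\ Rbar_le t hi.

Lemma inside_within (lo hi : Rbar) (t : R) : inside lo hi t -> within_ends lo hi t.
Proof. intros [H1 H2]; split; apply Rbar_lt_le; assumption. Qed.

Lemma inside_between (lo hi : Rbar) (s t x : R) :
  within_ends lo hi s -> within_ends lo hi t -> s < x < t -> inside lo hi x.
Proof.
intros [H1 _] [_ H2] [H3 H4]; split.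
- apply (Rbar_le_lt_trans _ s); [exact H1|exact H3].
- apply (Rbar_lt_le_trans _ t); [exact H4|exact H2].
Qed.

Lemma within_between (lo hi : Rbar) (s t x : R) :
  within_ends lo hi s -> within_ends lo hi t -> s <= x <= t -> within_ends lo hi x.
Proof.
intros [H1 _] [_ H2] [H3 H4]; split.
- apply (Rbar_le_trans _ s); [exact H1|exact H3].
- apply (Rbar_le_trans _ t); [exact H4|exact H2].
Qed.

Lemma inside_locally (lo hi : Rbar) (t : R) :
  inside lo hi t -> locally t (inside lo hi).
Proof.
intros [H1 H2]; apply filter_and.
- apply (open_Rbar_gt' t lo H1).
- apply (open_Rbar_lt' t hi H2).
Qed.

Definition nondecreasing_on (lo hi : Rbar) (g : R -> R) : Prop :=
  forall s t, within_ends lo hi s -> within_ends lo hi t -> s <= t -> g s <= g t.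

Lemma nondecreasing_derive (lo hi : Rbar) (g dg : R -> R) :
  (forall t, continuity_pt g t) ->
  (forall t, inside lo hi t -> is_derive g t (dg t) /\ 0 <= dg t) ->
  nondecreasing_on lo hi g.
Proof.
intros Hc Hd s t Hs Ht Hst.
apply (increasing_open g dg s t Hst Hc).
intros x Hx; apply Hd, (inside_between lo hi s t); assumption.
Qed.

Lemma constant_derive (lo hi : Rbar) (g : R -> R) :
  (forall t, continuity_pt g t) ->
  (forall t, inside lo hi t -> is_derive g t 0) ->
  forall s t, within_ends lo hi s -> within_ends lo hi t -> g s = g t.
Proof.
intros Hc Hd.
assert (Hw : forall s t, within_ends lo hi s -> within_ends lo hi t -> s <= t -> g s = g t).
{ intros s t Hs Ht Hst. apply (constant_open g s t Hst Hc).
  intros x Hx; apply Hd, (inside_between lo hi s t); assumption. }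
intros s t Hs Ht. destruct (Rle_dec s t); [auto|symmetry; apply Hw; auto; lra].
Qed.

(** At each finite end of the interval, [g] vanishes. *)
Definition zero_at_finite_ends (lo hi : Rbar) (g : R -> R) : Prop :=
  (lo = m_infty \/ exists l, lo = Finite l /\ g l = 0) /\
  (hi = p_infty \/ exists h, hi = Finite h /\ g h = 0).

(** A bounded convex function whose derivative vanishes at the finite ends of
    the interval, if any, is constant: otherwise it would grow at least linearly
    in one direction. *)
Lemma bounded_convex_constant (lo hi : Rbar) (I W : R -> R) (B : R) :
  (forall t, continuity_pt I t) ->
  (forall t, inside lo hi t -> is_derive I t (W t)) ->
  nondecreasing_on lo hi W ->
  (forall t, within_ends lo hi t -> Rabs (I t) <= B) ->
  zero_at_finite_ends lo hi W ->
  forall t, within_ends lo hi t -> W t = 0.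
Proof.
intros Hc Hd Hm HB [Hlo Hhi] t Ht.
pose proof (HB t Ht) as Bt. apply Rabs_le_between in Bt.
destruct (Rtotal_order (W t) 0) as [H|[H|H]]; [exfalso|exact H|exfalso].
- destruct Hlo as [Hlo|[l [Hl Hl0]]].
  + set (s := t + (2 * B + 1) / W t).
    assert (Hst : s < t).
    { unfold s. assert (0 < (2 * B + 1) / - W t) by (apply Rdiv_lt_0_compat; lra).
      replace ((2 * B + 1) / W t) with (- ((2 * B + 1) / - W t)) by (field; lra). lra. }
    assert (Hs : within_ends lo hi s).
    { split; [rewrite Hlo; exact Logic.I|].
      apply (Rbar_le_trans _ t); [simpl; lra|apply Ht]. }
    destruct (mvt_open I W s t (Rlt_le _ _ Hst) Hc) as [x [Hx E]].
    { intros x Hx; apply Hd, (inside_between lo hi s t); assumption. }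
    assert (Hwx : W x <= W t).
    { apply Hm; try apply Hx; auto. apply (within_between lo hi s t); assumption. }
    pose proof (HB s Hs) as Bs. apply Rabs_le_between in Bs.
    assert (E2 : W t * (t - s) = - (2 * B + 1)) by (unfold s; field; lra).
    nra.
  + assert (W l <= W t); [|lra].
    destruct Ht as [Ht1 Ht2]. rewrite Hl in *. simpl in Ht1.
    apply Hm; [split; [apply Rbar_le_refl|exact (Rbar_le_trans l t hi Ht1 Ht2)]
              |split; [exact Ht1|exact Ht2]|exact Ht1].
- destruct Hhi as [Hhi|[h [Hh Hh0]]].
  + set (s := t + (2 * B + 1) / W t).
    assert (Hst : t < s).
    { unfold s. assert (0 < (2 * B + 1) / W t) by (apply Rdiv_lt_0_compat; lra). lra. }
    assert (Hs : within_ends lo hi s).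
    { split; [|rewrite Hhi; exact Logic.I].
      apply (Rbar_le_trans _ t); [apply Ht|simpl; lra]. }
    destruct (mvt_open I W t s (Rlt_le _ _ Hst) Hc) as [x [Hx E]].
    { intros x Hx; apply Hd, (inside_between lo hi t s); assumption. }
    assert (Hwx : W t <= W x).
    { apply Hm; try apply Hx; auto. apply (within_between lo hi t s); assumption. }
    pose proof (HB s Hs) as Bs. apply Rabs_le_between in Bs.
    assert (E2 : W t * (s - t) = 2 * B + 1) by (unfold s; field; lra).
    nra.
  + assert (W t <= W h); [|lra].
    destruct Ht as [Ht1 Ht2]. rewrite Hh in *. simpl in Ht2.
    apply Hm; [split; [exact Ht1|exact Ht2]
              |split; [exact (Rbar_le_trans lo t h Ht1 Ht2)|apply Rbar_le_refl]|exact Ht2].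
Qed.

(** The square of the positive part, a continuously differentiable cut-off. *)
Definition pos2 (x : R) : R := (Rmax 0 x) ^ 2.

Lemma pos2_ge_0 (x : R) : 0 <= pos2 x.
Proof. apply pow2_ge_0. Qed.

Lemma pos2_nonpos (x : R) : x <= 0 -> pos2 x = 0.
Proof. intros H; unfold pos2; rewrite Rmax_left by exact H; ring. Qed.

Lemma pos2_eq_0 (x : R) : pos2 x = 0 -> x <= 0.
Proof.
unfold pos2; intros H. destruct (Rle_dec x 0) as [Hx|Hx]; [exact Hx|].
rewrite Rmax_right in H by lra. nra.
Qed.

Lemma continuity_pt_pos_part (x : R) : continuity_pt (Rmax 0) x.
Proof.
apply continuity_pt_locally; intros eps; exists eps; intros y Hy.
assert (H : Rabs (y - x) < eps) by exact Hy.
apply Rabs_def2 in H; unfold Rmax; apply Rabs_def1; repeat destruct Rle_dec; lra.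
Qed.

Lemma is_derive_pos2 (x : R) : is_derive pos2 x (2 * Rmax 0 x).
Proof.
apply is_derive_Reals. intros eps Heps.
exists (mkposreal eps Heps); intros h Hh0 Hh; simpl in Hh.
(* The remainder of [pos2 (x + h)] is at most [h ^ 2] in absolute value. *)
assert (E : Rabs (pos2 (x + h) - pos2 x - 2 * Rmax 0 x * h) <= h * h).
{ unfold pos2, Rmax. apply Rabs_le; repeat destruct Rle_dec; nra. }
replace ((pos2 (x + h) - pos2 x) / h - 2 * Rmax 0 x)
  with ((pos2 (x + h) - pos2 x - 2 * Rmax 0 x * h) / h) by (field; exact Hh0).
unfold Rdiv; rewrite Rabs_mult, Rabs_inv.
assert (0 < Rabs h) by (apply Rabs_pos_lt; exact Hh0).
apply Rle_lt_trans with (Rabs h); [|exact Hh].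
apply (Rmult_le_reg_r (Rabs h)); [lra|].
rewrite Rmult_assoc, Rinv_l, Rmult_1_r by lra.
rewrite <- Rabs_mult, (Rabs_pos_eq (h * h)) by nra. exact E.
Qed.

Lemma continuity_pt_pos2 (x : R) : continuity_pt pos2 x.
Proof. exact (continuity_pt_is_derive _ _ _ (is_derive_pos2 x)). Qed.

Lemma continuity_pt_exp (x : R) : continuity_pt exp x.
Proof. apply derivable_continuous_pt, derivable_pt_exp. Qed.

Lemma same_sign_slice (g : R -> R) (a b lo hi : R) :
  (forall x, continuity_pt g x) -> lo <= a <= hi -> lo <= b <= hi ->
  (forall x, lo <= x <= hi -> g x <> 0) -> 0 < g a * g b.
Proof.
intros Hc Ha Hb Hn.
destruct (Rlt_dec 0 (g a * g b)) as [H|H]; [exact H|exfalso].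
destruct (IVT_gen g a b 0 Hc) as [x [Hx E]].
- unfold Rmin, Rmax; repeat destruct Rle_dec; nra.
- apply (Hn x); [|exact E].
  unfold Rmin, Rmax in Hx; repeat destruct Rle_dec in Hx; lra.
Qed.

(** * Flows on a strip *)

(** A stationary flow in logarithmic polar coordinates [t = ln r] and
    [0 <= th <= L]: [rad] is [r * u_r], [ang] is [r * u_theta] and [vor] is the
    vorticity; the other functions are their partial derivatives.  All functions
    are continuous on the whole plane, which dispenses with one-sided limits,
    but what they satisfy is required only in the strip. *)
Record strip_flow (lo hi : Rbar) (L c : R) := {
  rad : R -> R -> R;
  ang : R -> R -> R;
  vor : R -> R -> R;
  rad_th : R -> R -> R;
  ang_th : R -> R -> R;
  vor_t : R -> R -> R;
  vor_th : R -> R -> R;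
  rad_cont : cont2 rad;
  ang_cont : cont2 ang;
  vor_cont : cont2 vor;
  rad_th_cont : cont2 rad_th;
  ang_th_cont : cont2 ang_th;
  vor_t_cont : cont2 vor_t;
  vor_th_cont : cont2 vor_th;
  width_pos : 0 < L;
  incompressible : forall t th, inside lo hi t -> 0 <= th <= L ->
    is_derive (fun t => rad t th) t (- ang_th t th);
  vorticity_def : forall t th, inside lo hi t -> 0 <= th <= L ->
    is_derive (fun t => ang t th) t (rad_th t th + exp (2 * t) * vor t th);
  is_vor_t : forall t th, inside lo hi t -> 0 <= th <= L ->
    is_derive (fun t => vor t th) t (vor_t t th);
  is_rad_th : forall t th, inside lo hi t -> 0 < th < L ->
    is_derive (fun th => rad t th) th (rad_th t th);
  is_ang_th : forall t th, inside lo hi t -> 0 < th < L ->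
    is_derive (fun th => ang t th) th (ang_th t th);
  is_vor_th : forall t th, inside lo hi t -> 0 < th < L ->
    is_derive (fun th => vor t th) th (vor_th t th);
  vor_transported : forall t th, inside lo hi t -> 0 < th < L ->
    rad t th * vor_t t th + ang t th * vor_th t th = 0;
  ang_0 : forall t, within_ends lo hi t -> ang t 0 = c;
  ang_L : forall t, within_ends lo hi t -> ang t L = c;
  rad_periodic : forall t, within_ends lo hi t -> rad t 0 = rad t L;
  rad_nonzero : forall t th, within_ends lo hi t -> 0 <= th <= L -> rad t th <> 0
}.

Arguments rad {lo hi L c}.
Arguments ang {lo hi L c}.
Arguments vor {lo hi L c}.
Arguments rad_th {lo hi L c}.
Arguments ang_th {lo hi L c}.
Arguments vor_t {lo hi L c}.
Arguments vor_th {lo hi L c}.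
Arguments rad_cont {lo hi L c}.
Arguments ang_cont {lo hi L c}.
Arguments vor_cont {lo hi L c}.
Arguments rad_th_cont {lo hi L c}.
Arguments ang_th_cont {lo hi L c}.
Arguments vor_t_cont {lo hi L c}.
Arguments vor_th_cont {lo hi L c}.
Arguments width_pos {lo hi L c}.
Arguments incompressible {lo hi L c}.
Arguments vorticity_def {lo hi L c}.
Arguments is_vor_t {lo hi L c}.
Arguments is_rad_th {lo hi L c}.
Arguments is_ang_th {lo hi L c}.
Arguments is_vor_th {lo hi L c}.
Arguments vor_transported {lo hi L c}.
Arguments ang_0 {lo hi L c}.
Arguments ang_L {lo hi L c}.
Arguments rad_periodic {lo hi L c}.
Arguments rad_nonzero {lo hi L c}.

Ltac solve_cont2 :=
  repeat first
    [ assumption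
    | apply rad_cont | apply ang_cont | apply vor_cont | apply rad_th_cont
    | apply ang_th_cont | apply vor_t_cont | apply vor_th_cont
    | apply cont2_const
    | apply cont2_plus | apply cont2_minus | apply cont2_mult | apply cont2_opp
    | apply cont2_RInt ].

Lemma cont2_t : cont2 (fun t _ => t).
Proof. apply (cont2_fst (fun t => t)); intros; apply continuity_pt_id'. Qed.

Lemma cont2_th : cont2 (fun _ th => th).
Proof. apply (cont2_snd (fun t => t)); intros; apply continuity_pt_id'. Qed.

Lemma rad_same_sign {lo hi L c} (F : strip_flow lo hi L c) (t1 th1 t2 th2 : R) :
  within_ends lo hi t1 -> within_ends lo hi t2 -> 0 <= th1 <= L -> 0 <= th2 <= L ->
  0 < rad F t1 th1 * rad F t2 th2.
Proof.
intros Ht1 Ht2 Hth1 Hth2.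
assert (H1 : 0 < rad F t1 th1 * rad F t1 th2).
{ apply (same_sign_slice (rad F t1) th1 th2 0 L); auto.
  - intros x; apply cont2_slice2, rad_cont.
  - intros x Hx; apply (rad_nonzero F); auto. }
assert (H2 : 0 < rad F t1 th2 * rad F t2 th2).
{ apply (same_sign_slice (fun t => rad F t th2) t1 t2 (Rmin t1 t2) (Rmax t1 t2)).
  - intros x; apply (cont2_slice1 (rad F)), rad_cont.
  - split; [apply Rmin_l|apply Rmax_l].
  - split; [apply Rmin_r|apply Rmax_r].
  - intros x Hx; apply (rad_nonzero F); auto.
    unfold Rmin, Rmax in Hx; destruct Rle_dec.
    + apply (within_between lo hi t1 t2); auto.
    + apply (within_between lo hi t2 t1); auto. }
pose proof (rad_nonzero F t1 th2 Ht1 Hth2). nra.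
Qed.

(** A quantity carried by the flow has a flux through a circle which varies
    only by what crosses the two sides. *)
Lemma flux_derive {lo hi L c} (F : strip_flow lo hi L c) (m mt mth : R -> R -> R) :
  cont2 m -> cont2 mt -> cont2 mth ->
  (forall t th, inside lo hi t -> 0 <= th <= L -> is_derive (fun t => m t th) t (mt t th)) ->
  (forall t th, inside lo hi t -> 0 < th < L -> is_derive (fun th => m t th) th (mth t th)) ->
  (forall t th, inside lo hi t -> 0 < th < L ->
     rad F t th * mt t th + ang F t th * mth t th = 0) ->
  forall t, inside lo hi t ->
  is_derive (fun t => RInt (fun th => rad F t th * m t th) 0 L) t (c * (m t 0 - m t L)).
Proof.
intros Hm Hmt Hmth Dt Dth Htr t Ht.
pose proof (width_pos F) as HL.
apply (d_eq _ _ (RInt (fun th => - ang_th F t th * m t th + rad F t th * mt t th) 0 L)).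
- assert (E : RInt (fun th => - (ang_th F t th * m t th + ang F t th * mth t th)) 0 L
    = - (ang F t L * m t L) - - (ang F t 0 * m t 0)).
  { apply (RInt_derive_open (fun th => - (ang F t th * m t th))); [lra| | |].
    - intros x; apply (cont2_slice2 (fun t th => - (ang F t th * m t th))); solve_cont2.
    - intros x; apply (cont2_slice2
        (fun t th => - (ang_th F t th * m t th + ang F t th * mth t th))); solve_cont2.
    - intros x Hx; apply d_opp, d_mult; [apply (is_ang_th F)|apply Dth]; auto. }
  rewrite (ang_0 F), (ang_L F) in E by (apply inside_within; exact Ht).
  transitivity (RInt (fun th => - (ang_th F t th * m t th + ang F t th * mth t th)) 0 L).
  + apply RInt_ext. intros x. rewrite Rmin_left, Rmax_right by lra. intros Hx.
    pose proof (Htr t x Ht Hx). lra.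
  + rewrite E; ring.
- apply (is_derive_RInt_strip (fun t th => rad F t th * m t th)
    (fun t th => - ang_th F t th * m t th + rad F t th * mt t th)); [lra| | |].
  + solve_cont2.
  + solve_cont2.
  + generalize (inside_locally lo hi t Ht). apply filter_imp. intros s Hs x Hx.
    apply (d_mult (fun t => rad F t x) (fun t => m t x));
      [apply (incompressible F)|apply Dt]; auto.
Qed.

(** Minus the flux of [rad] between the side [th = 0] and the point.  The stream
    function itself is [c * t + stream F t th]; this bounded part of it vanishes
    on the side [th = 0]. *)
Definition stream {lo hi L c} (F : strip_flow lo hi L c) (t th : R) : R :=
  - RInt (rad F t) 0 th.

Lemma stream_cont {lo hi L c} (F : strip_flow lo hi L c) : cont2 (stream F).
Proof. unfold stream; solve_cont2. Qed.

Lemma stream_0 {lo hi L c} (F : strip_flow lo hi L c) (t : R) : stream F t 0 = 0.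
Proof. unfold stream; rewrite RInt_point; unfold zero; simpl; ring. Qed.

Lemma is_stream_th {lo hi L c} (F : strip_flow lo hi L c) (t th : R) :
  is_derive (fun th => stream F t th) th (- rad F t th).
Proof.
apply d_opp, is_derive_RInt_cts. intros x; apply cont2_slice2, rad_cont.
Qed.

Lemma is_stream_t {lo hi L c} (F : strip_flow lo hi L c) (t th : R) :
  inside lo hi t -> 0 <= th <= L ->
  is_derive (fun t => stream F t th) t (ang F t th - c).
Proof.
intros Ht Hth.
apply (d_eq _ _ (- RInt (fun x => - ang_th F t x) 0 th)).
- assert (E : RInt (fun x => - ang_th F t x) 0 th = - ang F t th - - ang F t 0).
  { apply (RInt_derive_open (fun x => - ang F t x)); [lra| | |].
    - intros x; apply (cont2_slice2 (fun t x => - ang F t x)); solve_cont2.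
    - intros x; apply (cont2_slice2 (fun t x => - ang_th F t x)); solve_cont2.
    - intros x Hx; apply d_opp, (is_ang_th F); [auto|lra]. }
  rewrite E, (ang_0 F) by (apply inside_within; exact Ht). ring.
- apply d_opp, (is_derive_RInt_strip (rad F) (fun t th => - ang_th F t th)); [lra| | |].
  + solve_cont2.
  + solve_cont2.
  + generalize (inside_locally lo hi t Ht). apply filter_imp. intros s Hs x Hx.
    apply (incompressible F); [exact Hs|lra].
Qed.

Lemma stream_L_constant {lo hi L c} (F : strip_flow lo hi L c) (s t : R) :
  within_ends lo hi s -> within_ends lo hi t -> stream F s L = stream F t L.
Proof.
apply (constant_derive lo hi (fun t => stream F t L)).
- intros x; apply (cont2_slice1 (stream F)), stream_cont.
- intros x Hx. pose proof (width_pos F).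
  apply (d_eq _ _ (ang F x L - c)); [|apply is_stream_t; [exact Hx|lra]].
  rewrite (ang_L F) by (apply inside_within; exact Hx); ring.
Qed.

Lemma stream_monotone {lo hi L c} (F : strip_flow lo hi L c) (k t a b : R) :
  0 <= a -> a <= b -> b <= L ->
  (forall th, 0 <= th <= L -> 0 < k * rad F t th) ->
  k * stream F t b <= k * stream F t a.
Proof.
intros Ha Hab Hb Hk.
assert (H : - (k * stream F t a) <= - (k * stream F t b)); [|lra].
apply (increasing_open (fun th => - (k * stream F t th)) (fun th => - (k * - rad F t th)) a b Hab).
- intros x; apply (cont2_slice2 (fun t x => - (k * stream F t x))).
  pose proof (stream_cont F); solve_cont2.
- intros x Hx; split; [apply d_opp, d_scal, is_stream_th|].
  assert (0 < k * rad F t x) by (apply Hk; lra). lra.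
Qed.

Lemma stream_bound {lo hi L c} (F : strip_flow lo hi L c) (t th : R) :
  within_ends lo hi t -> 0 <= th <= L -> Rabs (stream F t th) <= Rabs (stream F t L).
Proof.
intros Ht Hth. pose proof (width_pos F) as HL.
assert (Hk : exists k, (k = 1 \/ k = -1) /\ forall th, 0 <= th <= L -> 0 < k * rad F t th).
{ assert (Hs : forall th, 0 <= th <= L -> 0 < rad F t 0 * rad F t th)
    by (intros x Hx; apply rad_same_sign; auto; lra).
  assert (H0 : rad F t 0 <> 0) by (apply (rad_nonzero F); auto; lra).
  destruct (Rlt_dec 0 (rad F t 0)); [exists 1|exists (-1)]; (split; [auto|]);
    intros x Hx; specialize (Hs x Hx); nra. }
destruct Hk as [k [Hk1 Hk]].
pose proof (stream_monotone F k t 0 th) as M1.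
pose proof (stream_monotone F k t th L) as M2.
rewrite stream_0 in M1.
assert (k * stream F t th <= 0) by (rewrite <- (Rmult_0_r k); apply M1; auto; lra).
assert (k * stream F t L <= k * stream F t th) by (apply M2; auto; lra).
destruct Hk1 as [->| ->]; unfold Rabs; repeat destruct Rcase_abs; lra.
Qed.

(** * The vorticity vanishes *)

(** If the weighted integral of a nonnegative function against [rad] vanishes
    on a circle, so does the function. *)
Lemma flux_zero {lo hi L c} (F : strip_flow lo hi L c) (m : R -> R) (t : R) :
  (forall x, continuity_pt m x) -> within_ends lo hi t ->
  (forall th, 0 <= th <= L -> 0 <= m th) ->
  RInt (fun th => rad F t th * m th) 0 L = 0 ->
  forall th, 0 <= th <= L -> m th = 0.
Proof.
intros Hm Ht Hp H0 th Hth.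
pose proof (width_pos F) as HL.
assert (Hs : forall x, 0 <= x <= L -> 0 < rad F t 0 * rad F t x).
{ intros x Hx; apply rad_same_sign; auto; lra. }
assert (Hc : forall x, continuity_pt (fun x => rad F t 0 * (rad F t x * m x)) x).
{ intros x. apply continuity_pt_mult; [apply continuity_pt_cst|].
  apply continuity_pt_mult; [apply cont2_slice2, rad_cont|apply Hm]. }
assert (E : rad F t 0 * (rad F t th * m th) = 0).
{ apply (RInt_zero_nonneg (fun x => rad F t 0 * (rad F t x * m x)) 0 L); auto.
  - intros x Hx. pose proof (Hs x Hx). pose proof (Hp x Hx).
    rewrite <- Rmult_assoc. apply Rmult_le_pos; lra.
  - transitivity (rad F t 0 * RInt (fun th => rad F t th * m th) 0 L).
    + apply (RInt_scal_cts (fun x => rad F t x * m x)). intros x.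
      apply continuity_pt_mult; [apply cont2_slice2, rad_cont|apply Hm].
    + rewrite H0; real_eq; ring. }
pose proof (Hs th Hth) as H1. rewrite <- Rmult_assoc in E.
apply Rmult_integral in E; destruct E; lra.
Qed.

Lemma flux_cont {lo hi L c} (F : strip_flow lo hi L c) (m : R -> R -> R) (t : R) :
  cont2 m -> continuity_pt (fun t => RInt (fun th => rad F t th * m t th) 0 L) t.
Proof.
intros Hm.
apply (cont2_slice1 (fun t x => RInt (fun th => rad F t th * m t th) 0 x)).
apply (cont2_RInt (fun t th => rad F t th * m t th)). solve_cont2.
Qed.

(** When the two sides are stream lines, the flux of any function of the
    vorticity is the same through all circles. *)
Lemma vor_flux_constant {lo hi L} (F : strip_flow lo hi L 0) (g dg : R -> R) :
  (forall x, is_derive g x (dg x)) -> (forall x, continuity_pt dg x) ->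
  forall s t, within_ends lo hi s -> within_ends lo hi t ->
  RInt (fun th => rad F s th * g (vor F s th)) 0 L =
  RInt (fun th => rad F t th * g (vor F t th)) 0 L.
Proof.
intros Hg Hdg.
assert (Hgc : cont2 (fun t th => g (vor F t th))).
{ apply cont2_comp; [|apply vor_cont].
  intros x; exact (continuity_pt_is_derive _ _ _ (Hg x)). }
assert (Hdgc : cont2 (fun t th => dg (vor F t th)))
  by (apply cont2_comp; [exact Hdg|apply vor_cont]).
apply (constant_derive lo hi (fun t => RInt (fun th => rad F t th * g (vor F t th)) 0 L)).
- intros t; apply (flux_cont F (fun t th => g (vor F t th))), Hgc.
- intros t Ht.
  apply (d_eq _ _ (0 * (g (vor F t 0) - g (vor F t L)))); [ring|].
  apply (flux_derive F (fun t th => g (vor F t th))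
    (fun t th => dg (vor F t th) * vor_t F t th)
    (fun t th => dg (vor F t th) * vor_th F t th)); auto.
  + solve_cont2.
  + solve_cont2.
  + intros s th Hs Hth. apply (d_comp g (fun t => vor F t th)); [apply Hg|].
    apply (is_vor_t F); auto.
  + intros s th Hs Hth. apply (d_comp g (fun th => vor F s th)); [apply Hg|].
    apply (is_vor_th F); auto.
  + intros s th Hs Hth. pose proof (vor_transported F s th Hs Hth) as E.
    transitivity (dg (vor F s th) * (rad F s th * vor_t F s th + ang F s th * vor_th F s th));
      [ring|rewrite E; ring].
Qed.

(** A sign of the vorticity on one circle is carried to the whole strip. *)
Lemma vor_sign_spreads {lo hi L} (F : strip_flow lo hi L 0) (k t0 : R) :
  within_ends lo hi t0 ->
  (forall th, 0 <= th <= L -> 0 <= k * vor F t0 th) ->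
  forall t th, within_ends lo hi t -> 0 <= th <= L -> 0 <= k * vor F t th.
Proof.
intros Ht0 Hs t th Ht Hth.
pose proof (width_pos F) as HL.
set (g x := pos2 (- k * x)).
assert (E : RInt (fun th => rad F t th * g (vor F t th)) 0 L = 0).
{ rewrite (vor_flux_constant F g (fun x => 2 * Rmax 0 (- k * x) * - k)) with (t := t0); auto.
  - apply RInt_zero_fun; [lra|]. intros x Hx.
    unfold g; rewrite pos2_nonpos; [ring|].
    assert (0 <= k * vor F t0 x) by (apply Hs; lra). lra.
  - intros x. apply (d_comp pos2 (fun x => - k * x)); [apply is_derive_pos2|].
    apply (d_eq _ _ (- k * 1)); [ring|]. apply d_scal, d_id.
  - intros x. apply continuity_pt_mult;
      [|apply continuity_pt_cst].
    apply (continuity_pt_mult (fun _ => 2) (fun x => Rmax 0 (- k * x)));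
      [apply continuity_pt_cst|].
    apply (continuity_pt_comp (fun x => - k * x) (Rmax 0)); [|apply continuity_pt_pos_part].
    apply continuity_pt_mult;
      [apply continuity_pt_cst|apply continuity_pt_id']. }
assert (H0 : g (vor F t th) = 0).
{ apply (flux_zero F (fun th => g (vor F t th)) t); auto.
  - intros x. apply (continuity_pt_comp (vor F t) g); [apply cont2_slice2, vor_cont|].
    unfold g. apply (continuity_pt_comp (fun x => - k * x) pos2); [|apply continuity_pt_pos2].
    apply continuity_pt_mult;
      [apply continuity_pt_cst|apply continuity_pt_id'].
  - intros x Hx; apply pos2_ge_0. }
apply pos2_eq_0 in H0. lra.
Qed.

(** If the flow has the same radial part on the two end circles and vorticities
    differing by a factor other than [1] and [-1], the vorticity vanishes. *)
Lemma vor_zero_scaled {lo hi L} (F : strip_flow lo hi L 0) (l h k : R) :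
  lo = Finite l -> hi = Finite h -> l <= h -> 1 < k ^ 2 ->
  (forall th, 0 <= th <= L -> rad F l th = rad F h th) ->
  (forall th, 0 <= th <= L -> vor F l th = k * vor F h th) ->
  forall t th, within_ends lo hi t -> 0 <= th <= L -> vor F t th = 0.
Proof.
intros Hlo Hhi. subst lo hi. intros Hlh Hk Hr Hv t th Ht Hth.
pose proof (width_pos F) as HL.
assert (Hl : within_ends (Finite l) (Finite h) l) by (split; simpl; lra).
assert (Hh : within_ends (Finite l) (Finite h) h) by (split; simpl; lra).
set (g x := x * x).
assert (Hg : forall x, is_derive g x (1 * x + x * 1)).
{ intros x; apply (d_mult (fun x => x) (fun x => x)); apply d_id. }
assert (Hgc : forall x, continuity_pt g x)
  by (intros x; exact (continuity_pt_is_derive _ _ _ (Hg x))).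
assert (Hdg : forall x, continuity_pt (fun x => 1 * x + x * 1) x).
{ intros x; apply (continuity_pt_plus (fun x => 1 * x) (fun x => x * 1));
    apply continuity_pt_mult;
    try apply continuity_pt_id'; apply continuity_pt_cst. }
pose proof (vor_flux_constant F g _ Hg Hdg l h Hl Hh) as E.
assert (E2 : RInt (fun th => rad F l th * g (vor F l th)) 0 L
  = k ^ 2 * RInt (fun th => rad F h th * g (vor F h th)) 0 L).
{ transitivity (RInt (fun th => k ^ 2 * (rad F h th * g (vor F h th))) 0 L).
  - apply RInt_ext. intros x. rewrite Rmin_left, Rmax_right by lra. intros Hx.
    rewrite Hr, Hv by lra. unfold g; real_eq; ring.
  - apply (RInt_scal_cts (fun th => rad F h th * g (vor F h th))). intros x.
    apply continuity_pt_mult; [apply cont2_slice2, rad_cont|].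
    apply (continuity_pt_comp (vor F h) g); [apply cont2_slice2, vor_cont|apply Hgc]. }
assert (E3 : RInt (fun th => rad F h th * g (vor F h th)) 0 L = 0) by nra.
rewrite (vor_flux_constant F g _ Hg Hdg h t Hh Ht) in E3.
assert (H0 : g (vor F t th) = 0).
{ apply (flux_zero F (fun th => g (vor F t th)) t); auto.
  - intros x. apply (continuity_pt_comp (vor F t) g); [apply cont2_slice2, vor_cont|apply Hgc].
  - intros x Hx; unfold g; nra. }
unfold g in H0; nra.
Qed.

(** The logarithmic radius at which the stream line through a point meets the
    side [th = e], where [e = 0] or [e = L] and [stream] takes the value [qe]:
    the stream function [c * t + stream F t th] is constant on stream lines. *)
Definition entry {lo hi L c} (F : strip_flow lo hi L c) (qe t th : R) : R :=
  t + / c * (stream F t th - qe).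

Lemma entry_cont {lo hi L c} (F : strip_flow lo hi L c) (qe : R) : cont2 (entry F qe).
Proof.
unfold entry. pose proof (stream_cont F). pose proof cont2_t. solve_cont2.
Qed.

Lemma is_entry_t {lo hi L c} (F : strip_flow lo hi L c) (qe t th : R) :
  c <> 0 -> inside lo hi t -> 0 <= th <= L ->
  is_derive (fun t => entry F qe t th) t (/ c * ang F t th).
Proof.
intros Hc Ht Hth.
apply (d_eq _ _ (1 + / c * (ang F t th - c - 0))); [field; exact Hc|].
apply (d_plus (fun t => t)); [apply d_id|].
apply d_scal, d_minus; [apply is_stream_t; auto|apply d_const].
Qed.

Lemma is_entry_th {lo hi L c} (F : strip_flow lo hi L c) (qe t th : R) :
  is_derive (fun th => entry F qe t th) th (- / c * rad F t th).
Proof.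
apply (d_eq _ _ (0 + / c * (- rad F t th - 0))); [ring|].
apply (d_plus (fun _ => t)); [apply d_const|].
apply d_scal, d_minus; [apply is_stream_th|apply d_const].
Qed.

(** When the sides are crossed by the flow, the vorticity on a side determines
    it everywhere, provided the stream lines through the strip reach that side
    before leaving the strip: [d = 1] if they meet it at smaller radii, [d = -1]
    if they meet it at larger radii. *)
Lemma vor_from_side {lo hi L c} (F : strip_flow lo hi L c) (A e d qe : R) :
  c <> 0 ->
  (d = 1 /\ lo = m_infty \/ d = -1 /\ hi = p_infty) ->
  (e = 0 /\ (forall t th, within_ends lo hi t -> 0 <= th <= L -> 0 < d * c * rad F t th) \/
   e = L /\ (forall t th, within_ends lo hi t -> 0 <= th <= L -> 0 < - (d * c) * rad F t th)) ->
  (forall t, within_ends lo hi t -> stream F t e = qe) ->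
  (forall t, inside lo hi t -> exp (2 * t) * vor F t e = - A) ->
  forall t th, inside lo hi t -> 0 <= th <= L ->
  vor F t th = - A * exp (- 2 * entry F qe t th).
Proof.
intros Hc Hd He Hqe Hside t0 th0 Ht0 Hth0.
pose proof (width_pos F) as HL.
assert (He0 : 0 <= e <= L) by (destruct He as [[-> _]|[-> _]]; lra).
assert (Hd2 : d * d = 1) by (destruct Hd as [[-> _]|[-> _]]; ring).
pose proof (inside_within _ _ _ Ht0) as Ht0'.
(* The multiple of [c] for which [k * rad] is positive. *)
pose (k := if Req_dec_T e 0 then d * c else - (d * c)).
assert (Hk : forall t th, within_ends lo hi t -> 0 <= th <= L -> 0 < k * rad F t th).
{ unfold k; destruct Req_dec_T; destruct He as [[E H]|[E H]]; auto; lra. }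
(* Stream lines meet the side in the direction given by [d]. *)
assert (Hdir : forall t th, within_ends lo hi t -> 0 <= th <= L ->
  d * (entry F qe t th - t) <= 0).
{ intros t th Ht Hth. unfold entry.
  replace (d * (t + / c * (stream F t th - qe) - t))
    with (/ (c * c) * (d * c * stream F t th - d * c * qe)) by (field; exact Hc).
  assert (0 < / (c * c)) by (apply Rinv_0_lt_compat; nra).
  assert (d * c * stream F t th <= d * c * qe); [|nra].
  rewrite <- (Hqe t Ht). destruct He as [[-> H']|[-> H']].
  - apply (stream_monotone F (d * c) t 0 th); try lra. intros x Hx; apply H'; auto.
  - pose proof (stream_monotone F (- (d * c)) t th L) as M.
    assert (- (d * c) * stream F t L <= - (d * c) * stream F t th); [|lra].
    apply M; try lra. intros x Hx; apply H'; auto. }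
(* Far enough in that direction, no stream line through the circle [t0] is left. *)
set (M := 2 * Rabs (stream F t0 L) * / Rabs c).
assert (HM : forall th, 0 <= th <= L -> Rabs (entry F qe t0 th - t0) <= M).
{ intros th Hth. unfold entry.
  replace (t0 + / c * (stream F t0 th - qe) - t0) with (/ c * (stream F t0 th - qe)) by ring.
  rewrite Rabs_mult, Rabs_inv. unfold M.
  assert (0 < / Rabs c) by (apply Rinv_0_lt_compat, Rabs_pos_lt, Hc).
  rewrite Rmult_comm. apply Rmult_le_compat_r; [lra|].
  rewrite <- (Hqe t0 Ht0').
  pose proof (stream_bound F t0 th Ht0' Hth). pose proof (stream_bound F t0 e Ht0' He0).
  replace (stream F t0 th - stream F t0 e) with (stream F t0 th + - stream F t0 e) by ring.
  eapply Rle_trans; [apply Rabs_triang|]. rewrite Rabs_Ropp. lra. }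
assert (HM0 : 0 <= M) by (eapply Rle_trans; [apply Rabs_pos|apply (HM 0); lra]).
set (t1 := t0 - d * (M + 1)).
assert (Ht1 : within_ends lo hi t1).
{ unfold t1. destruct Hd as [[-> Hlo]|[-> Hhi]]; split.
  - rewrite Hlo; exact Logic.I.
  - apply (Rbar_le_trans _ t0); [simpl; lra|apply Ht0'].
  - apply (Rbar_le_trans _ t0); [apply Ht0'|simpl; lra].
  - rewrite Hhi; exact Logic.I. }
set (eta t th := vor F t th + A * exp (- 2 * entry F qe t th)).
set (phi t th := pos2 (d * (entry F qe t th - t1))).
set (dphi t th := 2 * Rmax 0 (d * (entry F qe t th - t1))).
pose proof (entry_cont F qe) as Cen.
assert (Cexp : cont2 (fun t th => exp (- 2 * entry F qe t th))).
{ apply (cont2_comp exp (fun t th => - 2 * entry F qe t th)); [apply continuity_pt_exp|].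
  solve_cont2. }
assert (Ceta : cont2 eta) by (unfold eta; solve_cont2).
assert (Cphi : cont2 phi).
{ apply (cont2_comp pos2 (fun t th => d * (entry F qe t th - t1)));
    [apply continuity_pt_pos2|solve_cont2]. }
assert (Cdphi : cont2 dphi).
{ unfold dphi. apply cont2_mult; [apply cont2_const|].
  apply (cont2_comp (Rmax 0) (fun t th => d * (entry F qe t th - t1)));
    [apply continuity_pt_pos_part|solve_cont2]. }
set (m t th := eta t th * eta t th * phi t th).
(* The derivative of [m] in a variable in which the vorticity and [entry] have
   derivatives [dv] and [de]. *)
set (dm t th dv de :=
  ((dv + A * (exp (- 2 * entry F qe t th) * (- 2 * de))) * eta t th
   + eta t th * (dv + A * (exp (- 2 * entry F qe t th) * (- 2 * de)))) * phi t th
  + eta t th * eta t th * (dphi t th * (d * (de - 0)))).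
assert (Cm : cont2 m) by (unfold m; solve_cont2).
assert (Hder : forall (v en : R -> R) (x dv de : R), is_derive v x dv -> is_derive en x de ->
  is_derive (fun x => (v x + A * exp (- 2 * en x)) * (v x + A * exp (- 2 * en x))
     * pos2 (d * (en x - t1))) x
   (((dv + A * (exp (- 2 * en x) * (- 2 * de))) * (v x + A * exp (- 2 * en x))
     + (v x + A * exp (- 2 * en x)) * (dv + A * (exp (- 2 * en x) * (- 2 * de))))
      * pos2 (d * (en x - t1))
    + (v x + A * exp (- 2 * en x)) * (v x + A * exp (- 2 * en x))
      * ((2 * Rmax 0 (d * (en x - t1))) * (d * (de - 0))))).
{ intros v en x dv de Dv De.
  assert (De2 : is_derive (fun x => v x + A * exp (- 2 * en x)) x
    (dv + A * (exp (- 2 * en x) * (- 2 * de)))).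
  { apply (d_plus v); [exact Dv|]. apply d_scal.
    apply (d_comp exp (fun x => - 2 * en x)); [|apply d_scal, De].
    apply is_derive_Reals, derivable_pt_lim_exp. }
  apply (d_mult (fun x => (v x + A * exp (- 2 * en x)) * (v x + A * exp (- 2 * en x)))
    (fun x => pos2 (d * (en x - t1)))).
  - apply (d_mult (fun x => v x + A * exp (- 2 * en x)) (fun x => v x + A * exp (- 2 * en x)));
      exact De2.
  - apply (d_comp pos2 (fun x => d * (en x - t1))); [apply is_derive_pos2|].
    apply d_scal, d_minus; [exact De|apply d_const]. }
set (N t := RInt (fun th => rad F t th * m t th) 0 L).
assert (DN : forall t, inside lo hi t -> is_derive N t (c * (m t 0 - m t L))).
{ apply (flux_derive F m
    (fun t th => dm t th (vor_t F t th) (/ c * ang F t th))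
    (fun t th => dm t th (vor_th F t th) (- / c * rad F t th))).
  - exact Cm.
  - unfold dm; solve_cont2.
  - unfold dm; solve_cont2.
  - intros t th Ht Hth.
    apply (Hder (fun t => vor F t th) (fun t => entry F qe t th)).
    + apply (is_vor_t F); auto.
    + apply is_entry_t; auto.
  - intros t th Ht Hth.
    apply (Hder (fun th => vor F t th) (fun th => entry F qe t th)).
    + apply (is_vor_th F); auto.
    + apply is_entry_th.
  - intros t th Ht Hth. pose proof (vor_transported F t th Ht Hth) as E.
    unfold dm.
    transitivity (2 * eta t th * phi t th
      * (rad F t th * vor_t F t th + ang F t th * vor_th F t th)); [ring|rewrite E; ring]. }
assert (Hmpos : forall t th, 0 <= m t th).
{ intros t th. unfold m. apply Rmult_le_pos; [nra|apply pos2_ge_0]. }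
assert (Hme : forall t, inside lo hi t -> m t e = 0).
{ intros t Ht. pose proof (inside_within _ _ _ Ht) as Ht'.
  assert (E : eta t e = 0).
  { unfold eta, entry. rewrite (Hqe t Ht').
    replace (- 2 * (t + / c * (qe - qe))) with (- (2 * t)) by ring.
    rewrite exp_Ropp. pose proof (Hside t Ht). pose proof (exp_pos (2 * t)).
    apply (Rmult_eq_reg_l (exp (2 * t))); [|lra].
    rewrite Rmult_plus_distr_l, H. field; lra. }
  unfold m; rewrite E; ring. }
assert (Hmono : nondecreasing_on lo hi (fun t => - (d * k) * N t)).
{ apply (nondecreasing_derive lo hi _ (fun t => - (d * k) * (c * (m t 0 - m t L)))).
  - intros t; apply continuity_pt_mult; [apply continuity_pt_cst|].
    apply flux_cont, Cm.
  - intros t Ht; split; [apply d_scal, DN, Ht|].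
    pose proof (Hme t Ht) as E.
    pose proof (Hmpos t 0) as P0. pose proof (Hmpos t L) as PL.
    assert (Hcc : 0 <= c * c) by nra.
    unfold k; destruct Req_dec_T as [E0|E0].
    + rewrite E0 in E; rewrite E.
      replace (- (d * (d * c)) * (c * (0 - m t L))) with (d * d * (c * c * m t L)) by ring.
      rewrite Hd2; apply Rmult_le_pos; [lra|apply Rmult_le_pos; lra].
    + destruct He as [[He1 _]|[He1 _]]; [lra|]. rewrite He1 in E; rewrite E.
      replace (- (d * - (d * c)) * (c * (m t 0 - 0))) with (d * d * (c * c * m t 0)) by ring.
      rewrite Hd2; apply Rmult_le_pos; [lra|apply Rmult_le_pos; lra]. }
assert (HN1 : N t1 = 0).
{ apply RInt_zero_fun; [lra|]. intros x Hx.
  unfold m, phi. rewrite pos2_nonpos; [ring|]. apply Hdir; [exact Ht1|lra]. }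
assert (HkN : k * N t0 <= 0).
{ destruct Hd as [[E _]|[E _]].
  - pose proof (Hmono t1 t0 Ht1 Ht0') as H. cbv beta in H. rewrite HN1, E in H.
    assert (t1 <= t0) by (unfold t1; rewrite E; lra). specialize (H H0). lra.
  - pose proof (Hmono t0 t1 Ht0' Ht1) as H. cbv beta in H. rewrite HN1, E in H.
    assert (t0 <= t1) by (unfold t1; rewrite E; lra). specialize (H H0). lra. }
assert (HkN2 : k * N t0 = RInt (fun th => k * (rad F t0 th * m t0 th)) 0 L).
{ symmetry. apply (RInt_scal_cts (fun x => rad F t0 x * m t0 x)). intros x.
  apply (cont2_slice2 (fun t x => rad F t x * m t x)). solve_cont2. }
assert (HkN3 : 0 <= k * N t0).
{ rewrite HkN2. apply RInt_ge_0; [lra| |].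
  - apply ex_RInt_cts. intros x.
    apply (cont2_slice2 (fun t x => k * (rad F t x * m t x))). solve_cont2.
  - intros x Hx. rewrite <- Rmult_assoc. apply Rmult_le_pos; [|apply Hmpos].
    apply Rlt_le, Hk; [exact Ht0'|lra]. }
assert (Hk0 : k <> 0) by (intros E; pose proof (Hk t0 0 Ht0'); rewrite E in *; lra).
assert (HN0 : N t0 = 0).
{ apply (Rmult_eq_reg_l k); [lra|exact Hk0]. }
assert (Hm0 : m t0 th0 = 0).
{ apply (flux_zero F (m t0) t0); auto. intros x; apply cont2_slice2, Cm. }
assert (Hphi : phi t0 th0 <> 0).
{ unfold phi; intros E; apply pos2_eq_0 in E.
  pose proof (HM th0 Hth0) as B. apply Rabs_le_between in B.
  unfold t1 in E. destruct Hd as [[-> _]|[-> _]]; lra. }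
unfold m in Hm0. apply Rmult_integral in Hm0. destruct Hm0 as [Hm0|Hm0]; [|contradiction].
assert (Heta : eta t0 th0 = 0) by nra. unfold eta in Heta. lra.
Qed.

(** * Rigidity *)

(** On the finite end circles, the angular part is the constant [c]. *)
Definition calm_ends {lo hi L c} (F : strip_flow lo hi L c) : Prop :=
  (lo = m_infty \/ exists l, lo = Finite l /\ forall th, 0 <= th <= L -> ang F l th = c) /\
  (hi = p_infty \/ exists h, hi = Finite h /\ forall th, 0 <= th <= L -> ang F h th = c).

Lemma calm_ends_zero {lo hi L c} (F : strip_flow lo hi L c) (g : R -> R -> R) :
  calm_ends F ->
  zero_at_finite_ends lo hi (fun t => RInt (fun th => g t th * (ang F t th - c)) 0 L).
Proof.
pose proof (width_pos F) as HL.
assert (Hz : forall t, (forall th, 0 <= th <= L -> ang F t th = c) ->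
  RInt (fun th => g t th * (ang F t th - c)) 0 L = 0).
{ intros t H. apply RInt_zero_fun; [lra|]. intros x Hx. rewrite H by lra; ring. }
intros [[H1|[l [H1 H2]]] [H3|[h [H3 H4]]]]; split; auto;
  right; eexists; eauto.
Qed.

Lemma derive_zero_of_const (lo hi : Rbar) (g : R -> R) (k t dg : R) :
  (forall t, within_ends lo hi t -> g t = k) -> inside lo hi t ->
  is_derive g t dg -> dg = 0.
Proof.
intros H Ht D.
transitivity (Derive g t); [symmetry; apply is_derive_unique, D|].
apply is_derive_unique. apply (is_derive_ext_loc (fun _ => k)); [|apply d_const].
generalize (inside_locally lo hi t Ht). apply filter_imp.
intros s Hs; symmetry; apply H, inside_within, Hs.
Qed.

(** The mean of the stream function over circles is bounded; it is convex or
    concave in [t] when the vorticity has a sign, hence constant, and its second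
    derivative is a weighted mean of the vorticity. *)
Lemma vor_zero_of_sign {lo hi L c} (F : strip_flow lo hi L c) (k : R) :
  k <> 0 -> calm_ends F ->
  (forall t th, inside lo hi t -> 0 <= th <= L -> 0 <= k * vor F t th) ->
  forall t th, inside lo hi t -> 0 <= th <= L -> vor F t th = 0.
Proof.
intros Hk Hends Hs t0 th0 Ht0 Hth0.
pose proof (width_pos F) as HL.
pose proof (stream_cont F) as Cs.
set (I t := RInt (fun th => k * stream F t th) 0 L).
set (W t := RInt (fun th => k * (ang F t th - c)) 0 L).
assert (CI : forall t, continuity_pt I t).
{ intros t; apply (cont2_slice1 (fun t x => RInt (fun th => k * stream F t th) 0 x)).
  apply (cont2_RInt (fun t th => k * stream F t th)); solve_cont2. }
assert (CW : forall t, continuity_pt W t).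
{ intros t; apply (cont2_slice1 (fun t x => RInt (fun th => k * (ang F t th - c)) 0 x)).
  apply (cont2_RInt (fun t th => k * (ang F t th - c))); solve_cont2. }
assert (DI : forall t, inside lo hi t -> is_derive I t (W t)).
{ intros t Ht. apply (is_derive_RInt_strip (fun t th => k * stream F t th)
    (fun t th => k * (ang F t th - c))); [lra|solve_cont2|solve_cont2|].
  generalize (inside_locally lo hi t Ht). apply filter_imp. intros s Hs' x Hx.
  apply d_scal, is_stream_t; auto. }
assert (Cexp : cont2 (fun t _ => exp (2 * t))).
{ apply (cont2_fst (fun t => exp (2 * t))). intros x.
  apply (continuity_pt_comp (fun x => 2 * x) exp); [|apply continuity_pt_exp].
  apply continuity_pt_mult;
    [apply continuity_pt_cst|apply continuity_pt_id']. }
assert (CWt : cont2 (fun t th => k * (exp (2 * t) * vor F t th))) by solve_cont2.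
assert (DW : forall t, inside lo hi t ->
  is_derive W t (RInt (fun th => k * (exp (2 * t) * vor F t th)) 0 L)).
{ intros t Ht.
  apply (d_eq _ _ (RInt (fun th => k * (rad_th F t th + exp (2 * t) * vor F t th - 0)) 0 L)).
  - (* The radial part is periodic, so its angular derivative has mean zero *)
    assert (E : RInt (fun th => k * rad_th F t th) 0 L = k * rad F t L - k * rad F t 0).
    { apply (RInt_derive_open (fun th => k * rad F t th)); [lra| | |].
      - intros x; apply (cont2_slice2 (fun t x => k * rad F t x)); solve_cont2.
      - intros x; apply (cont2_slice2 (fun t x => k * rad_th F t x)); solve_cont2.
      - intros x Hx; apply d_scal, (is_rad_th F); auto. }
    rewrite (rad_periodic F t (inside_within _ _ _ Ht)) in E.
    transitivity (RInt (fun th => k * rad_th F t th + k * (exp (2 * t) * vor F t th)) 0 L).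
    + apply RInt_ext; intros x _. real_eq; ring.
    + rewrite (RInt_plus_cts (fun th => k * rad_th F t th)).
      * rewrite E. real_eq; ring.
      * intros x; apply (cont2_slice2 (fun t x => k * rad_th F t x)); solve_cont2.
      * intros x; apply (cont2_slice2 _ t x CWt).
  - apply (is_derive_RInt_strip (fun t th => k * (ang F t th - c))
      (fun t th => k * (rad_th F t th + exp (2 * t) * vor F t th - 0)));
      [lra|solve_cont2|solve_cont2|].
    generalize (inside_locally lo hi t Ht). apply filter_imp. intros s Hs' x Hx.
    apply d_scal, (d_minus (fun t => ang F t x)); [apply (vorticity_def F); auto|apply d_const]. }
assert (Hpos : forall t th, inside lo hi t -> 0 <= th <= L ->
  0 <= k * (exp (2 * t) * vor F t th)).
{ intros t th Ht Hth. pose proof (Hs t th Ht Hth). pose proof (exp_pos (2 * t)).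
  replace (k * (exp (2 * t) * vor F t th)) with (exp (2 * t) * (k * vor F t th)) by ring.
  apply Rmult_le_pos; lra. }
assert (HW : forall t, within_ends lo hi t -> W t = 0).
{ apply (bounded_convex_constant lo hi I W (L * (Rabs k * Rabs (stream F t0 L)))); auto.
  - apply (nondecreasing_derive lo hi W
      (fun t => RInt (fun th => k * (exp (2 * t) * vor F t th)) 0 L) CW).
    intros t Ht; split; [apply DW, Ht|].
    apply RInt_ge_0; [lra| |intros x Hx; apply Hpos; auto; lra].
    apply ex_RInt_cts. intros x; apply (cont2_slice2 _ t x CWt).
  - intros t Ht. unfold I.
    replace L with (Rabs (L - 0)) at 2 by (rewrite Rminus_0_r; apply Rabs_pos_eq; lra).
    apply RInt_le_abs.
    + intros x; apply (cont2_slice2 (fun t x => k * stream F t x)); solve_cont2.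
    + intros x. rewrite Rmin_left, Rmax_right by lra. intros Hx.
      rewrite Rabs_mult. apply Rmult_le_compat_l; [apply Rabs_pos|].
      rewrite (stream_L_constant F t0 t) by (auto using inside_within).
      apply stream_bound; auto.
  - apply (calm_ends_zero F (fun _ _ => k)), Hends. }
pose proof (derive_zero_of_const lo hi W 0 t0 _ HW Ht0 (DW t0 Ht0)) as E.
assert (E2 : k * (exp (2 * t0) * vor F t0 th0) = 0).
{ apply (RInt_zero_nonneg (fun th => k * (exp (2 * t0) * vor F t0 th)) 0 L); auto.
  intros x; apply (cont2_slice2 _ t0 x CWt). }
pose proof (exp_pos (2 * t0)).
apply Rmult_integral in E2; destruct E2 as [E2|E2]; [contradiction|].
apply Rmult_integral in E2; destruct E2; [lra|assumption].
Qed.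

(** When a side is crossed by the flow, a constant angular derivative of the
    radial part there makes the vorticity on that side a multiple of
    [exp (- 2 * t)], hence of constant sign in the strip. *)
Lemma vor_zero_from_side {lo hi L c} (F : strip_flow lo hi L c) (A e d t0 : R) :
  c <> 0 -> calm_ends F -> within_ends lo hi t0 ->
  (d = 1 /\ lo = m_infty \/ d = -1 /\ hi = p_infty) ->
  (e = 0 /\ (forall t th, within_ends lo hi t -> 0 <= th <= L -> 0 < d * c * rad F t th) \/
   e = L /\ (forall t th, within_ends lo hi t -> 0 <= th <= L -> 0 < - (d * c) * rad F t th)) ->
  (forall t, inside lo hi t -> rad_th F t e = A) ->
  forall t th, inside lo hi t -> 0 <= th <= L -> vor F t th = 0.
Proof.
intros Hc Hcalm Ht0 Hd He HA.
pose proof (width_pos F) as HL.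
assert (He0 : e = 0 \/ e = L) by tauto.
assert (Hang : forall t, within_ends lo hi t -> ang F t e = c).
{ intros t Ht. destruct He0 as [-> | ->]; [apply (ang_0 F)|apply (ang_L F)]; exact Ht. }
assert (Hv : forall t th, inside lo hi t -> 0 <= th <= L ->
  vor F t th = - A * exp (- 2 * entry F (stream F t0 e) t th)).
{ apply (vor_from_side F A e d (stream F t0 e)); auto.
  - intros t Ht. destruct He0 as [-> | ->]; [rewrite !stream_0; reflexivity|].
    apply stream_L_constant; assumption.
  - intros t Ht.
    assert (E : rad_th F t e + exp (2 * t) * vor F t e = 0).
    { apply (derive_zero_of_const lo hi (fun t => ang F t e) c t); auto.
      apply (vorticity_def F); [exact Ht|destruct He0; lra]. }
    rewrite (HA t Ht) in E. lra. }
destruct (Req_dec A 0) as [E|E].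
- intros t th Ht Hth. rewrite (Hv t th Ht Hth), E. ring.
- apply (vor_zero_of_sign F (- A)); [lra|exact Hcalm|].
  intros t th Ht Hth. rewrite (Hv t th Ht Hth).
  pose proof (exp_pos (- 2 * entry F (stream F t0 e) t th)).
  rewrite <- Rmult_assoc. apply Rmult_le_pos; [nra|lra].
Qed.

(** Without vorticity, the stream function minus its linear interpolation is
    harmonic and vanishes on the sides; its energy on circles is convex in [t]. *)
Lemma rigid_of_vor_zero {lo hi L c} (F : strip_flow lo hi L c) (t0 : R) :
  within_ends lo hi t0 ->
  (calm_ends F \/
   exists l h, lo = Finite l /\ hi = Finite h /\ l <= h /\
     forall th, 0 <= th <= L -> rad F l th = rad F h th /\ ang F l th = ang F h th) ->
  (forall t th, inside lo hi t -> 0 <= th <= L -> vor F t th = 0) ->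
  forall t th, inside lo hi t -> 0 <= th <= L ->
  ang F t th = c /\ rad F t th = - (stream F t0 L / L).
Proof.
intros Ht0 Hends Hv t1 th1 Ht1 Hth1.
pose proof (width_pos F) as HL.
pose proof (stream_cont F) as Cs.
pose proof cont2_th as Cth.
set (k := stream F t0 L / L).
set (q t th := stream F t th - k * th).
assert (Cq : cont2 q) by (unfold q; solve_cont2).
set (E t := RInt (fun th => q t th * q t th) 0 L).
set (G t := RInt (fun th => 2 * q t th * (ang F t th - c)) 0 L).
set (g t th := (ang F t th - c) * (ang F t th - c) + (rad F t th + k) * (rad F t th + k)).
assert (Cg : cont2 g) by (unfold g; solve_cont2).
assert (Dq : forall t th, inside lo hi t -> 0 <= th <= L ->
  is_derive (fun t => q t th) t (ang F t th - c)).
{ intros t th Ht Hth. apply (d_eq _ _ (ang F t th - c - 0)); [ring|].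
  apply (d_minus (fun t => stream F t th)); [apply is_stream_t; auto|apply d_const]. }
assert (CE : forall t, continuity_pt E t).
{ intros t; apply (cont2_slice1 (fun t x => RInt (fun th => q t th * q t th) 0 x)).
  apply (cont2_RInt (fun t th => q t th * q t th)); solve_cont2. }
assert (CG : forall t, continuity_pt G t).
{ intros t; apply (cont2_slice1 (fun t x => RInt (fun th => 2 * q t th * (ang F t th - c)) 0 x)).
  apply (cont2_RInt (fun t th => 2 * q t th * (ang F t th - c))); solve_cont2. }
assert (DE : forall t, inside lo hi t -> is_derive E t (G t)).
{ intros t Ht. apply (is_derive_RInt_strip (fun t th => q t th * q t th)
    (fun t th => 2 * q t th * (ang F t th - c))); [lra|solve_cont2|solve_cont2|].
  generalize (inside_locally lo hi t Ht). apply filter_imp. intros s Hs x Hx.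
  apply (d_eq _ _ ((ang F s x - c) * q s x + q s x * (ang F s x - c))); [ring|].
  apply (d_mult (fun t => q t x) (fun t => q t x)); apply Dq; auto. }
assert (DG : forall t, inside lo hi t -> is_derive G t (RInt (fun th => 2 * g t th) 0 L)).
{ intros t Ht.
  apply (d_eq _ _ (RInt (fun th => 2 * ((ang F t th - c) * (ang F t th - c)
    + q t th * rad_th F t th)) 0 L)).
  - (* Integration by parts in [th]; the boundary terms vanish with [q] *)
    assert (P : RInt (fun th => (- rad F t th - k * 1) * (2 * (rad F t th + k))
        + q t th * (2 * (rad_th F t th + 0))) 0 L
      = q t L * (2 * (rad F t L + k)) - q t 0 * (2 * (rad F t 0 + k))).
    { apply (RInt_derive_open (fun th => q t th * (2 * (rad F t th + k)))); [lra| | |].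
      - intros x; apply (cont2_slice2 (fun t th => q t th * (2 * (rad F t th + k)))); solve_cont2.
      - intros x; apply (cont2_slice2 (fun t th => (- rad F t th - k * 1) * (2 * (rad F t th + k))
          + q t th * (2 * (rad_th F t th + 0)))); solve_cont2.
      - intros x Hx. apply (d_mult (q t) (fun th => 2 * (rad F t th + k))).
        + apply d_minus; [apply is_stream_th|]. apply d_scal, d_id.
        + apply d_scal, d_plus; [apply (is_rad_th F); auto|apply d_const]. }
    assert (Q0 : q t 0 = 0) by (unfold q; rewrite stream_0; ring).
    assert (QL : q t L = 0).
    { unfold q, k. rewrite (stream_L_constant F t t0) by (auto using inside_within).
      field; lra. }
    rewrite Q0, QL in P.
    transitivity (RInt (fun th => 2 * g t th +
      ((- rad F t th - k * 1) * (2 * (rad F t th + k)) + q t th * (2 * (rad_th F t th + 0)))) 0 L).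
    + apply RInt_ext; intros x _. unfold g. real_eq; ring.
    + rewrite (RInt_plus_cts (fun th => 2 * g t th)).
      * rewrite P. real_eq; ring.
      * intros x; apply (cont2_slice2 (fun t x => 2 * g t x)); solve_cont2.
      * intros x;
          apply (cont2_slice2 (fun t th => (- rad F t th - k * 1) * (2 * (rad F t th + k))
          + q t th * (2 * (rad_th F t th + 0)))); solve_cont2.
  - apply (is_derive_RInt_strip (fun t th => 2 * q t th * (ang F t th - c))
      (fun t th => 2 * ((ang F t th - c) * (ang F t th - c) + q t th * rad_th F t th)));
      [lra|solve_cont2|solve_cont2|].
    generalize (inside_locally lo hi t Ht). apply filter_imp. intros s Hs x Hx.
    apply (d_eq _ _ (2 * (ang F s x - c) * (ang F s x - c)
      + 2 * q s x * (rad_th F s x + exp (2 * s) * vor F s x - 0))).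
    + rewrite (Hv s x Hs Hx). ring.
    + apply (d_mult (fun t => 2 * q t x) (fun t => ang F t x - c)).
      * apply d_scal, Dq; auto.
      * apply d_minus; [apply (vorticity_def F); auto|apply d_const]. }
assert (Hg : forall t th, 0 <= 2 * g t th).
{ intros t th; unfold g. pose proof (Rle_0_sqr (ang F t th - c)) as S1.
  pose proof (Rle_0_sqr (rad F t th + k)) as S2. unfold Rsqr in S1, S2. lra. }
assert (Hmono : nondecreasing_on lo hi G).
{ apply (nondecreasing_derive lo hi G (fun t => RInt (fun th => 2 * g t th) 0 L) CG).
  intros t Ht; split; [apply DG, Ht|].
  apply RInt_ge_0; [lra| |intros; apply Hg].
  apply ex_RInt_cts. intros x; apply (cont2_slice2 (fun t x => 2 * g t x)); solve_cont2. }
assert (HG : exists v, forall t, within_ends lo hi t -> G t = v).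
{ destruct Hends as [Hends|[l [h [Hl [Hh [Hlh Hp]]]]]].
  - exists 0. apply (bounded_convex_constant lo hi E G
      (L * (2 * Rabs (stream F t0 L) * (2 * Rabs (stream F t0 L))))); auto.
    + intros t Ht. unfold E.
      replace L with (Rabs (L - 0)) at 2 by (rewrite Rminus_0_r; apply Rabs_pos_eq; lra).
      apply RInt_le_abs.
      * intros x; apply (cont2_slice2 (fun t x => q t x * q t x)); solve_cont2.
      * intros x. rewrite Rmin_left, Rmax_right by lra. intros Hx.
        assert (Rabs (q t x) <= 2 * Rabs (stream F t0 L)).
        { unfold q. eapply Rle_trans; [apply Rabs_triang|]. rewrite Rabs_Ropp.
          assert (Rabs (stream F t x) <= Rabs (stream F t0 L)).
          { rewrite (stream_L_constant F t0 t) by auto. apply stream_bound; auto. }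
          assert (Rabs (k * x) <= Rabs (stream F t0 L)); [|lra].
          unfold k. replace (stream F t0 L / L * x) with (stream F t0 L * (x / L)) by (field; lra).
          rewrite Rabs_mult. rewrite <- (Rmult_1_r (Rabs (stream F t0 L))) at 2.
          apply Rmult_le_compat_l; [apply Rabs_pos|].
          rewrite Rabs_pos_eq; [apply Rle_div_l; lra|apply Rdiv_le_0_compat; lra]. }
        rewrite Rabs_mult. apply Rmult_le_compat; auto using Rabs_pos.
    + apply (calm_ends_zero F (fun t th => 2 * q t th)), Hends.
  - exists (G l). subst lo hi.
    assert (Hl : within_ends l h l) by (split; simpl; lra).
    assert (Hh : within_ends l h h) by (split; simpl; lra).
    assert (Elh : G l = G h).
    { apply RInt_ext. intros x. rewrite Rmin_left, Rmax_right by lra. intros Hx.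
      destruct (Hp x) as [_ Ha]; [lra|]. rewrite Ha. do 2 f_equal.
      unfold q, stream. do 2 f_equal. apply RInt_ext. intros y.
      rewrite Rmin_left, Rmax_right by lra. intros Hy. apply Hp; lra. }
    intros t Ht.
    pose proof (Hmono l t Hl Ht (proj1 Ht)). pose proof (Hmono t h Ht Hh (proj2 Ht)). lra. }
destruct HG as [v HG].
pose proof (derive_zero_of_const lo hi G v t1 _ HG Ht1 (DG t1 Ht1)) as Z.
assert (Z2 : 2 * g t1 th1 = 0).
{ apply (RInt_zero_nonneg (fun th => 2 * g t1 th) 0 L); auto.
  intros x; apply (cont2_slice2 (fun t x => 2 * g t x)); solve_cont2. }
unfold g in Z2. fold k.
pose proof (Rle_0_sqr (ang F t1 th1 - c)) as S1.
pose proof (Rle_0_sqr (rad F t1 th1 + k)) as S2. unfold Rsqr in S1, S2.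
assert (Z3 : (ang F t1 th1 - c) * (ang F t1 th1 - c) = 0) by lra.
assert (Z4 : (rad F t1 th1 + k) * (rad F t1 th1 + k) = 0) by lra.
apply Rmult_integral in Z3; apply Rmult_integral in Z4. lra.
Qed.

(** * Relative derivatives *)

(** [l] is the derivative of [g] at [x] along the points of [S]. *)
Definition rel_derive (S : R -> Prop) (g : R -> R) (x l : R) : Prop :=
  filterlim (fun s => (g s - g x) / (s - x)) (within S (locally' x)) (locally l).

Lemma rel_derive_eps (S : R -> Prop) (g : R -> R) (x l : R) :
  rel_derive S g x l <->
  forall eps : posreal, exists d : posreal, forall y, Rabs (y - x) < d -> y <> x -> S y ->
    Rabs ((g y - g x) / (y - x) - l) < eps.
Proof.
unfold rel_derive. split.
- intros H eps. apply (proj1 (filterlim_locally _ _)) with (eps := eps) in H.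
  destruct H as [d Hd]. exists d. intros y Hy Hn Sy. apply (Hd y Hy Hn Sy).
- intros H. apply filterlim_locally. intros eps. destruct (H eps) as [d Hd].
  exists d. intros y Hy Hn Sy. apply (Hd y Hy Hn Sy).
Qed.

(** [S] has points other than [x] arbitrarily close to [x], so that relative
    derivatives at [x] are unique. *)
Definition limit_point (S : R -> Prop) (x : R) : Prop :=
  forall d : posreal, exists y, Rabs (y - x) < d /\ y <> x /\ S y.

Lemma rel_derive_lim (S : R -> Prop) (g : R -> R) (x l : R) :
  limit_point S x -> rel_derive S g x l ->
  lim (filtermap (fun s => (g s - g x) / (s - x)) (within S (locally' x))) = l.
Proof.
intros HS H.
set (F := filtermap (fun s => (g s - g x) / (s - x)) (within S (locally' x))).
assert (PF : ProperFilter F).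
{ split.
  - intros P [d Hd]. destruct (HS d) as [y [Hy [Hn Sy]]].
    eexists; apply (Hd y Hy Hn Sy).
  - apply filtermap_filter, within_filter, locally'_filter. }
assert (Hl : forall eps : posreal, F (ball l eps)).
{ intros eps. apply (proj1 (filterlim_locally _ _) H eps). }
assert (HC : cauchy F) by (intros eps; exists l; apply Hl).
assert (Hlim : forall eps : posreal, F (ball (lim F) eps)) by (intros; apply complete_cauchy; auto).
destruct (Req_dec (lim F) l) as [E|E]; [exact E|exfalso].
assert (He : 0 < Rabs (lim F - l) / 2).
{ assert (0 < Rabs (lim F - l)) by (apply Rabs_pos_lt; lra). lra. }
destruct (filter_ex _ (filter_and _ _ (Hl (mkposreal _ He)) (Hlim (mkposreal _ He))))
  as [z [Z1 Z2]].
assert (Z1' : Rabs (z - l) < Rabs (lim F - l) / 2) by exact Z1.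
assert (Z2' : Rabs (z - lim F) < Rabs (lim F - l) / 2) by exact Z2.
assert (Rabs (lim F - l) <= Rabs (z - l) + Rabs (z - lim F)); [|lra].
replace (lim F - l) with ((z - l) + - (z - lim F)) by ring.
eapply Rle_trans; [apply Rabs_triang|]. rewrite Rabs_Ropp; lra.
Qed.

Lemma rel_derive_inner (S : R -> Prop) (g : R -> R) (x l : R) :
  locally x S -> rel_derive S g x l -> is_derive g x l.
Proof.
intros [d0 Hd0] H. rewrite rel_derive_eps in H.
apply is_derive_Reals. intros eps Heps.
destruct (H (mkposreal _ Heps)) as [d Hd].
assert (Hm : 0 < Rmin d0 d) by (apply Rmin_glb_lt; apply cond_pos).
exists (mkposreal _ Hm). intros h Hh0 Hh. simpl in Hh.
assert (E : x + h - x = h) by ring.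
specialize (Hd (x + h)). rewrite E in Hd. apply Hd.
- eapply Rlt_le_trans; [exact Hh|apply Rmin_r].
- lra.
- apply Hd0. change (Rabs (x + h - x) < d0). rewrite E.
  eapply Rlt_le_trans; [exact Hh|apply Rmin_l].
Qed.

Lemma rel_derive_ext (S : R -> Prop) (g1 g2 : R -> R) (x l : R) :
  S x -> (forall y, S y -> g1 y = g2 y) -> rel_derive S g1 x l -> rel_derive S g2 x l.
Proof.
intros Hx E H. rewrite rel_derive_eps in *. intros eps. destruct (H eps) as [d Hd].
exists d. intros y Hy Hn Sy. rewrite <- !E by assumption. auto.
Qed.

Lemma rel_derive_scal (S : R -> Prop) (g : R -> R) (k x l : R) :
  rel_derive S g x l -> rel_derive S (fun y => k * g y) x (k * l).
Proof.
unfold rel_derive. intros H.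
apply (filterlim_ext (fun s => scal k ((g s - g x) / (s - x)))).
- intros s. unfold scal; simpl; unfold mult; simpl. unfold Rdiv; ring.
- apply (filterlim_comp _ _ _ _ (scal k) _ (locally l) _ H).
  apply (filterlim_scal_r (V := R_NormedModule) k l).
Qed.

Lemma rel_derive_id_mult (S : R -> Prop) (g : R -> R) (x l : R) :
  rel_derive S g x l -> rel_derive S (fun y => y * g y) x (g x + x * l).
Proof.
intros H. rewrite rel_derive_eps in *. intros eps.
(* The difference of the quotients is [(s - x) * q + x * (q - l)], with [q] the
   quotient of [g]. *)
set (M := Rabs x + Rabs l + 2).
assert (HM : 0 < M) by (unfold M; pose proof (Rabs_pos x); pose proof (Rabs_pos l); lra).
assert (He : 0 < Rmin 1 (eps / M)).
{ apply Rmin_glb_lt; [lra|apply Rdiv_lt_0_compat; [apply cond_pos|exact HM]]. }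
destruct (H (mkposreal _ He)) as [d Hd]. simpl in Hd.
assert (Hm : 0 < Rmin d (eps / M)).
{ apply Rmin_glb_lt; [apply cond_pos|apply Rdiv_lt_0_compat; [apply cond_pos|exact HM]]. }
exists (mkposreal _ Hm). intros y Hy Hn Sy. simpl in Hy.
pose proof (Rmin_l d (eps / M)). pose proof (Rmin_r d (eps / M)).
pose proof (Rmin_l 1 (eps / M)). pose proof (Rmin_r 1 (eps / M)).
specialize (Hd y (Rlt_le_trans _ _ _ Hy (Rmin_l _ _)) Hn Sy).
set (q := (g y - g x) / (y - x)) in *.
assert (E : (y * g y - x * g x) / (y - x) - (g x + x * l) = (y - x) * q + x * (q - l)).
{ unfold q. field. lra. }
rewrite E.
assert (Hq : Rabs q <= Rabs l + 1).
{ replace q with ((q - l) + l) by ring.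
  eapply Rle_trans; [apply Rabs_triang|]. lra. }
eapply Rle_lt_trans; [apply Rabs_triang|]. rewrite !Rabs_mult.
assert (B1 : Rabs (y - x) * Rabs q <= eps / M * (Rabs l + 1)).
{ apply Rmult_le_compat; try apply Rabs_pos; lra. }
assert (B2 : Rabs x * Rabs (q - l) <= Rabs x * (eps / M)).
{ apply Rmult_le_compat_l; [apply Rabs_pos|lra]. }
assert (B3 : eps / M * (Rabs l + 1) + Rabs x * (eps / M) = eps - eps / M)
  by (unfold M; field; unfold M in HM; lra).
assert (0 < eps / M) by (apply Rdiv_lt_0_compat; [apply cond_pos|exact HM]).
lra.
Qed.

(** * The closed polar sector *)

Lemma limit_point_admissible (a : R) (b : Rbar) (r : R) :
  0 <= a -> Rbar_lt a b -> admissible a b r -> limit_point (admissible a b) r.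
Proof.
intros Ha Hab [Hr [Har Hrb]] d. pose proof (cond_pos d) as Hd.
assert (Hc : (Rbar_lt r b \/ a < r)).
{ destruct (Rlt_dec a r); [right; assumption|left].
  replace r with a by lra; exact Hab. }
destruct Hc as [Hc|Hc].
- destruct b as [b| |]; simpl in *; try easy.
  + exists (r + Rmin (d / 2) (b - r)).
    assert (0 < Rmin (d / 2) (b - r)) by (apply Rmin_glb_lt; lra).
    pose proof (Rmin_l (d / 2) (b - r)). pose proof (Rmin_r (d / 2) (b - r)).
    repeat split; simpl; try lra.
    replace (r + Rmin (d / 2) (b - r) - r) with (Rmin (d / 2) (b - r)) by ring.
    rewrite Rabs_pos_eq; lra.
  + exists (r + d / 2). repeat split; simpl; try lra.
    replace (r + d / 2 - r) with (d / 2) by ring. rewrite Rabs_pos_eq; lra.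
- exists (r - Rmin (d / 2) ((r - a) / 2)).
  assert (0 < Rmin (d / 2) ((r - a) / 2)) by (apply Rmin_glb_lt; lra).
  pose proof (Rmin_l (d / 2) ((r - a) / 2)). pose proof (Rmin_r (d / 2) ((r - a) / 2)).
  repeat split; try lra.
  + replace (r - Rmin (d / 2) ((r - a) / 2) - r) with (- Rmin (d / 2) ((r - a) / 2)) by ring.
    rewrite Rabs_Ropp, Rabs_pos_eq; lra.
  + apply (Rbar_le_trans _ r); [simpl; lra|exact Hrb].
Qed.

Lemma limit_point_segment (L x : R) :
  0 < L -> 0 <= x <= L -> limit_point (fun y => 0 <= y <= L) x.
Proof.
intros HL Hx d.
destruct (limit_point_admissible 1 (Finite (1 + L)) (x + 1)) with (d := d) as [y [H1 [H2 H3]]].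
- lra.
- simpl; lra.
- repeat split; simpl; lra.
- exists (y - 1). destruct H3 as [H3 [H4 H5]]; simpl in H5.
  repeat split; try lra. replace (y - 1 - x) with (y - (x + 1)) by ring. exact H1.
Qed.

(** The nearest angle of the sector. *)
Definition clamp_th (L th : R) : R := Rmax 0 (Rmin L th).

Lemma clamp_th_in (L th : R) : 0 < L -> 0 <= clamp_th L th <= L.
Proof. unfold clamp_th, Rmax, Rmin; repeat destruct Rle_dec; lra. Qed.

Lemma clamp_th_id (L th : R) : 0 <= th <= L -> clamp_th L th = th.
Proof. unfold clamp_th, Rmax, Rmin; repeat destruct Rle_dec; lra. Qed.

Lemma clamp_th_lip (L r s : R) : Rabs (clamp_th L r - clamp_th L s) <= Rabs (r - s).
Proof.
unfold clamp_th, Rmax, Rmin, Rabs; repeat destruct Rle_dec; repeat destruct Rcase_abs; lra.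
Qed.

(** The ends of the interval of logarithmic radii; the radius [0] gives the end
    [m_infty]. *)
Definition ln_end (x : Rbar) : Rbar :=
  match x with
  | Finite x => if Rle_dec x 0 then m_infty else Finite (ln x)
  | y => y
  end.

Section Sector.

Context (a : R) (b : Rbar) (Ha : 0 <= a) (Hab : Rbar_lt a b).
Set Default Proof Using "Ha Hab".

(** The nearest radius of the sector. *)
Definition clamp_r (r : R) : R :=
  Rmax a (match b with Finite b => Rmin b r | _ => r end).

Lemma clamp_r_admissible (r : R) : 0 < r -> admissible a b (clamp_r r).
Proof.
intros Hr. unfold clamp_r, admissible.
destruct b as [b'| |]; simpl in *; try easy.
- unfold Rmax, Rmin; repeat destruct Rle_dec; lra.
- unfold Rmax; destruct Rle_dec; repeat split; lra.
Qed.

Lemma clamp_r_id (r : R) : admissible a b r -> clamp_r r = r.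
Proof.
intros [H1 [H2 H3]]. unfold clamp_r.
destruct b as [b'| |]; simpl in *; try easy.
- unfold Rmax, Rmin; repeat destruct Rle_dec; lra.
- unfold Rmax; destruct Rle_dec; lra.
Qed.

Lemma clamp_r_lip (r s : R) : Rabs (clamp_r r - clamp_r s) <= Rabs (r - s).
Proof.
unfold clamp_r. destruct b as [b'| |]; simpl in *; try easy;
unfold Rmax, Rmin, Rabs; repeat destruct Rle_dec; repeat destruct Rcase_abs; lra.
Qed.

Lemma inside_exp (t : R) :
  inside (ln_end a) (ln_end b) t -> a < exp t /\ Rbar_lt (exp t) b.
Proof.
intros [H1 H2]; split.
- simpl in H1; destruct (Rle_dec a 0); [pose proof (exp_pos t); lra|].
  simpl in H1. rewrite <- (exp_ln a) by lra. apply exp_increasing, H1.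
- destruct b as [b'| |]; simpl in *; try easy.
  destruct (Rle_dec b' 0); [easy|]. simpl in H2.
  rewrite <- (exp_ln b') by lra. apply exp_increasing, H2.
Qed.

Lemma within_exp (t : R) :
  within_ends (ln_end a) (ln_end b) t <-> admissible a b (exp t).
Proof.
pose proof (exp_pos t) as Hp. split.
- intros [H1 H2]; split; [exact Hp|split].
  + simpl in H1; destruct (Rle_dec a 0); [lra|].
    simpl in H1. rewrite <- (exp_ln a) by lra.
    destruct H1 as [H1| ->]; [apply Rlt_le, exp_increasing, H1|apply Rle_refl].
  + destruct b as [b'| |]; simpl in *; try easy.
    destruct (Rle_dec b' 0); [easy|]. simpl in H2.
    rewrite <- (exp_ln b') by lra.
    destruct H2 as [H2| ->]; [apply Rlt_le, exp_increasing, H2|apply Rle_refl].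
- intros [_ [H1 H2]]; split.
  + simpl; destruct (Rle_dec a 0); [exact Logic.I|].
    simpl. rewrite <- (ln_exp t). apply ln_le; lra.
  + destruct b as [b'| |]; simpl in *; try easy.
    destruct (Rle_dec b' 0); [lra|]. simpl.
    rewrite <- (ln_exp t). apply ln_le; lra.
Qed.

Context (L : R) (HL : 0 < L).
Set Default Proof Using "Ha Hab HL".

Let D := polar_closure a b L.

Lemma limit_point_r (r th : R) : D r th -> limit_point (fun s => D s th) r.
Proof.
intros [Hr Hth] d.
destruct (limit_point_admissible a b r Ha Hab Hr d) as [y [H1 [H2 H3]]].
exists y; repeat split; auto; apply H3 || apply Hth.
Qed.

Lemma limit_point_th (r th : R) : D r th -> limit_point (fun s => D r s) th.
Proof.
intros [Hr Hth] d.
destruct (limit_point_segment L th HL Hth d) as [y [H1 [H2 H3]]].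
exists y; repeat split; auto; apply H3 || apply Hr.
Qed.

Lemma pd_r_eq (f : R -> R -> R) (r th l : R) : D r th ->
  rel_derive (fun s => D s th) (fun s => f s th) r l -> pd_r D f r th = l.
Proof.
intros H HD. apply (rel_derive_lim (fun s => D s th) (fun s => f s th) r l); [|exact HD].
apply limit_point_r, H.
Qed.

Lemma pd_theta_eq (f : R -> R -> R) (r th l : R) : D r th ->
  rel_derive (fun s => D r s) (fun s => f r s) th l -> pd_theta D f r th = l.
Proof.
intros H HD. apply (rel_derive_lim (fun s => D r s) (fun s => f r s) th l); [|exact HD].
apply limit_point_th, H.
Qed.

Lemma pd_r_spec (f : R -> R -> R) (r th : R) : D r th -> ex_pd_r D f r th ->
  rel_derive (fun s => D s th) (fun s => f s th) r (pd_r D f r th).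
Proof. intros H [l Hl]. rewrite (pd_r_eq f r th l H Hl). exact Hl. Qed.

Lemma pd_theta_spec (f : R -> R -> R) (r th : R) : D r th -> ex_pd_theta D f r th ->
  rel_derive (fun s => D r s) (fun s => f r s) th (pd_theta D f r th).
Proof. intros H [l Hl]. rewrite (pd_theta_eq f r th l H Hl). exact Hl. Qed.

Lemma inner_r (r th : R) : a < r -> Rbar_lt r b -> 0 <= th <= L ->
  locally r (fun s => D s th).
Proof.
intros H1 H2 H3.
generalize (filter_and _ _ (open_Rbar_gt' r a H1) (open_Rbar_lt' r b H2)).
apply filter_imp. intros s [Hs1 Hs2]; simpl in Hs1.
repeat split; try lra. apply Rbar_lt_le, Hs2.
Qed.

Lemma inner_th (r th : R) : admissible a b r -> 0 < th < L -> locally th (fun s => D r s).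
Proof.
intros H1 [H2 H3].
generalize (filter_and _ _ (open_Rbar_gt' th 0 H2) (open_Rbar_lt' th L H3)).
apply filter_imp. intros s [Hs1 Hs2]; simpl in Hs1, Hs2.
split; [exact H1|lra].
Qed.

Lemma is_derive_pd_r (f : R -> R -> R) (r th : R) :
  a < r -> Rbar_lt r b -> 0 <= th <= L -> ex_pd_r D f r th ->
  is_derive (fun s => f s th) r (pd_r D f r th).
Proof.
intros H1 H2 H3 H4. pose proof (inner_r r th H1 H2 H3) as Hl.
apply (rel_derive_inner (fun s => D s th)); [exact Hl|].
apply pd_r_spec; [exact (locally_singleton _ _ Hl)|exact H4].
Qed.

Lemma is_derive_pd_theta (f : R -> R -> R) (r th : R) :
  admissible a b r -> 0 < th < L -> ex_pd_theta D f r th ->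
  is_derive (fun s => f r s) th (pd_theta D f r th).
Proof.
intros H1 H2 H3. pose proof (inner_th r th H1 H2) as Hl.
apply (rel_derive_inner (fun s => D r s)); [exact Hl|].
apply pd_theta_spec; [exact (locally_singleton _ _ Hl)|exact H3].
Qed.

(** Continuity relative to the closed sector. *)
Definition cont_sector (f : R -> R -> R) : Prop :=
  continuous_on (fun p : R * R => D (fst p) (snd p)) (fun p => f (fst p) (snd p)).

Lemma cont_sector_eps (f : R -> R -> R) (r th : R) : cont_sector f -> D r th ->
  forall eps : posreal, exists d : posreal, forall s u, D s u ->
    Rabs (s - r) < d -> Rabs (u - th) < d -> Rabs (f s u - f r th) < eps.
Proof.
intros Hf H eps.
specialize (Hf (r, th) H). apply (proj1 (filterlim_locally _ _)) with (eps := eps) in Hf.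
destruct Hf as [d Hd]. exists d. intros s u Hs H1 H2.
apply (Hd (s, u)); [split; assumption|exact Hs].
Qed.

Lemma cont_sector_inner (f : R -> R -> R) (r th : R) : cont_sector f ->
  polar_domain a b L r th -> continuity_2d_pt f r th.
Proof.
intros Hf [H1 [H2 H3]] eps.
assert (Hr : locally r (fun s => D s th)) by (apply inner_r; auto; lra).
assert (Hth : locally th (fun s => D r s)).
{ apply inner_th; auto. apply (locally_singleton _ _ Hr). }
destruct (cont_sector_eps f r th Hf (locally_singleton _ _ Hr) eps) as [d Hd].
destruct Hr as [d1 Hd1]. destruct Hth as [d2 Hd2].
assert (Hm : 0 < Rmin d (Rmin d1 d2)) by (repeat apply Rmin_glb_lt; apply cond_pos).
exists (mkposreal _ Hm). intros u v Hu Hv. simpl in Hu, Hv.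
pose proof (Rmin_l d (Rmin d1 d2)). pose proof (Rmin_r d (Rmin d1 d2)).
pose proof (Rmin_l d1 d2). pose proof (Rmin_r d1 d2).
apply Hd; [|lra|lra]. split.
- apply (Hd1 u). change (Rabs (u - r) < d1); lra.
- apply (Hd2 v). change (Rabs (v - th) < d2); lra.
Qed.


(** A function on the sector in logarithmic polar coordinates, extended to the
    whole plane by its values at the nearest points. *)
Definition pull (f : R -> R -> R) (t th : R) : R := f (clamp_r (exp t)) (clamp_th L th).

Lemma pull_in (f : R -> R -> R) (t th : R) :
  admissible a b (exp t) -> 0 <= th <= L -> pull f t th = f (exp t) th.
Proof. intros H1 H2; unfold pull; rewrite clamp_r_id, clamp_th_id by auto; reflexivity. Qed.

Lemma pull_cont (f : R -> R -> R) : cont_sector f -> cont2 (pull f).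
Proof.
intros Hf t th eps. unfold pull.
assert (HD : D (clamp_r (exp t)) (clamp_th L th)).
{ split; [apply clamp_r_admissible, exp_pos|apply clamp_th_in, HL]. }
destruct (cont_sector_eps f _ _ Hf HD eps) as [d Hd].
destruct (proj1 (continuity_pt_locally exp t) (continuity_pt_exp t) d) as [d2 Hd2].
assert (Hm : 0 < Rmin d d2) by (apply Rmin_glb_lt; apply cond_pos).
exists (mkposreal _ Hm). intros u v Hu Hv. simpl in Hu, Hv.
apply Hd.
- split; [apply clamp_r_admissible, exp_pos|apply clamp_th_in, HL].
- eapply Rle_lt_trans; [apply clamp_r_lip|]. apply Hd2.
  eapply Rlt_le_trans; [exact Hu|apply Rmin_r].
- eapply Rle_lt_trans; [apply clamp_th_lip|].
  eapply Rlt_le_trans; [exact Hv|apply Rmin_l].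
Qed.

Lemma pull_derive_t (f fr : R -> R -> R) (t th : R) :
  (forall r th, a < r -> Rbar_lt r b -> 0 <= th <= L -> is_derive (fun s => f s th) r (fr r th)) ->
  inside (ln_end a) (ln_end b) t -> 0 <= th <= L ->
  is_derive (fun t => pull f t th) t (clamp_r (exp t) * pull fr t th).
Proof.
intros Hf Ht Hth.
pose proof (inside_exp t Ht) as [H1 H2].
pose proof (proj1 (within_exp t) (inside_within _ _ _ Ht)) as Hadm.
rewrite pull_in, clamp_r_id by auto.
apply (is_derive_ext_loc (fun t => f (exp t) th)).
- generalize (inside_locally _ _ t Ht). apply filter_imp. intros s Hs.
  symmetry; apply pull_in; [apply within_exp, inside_within, Hs|exact Hth].
- apply (d_eq _ _ (fr (exp t) th * exp t)); [ring|].
  apply (d_comp (fun s => f s th) exp); [apply Hf; auto|].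
  apply is_derive_Reals, derivable_pt_lim_exp.
Qed.

Lemma pull_derive_th (f ft : R -> R -> R) (t th : R) :
  (forall r th, admissible a b r -> 0 < th < L -> is_derive (fun s => f r s) th (ft r th)) ->
  0 < th < L -> is_derive (fun th => pull f t th) th (pull ft t th).
Proof.
intros Hf Hth. unfold pull.
rewrite (clamp_th_id L th) by lra.
apply (is_derive_ext_loc (fun th => f (clamp_r (exp t)) th)).
- destruct Hth as [H1 H2].
  generalize (filter_and _ _ (open_Rbar_gt' th 0 H1) (open_Rbar_lt' th L H2)).
  apply filter_imp. intros s [Hs1 Hs2]; simpl in Hs1, Hs2.
  rewrite clamp_th_id by lra; reflexivity.
- apply Hf; [apply clamp_r_admissible, exp_pos|exact Hth].
Qed.

Unset Default Proof Using.
End Sector.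

(** * Differentiability in the plane *)

Lemma differentiable_of_partials (f fx : R -> R -> R) (x y fy : R) :
  locally_2d (fun u v => is_derive (fun z => f z v) u (fx u v)) x y ->
  is_derive (fun z => f x z) y fy -> continuity_2d_pt fx x y ->
  differentiable_pt_lim f x y (fx x y) fy.
Proof.
intros Hx Hy Hc. apply filterdiff_differentiable_pt_lim.
apply (is_derive_filterdiff f x y fx fy).
- apply (proj1 (locally_2d_locally _ x y) Hx).
- exact Hy.
- apply (proj1 (continuity_2d_pt_filterlim fx x y) Hc).
Qed.

(** Equality of mixed partial derivatives on an open set. *)
Lemma mixed_partials (O : R -> R -> Prop) (g gr gt grt gtr : R -> R -> R) (x y : R) :
  (forall x y, O x y -> locally_2d O x y) ->
  (forall x y, O x y -> is_derive (fun s => g s y) x (gr x y)) ->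
  (forall x y, O x y -> is_derive (fun s => g x s) y (gt x y)) ->
  (forall x y, O x y -> is_derive (fun s => gr x s) y (grt x y)) ->
  (forall x y, O x y -> is_derive (fun s => gt s y) x (gtr x y)) ->
  (forall x y, O x y -> continuity_2d_pt grt x y) ->
  (forall x y, O x y -> continuity_2d_pt gtr x y) ->
  O x y -> grt x y = gtr x y.
Proof.
intros HO Dr Dt Drt Dtr Crt Ctr Hxy.
assert (Ert : forall u v, O u v ->
  is_derive (fun z => Derive (fun t => g t z) u) v (grt u v)).
{ intros u v H. apply (is_derive_ext_loc (fun z => gr u z)); [|apply Drt, H].
  destruct (HO u v H) as [d Hd]. exists d. intros z Hz.
  symmetry; apply is_derive_unique, Dr, Hd; [|exact Hz].
  rewrite Rminus_diag, Rabs_R0; apply cond_pos. }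
assert (Etr : forall u v, O u v ->
  is_derive (fun z => Derive (fun t => g z t) v) u (gtr u v)).
{ intros u v H. apply (is_derive_ext_loc (fun z => gt z v)); [|apply Dtr, H].
  destruct (HO u v H) as [d Hd]. exists d. intros z Hz.
  symmetry; apply is_derive_unique, Dt, Hd; [exact Hz|].
  rewrite Rminus_diag, Rabs_R0; apply cond_pos. }
rewrite <- (is_derive_unique _ _ _ (Ert x y Hxy)), <- (is_derive_unique _ _ _ (Etr x y Hxy)).
symmetry. apply Schwarz.
- destruct (HO x y Hxy) as [d Hd]. exists d. intros u v Hu Hv. specialize (Hd u v Hu Hv).
  repeat split; eexists; eauto.
- apply (continuity_2d_pt_ext_loc gtr); [|apply Ctr, Hxy].
  destruct (HO x y Hxy) as [d Hd]. exists d. intros u v Hu Hv.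
  symmetry; apply is_derive_unique, Etr, Hd; assumption.
- apply (continuity_2d_pt_ext_loc grt); [|apply Crt, Hxy].
  destruct (HO x y Hxy) as [d Hd]. exists d. intros u v Hu Hv.
  symmetry; apply is_derive_unique, Ert, Hd; assumption.
Qed.

(** * Polar coordinates near a point *)

(** Polar coordinates near the ray of angle [th0], through the coordinates
    along this ray and across it. *)
Definition along (th0 x y : R) : R := x * cos th0 + y * sin th0.
Definition across (th0 x y : R) : R := y * cos th0 - x * sin th0.
Definition chart_r (th0 x y : R) : R :=
  sqrt (along th0 x y * along th0 x y + across th0 x y * across th0 x y).
Definition chart_th (th0 x y : R) : R := th0 + atan (across th0 x y / along th0 x y).

Lemma cos2_sin2 (t : R) : cos t * cos t + sin t * sin t = 1.
Proof. pose proof (sin2_cos2 t) as H; unfold Rsqr in H; lra. Qed.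

Lemma along_polar (r th : R) : along th (r * cos th) (r * sin th) = r.
Proof. 
unfold along. rewrite <- (Rmult_1_r r) at 3. rewrite <- (cos2_sin2 th). ring.
Qed.

Lemma across_polar (r th : R) : across th (r * cos th) (r * sin th) = 0.
Proof. unfold across; ring. Qed.

Lemma chart_r_polar (r th : R) : 0 < r -> chart_r th (r * cos th) (r * sin th) = r.
Proof.
intros Hr. unfold chart_r. rewrite along_polar, across_polar.
replace (r * r + 0 * 0) with (r * r) by ring. apply sqrt_square; lra.
Qed.

Lemma chart_th_polar (r th : R) : chart_th th (r * cos th) (r * sin th) = th.
Proof.
unfold chart_th. rewrite across_polar. unfold Rdiv; rewrite Rmult_0_l, atan_0; ring.
Qed.

Lemma chart_inverse (th0 x y : R) : 0 < along th0 x y ->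
  chart_r th0 x y * cos (chart_th th0 x y) = x /\
  chart_r th0 x y * sin (chart_th th0 x y) = y.
Proof.
intros HA. unfold chart_r, chart_th.
set (A := along th0 x y) in *. set (B := across th0 x y).
assert (E : sqrt (A * A + B * B) = A * sqrt (1 + (B / A)²)).
{ transitivity (sqrt (A * A) * sqrt (1 + (B / A)²));
    [|rewrite sqrt_square by lra; reflexivity].
  rewrite <- sqrt_mult; [|nra|pose proof (Rle_0_sqr (B / A)); lra].
  f_equal. unfold Rsqr. field. lra. }
assert (Hs : 0 < sqrt (1 + (B / A)²)).
{ apply sqrt_lt_R0. pose proof (Rle_0_sqr (B / A)); lra. }
assert (EA : A * cos th0 - B * sin th0 = x).
{ unfold A, B, along, across. pose proof (cos2_sin2 th0).
  transitivity (x * (cos th0 * cos th0 + sin th0 * sin th0)); [ring|rewrite H; ring]. }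
assert (EB : A * sin th0 + B * cos th0 = y).
{ unfold A, B, along, across. pose proof (cos2_sin2 th0).
  transitivity (y * (cos th0 * cos th0 + sin th0 * sin th0)); [ring|rewrite H; ring]. }
rewrite cos_plus, sin_plus, cos_atan, sin_atan, E. split.
- transitivity (A * cos th0 - B * sin th0); [field; split; lra|exact EA].
- transitivity (A * sin th0 + B * cos th0); [field; split; lra|exact EB].
Qed.

Lemma differentiable_linear (f : R -> R -> R) (p q x y : R) :
  (forall x y, f x y = p * x + q * y) -> differentiable_pt_lim f x y p q.
Proof.
intros H eps. exists (mkposreal 1 Rlt_0_1). intros u v _ _.
rewrite !H. replace (p * u + q * v - (p * x + q * y) - (p * (u - x) + q * (v - y))) with 0 by ring.
rewrite Rabs_R0. apply Rmult_le_pos; [apply Rlt_le, cond_pos|].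
eapply Rle_trans; [apply Rabs_pos|apply Rmax_l].
Qed.

Lemma differentiable_along (th0 x y : R) :
  differentiable_pt_lim (along th0) x y (cos th0) (sin th0).
Proof. apply differentiable_linear; intros; unfold along; ring. Qed.

Lemma differentiable_across (th0 x y : R) :
  differentiable_pt_lim (across th0) x y (- sin th0) (cos th0).
Proof. apply differentiable_linear; intros; unfold across; ring. Qed.

Lemma locally_2d_half_plane (r : R) : 0 < r -> locally_2d (fun u _ => 0 < u) r 0.
Proof.
intros Hr. exists (mkposreal r Hr). intros u v Hu _. simpl in Hu.
apply Rabs_def2 in Hu; lra.
Qed.

Lemma differentiable_chart_r (r th : R) : 0 < r ->
  differentiable_pt_lim (chart_r th) (r * cos th) (r * sin th) (cos th) (sin th).
Proof.
intros Hr.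
assert (Es : sqrt (r * r + 0 * 0) = r).
{ replace (r * r + 0 * 0) with (r * r) by ring. apply sqrt_square; lra. }
assert (H : differentiable_pt_lim (fun u v => sqrt (u * u + v * v)) r 0 1 0).
{ replace 1 with ((fun u v => u / sqrt (u * u + v * v)) r 0) by (cbv beta; rewrite Es; field; lra).
  apply (differentiable_of_partials (fun u v => sqrt (u * u + v * v))
    (fun u v => u / sqrt (u * u + v * v))).
  - generalize (locally_2d_half_plane r Hr). apply locally_2d_impl. apply locally_2d_forall.
    intros u v Hu. assert (0 < u * u + v * v) by nra.
    assert (0 < sqrt (u * u + v * v)) by (apply sqrt_lt_R0; assumption).
    auto_derive; [assumption|]. field; lra.
  - auto_derive; [nra|]. rewrite Es. field; lra.
  - assert (C : continuity_2d_pt (fun u v => sqrt (u * u + v * v)) r 0).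
    { apply (continuity_1d_2d_pt_comp sqrt (fun u v => u * u + v * v)).
      - apply continuity_pt_sqrt; nra.
      - apply continuity_2d_pt_plus; apply continuity_2d_pt_mult;
          apply continuity_2d_pt_id1 || apply continuity_2d_pt_id2. }
    apply continuity_2d_pt_mult; [apply continuity_2d_pt_id1|].
    apply continuity_2d_pt_inv; [exact C|]. rewrite Es; lra. }
rewrite <- (along_polar r th) in H at 1. rewrite <- (across_polar r th) in H at 1.
pose proof (differentiable_pt_lim_comp _ _ _ _ _ _ _ _ _ _ _ H
  (differentiable_along th (r * cos th) (r * sin th))
  (differentiable_across th (r * cos th) (r * sin th))) as K.
replace (1 * cos th + 0 * - sin th) with (cos th) in K by ring.
replace (1 * sin th + 0 * cos th) with (sin th) in K by ring.
exact K.
Qed.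

Lemma differentiable_chart_th (r th : R) : 0 < r ->
  differentiable_pt_lim (chart_th th) (r * cos th) (r * sin th) (- sin th / r) (cos th / r).
Proof.
intros Hr.
assert (H : differentiable_pt_lim (fun u v => th + atan (v / u)) r 0 0 (/ r)).
{ replace 0 with ((fun u v => - v / (u * u + v * v)) r 0) at 2
    by (cbv beta; unfold Rdiv; ring).
  apply (differentiable_of_partials (fun u v => th + atan (v / u))
    (fun u v => - v / (u * u + v * v))).
  - generalize (locally_2d_half_plane r Hr). apply locally_2d_impl. apply locally_2d_forall.
    intros u v Hu. assert (0 < u * u + v * v) by nra.
    auto_derive; [lra|]. field. repeat split; try lra; nra.
  - auto_derive; [trivial|]. field. nra.
  - apply continuity_2d_pt_mult; [apply continuity_2d_pt_opp, continuity_2d_pt_id2|].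
    apply continuity_2d_pt_inv; [|nra].
    apply continuity_2d_pt_plus; apply continuity_2d_pt_mult;
      apply continuity_2d_pt_id1 || apply continuity_2d_pt_id2. }
rewrite <- (along_polar r th) in H at 1. rewrite <- (across_polar r th) in H at 1.
pose proof (differentiable_pt_lim_comp _ _ _ _ _ _ _ _ _ _ _ H
  (differentiable_along th (r * cos th) (r * sin th))
  (differentiable_across th (r * cos th) (r * sin th))) as K.
replace (0 * cos th + / r * - sin th) with (- sin th / r) in K by (unfold Rdiv; ring).
replace (0 * sin th + / r * cos th) with (cos th / r) in K by (unfold Rdiv; ring).
exact K.
Qed.

Section Open_polar_set.

(** An open set of polar coordinates with positive radii. *)
Context (O : R -> R -> Prop).
Context (O_open : forall r th, O r th -> locally_2d O r th).
Context (O_pos : forall r th, O r th -> 0 < r).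

Lemma differentiable_continuity_lim (f : R -> R -> R) (x y p q : R) :
  differentiable_pt_lim f x y p q -> continuity_2d_pt f x y.
Proof. intros H; apply differentiable_continuity_pt; exists p, q; exact H. Qed.

Lemma chart_locally (r th : R) : O r th ->
  locally_2d (fun x y => O (chart_r th x y) (chart_th th x y) /\
    x = chart_r th x y * cos (chart_th th x y) /\
    y = chart_r th x y * sin (chart_th th x y)) (r * cos th) (r * sin th).
Proof.
intros H. pose proof (O_pos r th H) as Hr.
assert (H1 : locally_2d (fun x y => O (chart_r th x y) (chart_th th x y))
  (r * cos th) (r * sin th)).
{ destruct (O_open r th H) as [d Hd].
  pose proof (differentiable_continuity_lim _ _ _ _ _ (differentiable_chart_r r th Hr) d) as C1.
  pose proof (differentiable_continuity_lim _ _ _ _ _ (differentiable_chart_th r th Hr) d) as C2.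
  rewrite chart_r_polar in C1 by exact Hr. rewrite chart_th_polar in C2.
  generalize (locally_2d_and _ _ _ _ C1 C2). apply locally_2d_impl, locally_2d_forall.
  intros x y [K1 K2]. apply Hd; assumption. }
assert (H2 : locally_2d (fun x y => 0 < along th x y) (r * cos th) (r * sin th)).
{ pose proof (differentiable_continuity_lim _ _ _ _ _
    (differentiable_along th (r * cos th) (r * sin th)) (mkposreal r Hr)) as C.
  revert C. apply locally_2d_impl, locally_2d_forall. intros x y K.
  rewrite along_polar in K. simpl in K. apply Rabs_def2 in K. lra. }
generalize (locally_2d_and _ _ _ _ H1 H2). apply locally_2d_impl, locally_2d_forall.
intros x y [K1 K2]. destruct (chart_inverse th x y K2) as [E1 E2].
rewrite E1, E2. auto.
Qed.

(** A Cartesian function is continuous, or differentiable, when its expression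
    in polar coordinates is. *)
Lemma polar_continuity (h Q : R -> R -> R) (r th : R) :
  (forall r th, O r th -> h (r * cos th) (r * sin th) = Q r th) -> O r th ->
  continuity_2d_pt Q r th -> continuity_2d_pt h (r * cos th) (r * sin th).
Proof.
intros E H C. pose proof (O_pos r th H) as Hr.
apply (continuity_2d_pt_ext_loc (fun x y => Q (chart_r th x y) (chart_th th x y))).
- generalize (chart_locally r th H). apply locally_2d_impl, locally_2d_forall.
  intros x y [K [E1 E2]]. rewrite <- E by exact K. rewrite <- E1, <- E2. reflexivity.
- intros eps. rewrite chart_r_polar, chart_th_polar by exact Hr.
  destruct (C eps) as [d Hd].
  pose proof (differentiable_continuity_lim _ _ _ _ _ (differentiable_chart_r r th Hr) d) as C1.
  pose proof (differentiable_continuity_lim _ _ _ _ _ (differentiable_chart_th r th Hr) d) as C2.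
  rewrite chart_r_polar in C1 by exact Hr. rewrite chart_th_polar in C2.
  generalize (locally_2d_and _ _ _ _ C1 C2). apply locally_2d_impl, locally_2d_forall.
  intros x y [K1 K2]. apply Hd; assumption.
Qed.

Lemma polar_differentiable (h G : R -> R -> R) (r th gr gt : R) :
  (forall r th, O r th -> h (r * cos th) (r * sin th) = G r th) -> O r th ->
  differentiable_pt_lim G r th gr gt ->
  differentiable_pt_lim h (r * cos th) (r * sin th)
    (gr * cos th - gt * sin th / r) (gr * sin th + gt * cos th / r).
Proof.
intros E H D. pose proof (O_pos r th H) as Hr.
apply (differentiable_pt_lim_ext (fun x y => G (chart_r th x y) (chart_th th x y))).
- generalize (chart_locally r th H). apply locally_2d_impl, locally_2d_forall.
  intros x y [K [E1 E2]]. rewrite <- E by exact K. rewrite <- E1, <- E2. reflexivity.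
- assert (D' : differentiable_pt_lim G (chart_r th (r * cos th) (r * sin th))
    (chart_th th (r * cos th) (r * sin th)) gr gt).
  { rewrite chart_r_polar, chart_th_polar by exact Hr. exact D. }
  pose proof (differentiable_pt_lim_comp _ _ _ _ _ _ _ _ _ _ _ D'
    (differentiable_chart_r r th Hr) (differentiable_chart_th r th Hr)) as K.
  replace (gr * cos th - gt * sin th / r) with (gr * cos th + gt * (- sin th / r))
    by (unfold Rdiv; ring).
  replace (gr * sin th + gt * cos th / r) with (gr * sin th + gt * (cos th / r))
    by (unfold Rdiv; ring).
  exact K.
Qed.

Lemma cartesian_differentiable (p : R -> R -> R) (r th px py : R) :
  differentiable_pt_lim p (r * cos th) (r * sin th) px py ->
  is_derive (fun r => p (r * cos th) (r * sin th)) r (px * cos th + py * sin th) /\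
  is_derive (fun th => p (r * cos th) (r * sin th)) th (- px * r * sin th + py * r * cos th).
Proof.
intros D. split.
- apply is_derive_Reals.
  apply (derivable_pt_lim_comp_2d p (fun r => r * cos th) (fun r => r * sin th)); [exact D| |];
  apply is_derive_Reals; auto_derive; trivial; ring.
- apply (d_eq _ _ (px * (- r * sin th) + py * (r * cos th))); [ring|].
  apply is_derive_Reals.
  apply (derivable_pt_lim_comp_2d p (fun th => r * cos th) (fun th => r * sin th)); [exact D| |];
  apply is_derive_Reals; auto_derive; trivial; ring.
Qed.

(** * The Euler equations in polar coordinates *)

(** A twice continuously differentiable function, with names for its
    derivatives. *)
Record C2_data (f f_r f_t f_rr f_rt f_tr f_tt : R -> R -> R) : Prop := {
  C2_r : forall r th, O r th -> is_derive (fun s => f s th) r (f_r r th);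
  C2_t : forall r th, O r th -> is_derive (fun s => f r s) th (f_t r th);
  C2_rr : forall r th, O r th -> is_derive (fun s => f_r s th) r (f_rr r th);
  C2_rt : forall r th, O r th -> is_derive (fun s => f_r r s) th (f_rt r th);
  C2_tr : forall r th, O r th -> is_derive (fun s => f_t s th) r (f_tr r th);
  C2_tt : forall r th, O r th -> is_derive (fun s => f_t r s) th (f_tt r th);
  C2_cont : forall r th, O r th ->
    continuity_2d_pt f r th /\ continuity_2d_pt f_r r th /\ continuity_2d_pt f_t r th /\
    continuity_2d_pt f_rr r th /\ continuity_2d_pt f_rt r th /\
    continuity_2d_pt f_tr r th /\ continuity_2d_pt f_tt r th
}.

Context (U U_r U_t U_rr U_rt U_tr U_tt : R -> R -> R).
Context (V V_r V_t V_rr V_rt V_tr V_tt : R -> R -> R).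
Context (HU : C2_data U U_r U_t U_rr U_rt U_tr U_tt).
Context (HV : C2_data V V_r V_t V_rr V_rt V_tr V_tt).
Context (Oc : R -> R -> Prop) (u : R -> R -> R * R) (P : R -> R -> R).
Context (Oc_polar : forall r th, O r th -> Oc (r * cos th) (r * sin th)).
Context (u_polar : forall r th, O r th ->
  u (r * cos th) (r * sin th) = polar_vector (U r th) (V r th) th).
Context (euler : steady_euler Oc u P).

(** The Cartesian components of the velocity and their derivatives in [r] and
    [th]. *)
Let G1 r th := V r th * cos th - U r th * sin th.
Let G1r r th := V_r r th * cos th - U_r r th * sin th.
Let G1t r th := V_t r th * cos th - V r th * sin th - (U_t r th * sin th + U r th * cos th).
Let G2 r th := V r th * sin th + U r th * cos th.
Let G2r r th := V_r r th * sin th + U_r r th * cos th.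
Let G2t r th := V_t r th * sin th + V r th * cos th + (U_t r th * cos th - U r th * sin th).

Lemma cont_cos_th (r th : R) : continuity_2d_pt (fun _ th => cos th) r th.
Proof. apply (cont2_snd cos). intros x; apply continuity_cos. Qed.

Lemma cont_sin_th (r th : R) : continuity_2d_pt (fun _ th => sin th) r th.
Proof. apply (cont2_snd sin). intros x; apply continuity_sin. Qed.

Lemma velocity_differentiable (r th : R) : O r th ->
  differentiable_pt_lim G1 r th (G1r r th) (G1t r th) /\
  differentiable_pt_lim G2 r th (G2r r th) (G2t r th).
Proof.
intros H. destruct (C2_cont _ _ _ _ _ _ _ HU r th H) as [_ [CUr _]].
destruct (C2_cont _ _ _ _ _ _ _ HV r th H) as [_ [CVr _]].
pose proof (cont_cos_th r th). pose proof (cont_sin_th r th).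
assert (Dcos : is_derive cos th (- sin th)) by apply is_derive_cos.
assert (Dsin : is_derive sin th (cos th)) by apply is_derive_sin.
pose proof (C2_t _ _ _ _ _ _ _ HU r th H) as DUt.
pose proof (C2_t _ _ _ _ _ _ _ HV r th H) as DVt.
split; apply differentiable_of_partials.
- generalize (O_open r th H). apply locally_2d_impl, locally_2d_forall. intros s x K.
  apply (d_eq _ _ (V_r s x * cos x + V s x * 0 - (U_r s x * sin x + U s x * 0)));
    [unfold G1r; ring|].
  apply d_minus;
    [apply (d_mult (fun s => V s x) (fun _ => cos x))
    |apply (d_mult (fun s => U s x) (fun _ => sin x))];
    try apply d_const; [apply (C2_r _ _ _ _ _ _ _ HV)|apply (C2_r _ _ _ _ _ _ _ HU)]; exact K.
- apply (d_eq _ _ (V_t r th * cos th + V r th * - sin th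
    - (U_t r th * sin th + U r th * cos th))); [unfold G1t; ring|].
  apply d_minus; apply d_mult; assumption.
- unfold G1r; apply continuity_2d_pt_minus; apply continuity_2d_pt_mult; assumption.
- generalize (O_open r th H). apply locally_2d_impl, locally_2d_forall. intros s x K.
  apply (d_eq _ _ (V_r s x * sin x + V s x * 0 + (U_r s x * cos x + U s x * 0)));
    [unfold G2r; ring|].
  apply d_plus;
    [apply (d_mult (fun s => V s x) (fun _ => sin x))
    |apply (d_mult (fun s => U s x) (fun _ => cos x))];
    try apply d_const; [apply (C2_r _ _ _ _ _ _ _ HV)|apply (C2_r _ _ _ _ _ _ _ HU)]; exact K.
- apply (d_eq _ _ (V_t r th * sin th + V r th * cos th
    + (U_t r th * cos th + U r th * - sin th))); [unfold G2t; ring|].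
  apply d_plus; apply d_mult; assumption.
- unfold G2r; apply continuity_2d_pt_plus; apply continuity_2d_pt_mult; assumption.
Qed.

Lemma velocity_polar (r th : R) : O r th ->
  fst (u (r * cos th) (r * sin th)) = G1 r th /\ snd (u (r * cos th) (r * sin th)) = G2 r th.
Proof.
intros H. rewrite u_polar by exact H. unfold polar_vector, e_theta, e_r, G1, G2.
simpl. unfold plus, scal; simpl. unfold mult; simpl. split; ring.
Qed.

Lemma velocity_derivatives (r th : R) : O r th ->
  Defs.Dx (fun x y => fst (u x y)) (r * cos th) (r * sin th)
    = G1r r th * cos th - G1t r th * sin th / r /\
  Dy (fun x y => fst (u x y)) (r * cos th) (r * sin th)
    = G1r r th * sin th + G1t r th * cos th / r /\
  Defs.Dx (fun x y => snd (u x y)) (r * cos th) (r * sin th)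
    = G2r r th * cos th - G2t r th * sin th / r /\
  Dy (fun x y => snd (u x y)) (r * cos th) (r * sin th)
    = G2r r th * sin th + G2t r th * cos th / r.
Proof.
intros H. destruct (velocity_differentiable r th H) as [D1 D2].
pose proof (polar_differentiable (fun x y => fst (u x y)) G1 r th _ _
  (fun r th K => proj1 (velocity_polar r th K)) H D1) as K1.
pose proof (polar_differentiable (fun x y => snd (u x y)) G2 r th _ _
  (fun r th K => proj2 (velocity_polar r th K)) H D2) as K2.
apply differentiable_pt_lim_unique in K1. apply differentiable_pt_lim_unique in K2.
unfold Defs.Dx, Dy. tauto.
Qed.

(** The Cartesian components of [u . grad u], in polar coordinates. *)
Let A1 r th := V r th * G1r r th + U r th / r * G1t r th.
Let A2 r th := V r th * G2r r th + U r th / r * G2t r th.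

Lemma pressure_gradient (r th : R) : O r th ->
  Defs.Dx P (r * cos th) (r * sin th) = - A1 r th /\
  Dy P (r * cos th) (r * sin th) = - A2 r th /\
  V r th + r * V_r r th + U_t r th = 0.
Proof.
intros H. pose proof (O_pos r th H) as Hr.
destruct (euler _ _ (Oc_polar r th H)) as [_ [E1 [E2 E3]]].
destruct (velocity_derivatives r th H) as [X1 [Y1 [X2 Y2]]].
destruct (velocity_polar r th H) as [U1 U2].
rewrite X1, Y1, U1, U2 in E1. rewrite X2, Y2, U1, U2 in E2. rewrite X1, Y2 in E3.
pose proof (cos2_sin2 th) as HC.
assert (HC2 : sin th * sin th = 1 - cos th * cos th) by lra.
split; [|split].
- rewrite <- (Ropp_involutive (Defs.Dx P _ _)), <- E1. f_equal.
  unfold A1, G1, G2.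
  transitivity ((V r th * G1r r th + U r th / r * G1t r th)
    * (cos th * cos th + sin th * sin th)); [field; lra|rewrite HC; ring].
- rewrite <- (Ropp_involutive (Dy P _ _)), <- E2. f_equal.
  unfold A2, G1, G2.
  transitivity ((V r th * G2r r th + U r th / r * G2t r th)
    * (cos th * cos th + sin th * sin th)); [field; lra|rewrite HC; ring].
- unfold G1r, G1t, G2r, G2t in E3.
  assert (E4 : (V r th + r * V_r r th + U_t r th) * (cos th * cos th + sin th * sin th) = r * 0).
  { rewrite <- E3. field. lra. }
  rewrite HC in E4. lra.
Qed.

Lemma pressure_differentiable (r th : R) : O r th ->
  differentiable_pt_lim P (r * cos th) (r * sin th) (- A1 r th) (- A2 r th).
Proof.
intros H. pose proof (O_pos r th H) as Hr.
destruct (pressure_gradient r th H) as [E1 [E2 _]].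
rewrite <- E1, <- E2.
apply (differentiable_of_partials P (Defs.Dx P)).
- generalize (chart_locally r th H). apply locally_2d_impl, locally_2d_forall.
  intros x y [K [Ex Ey]].
  pose proof (euler _ _ (Oc_polar _ _ K)) as [[_ [_ [_ [_ [HP _]]]]] _].
  rewrite <- Ex, <- Ey in HP. apply Derive_correct, HP.
- destruct (euler _ _ (Oc_polar r th H)) as [[_ [_ [_ [_ [_ HP]]]]] _].
  apply Derive_correct, HP.
- apply (polar_continuity (Defs.Dx P) (fun r th => - A1 r th)); auto.
  + intros r' th' K; apply (pressure_gradient r' th' K).
  + destruct (C2_cont _ _ _ _ _ _ _ HU r th H) as [CU [CUr [CUt _]]].
    destruct (C2_cont _ _ _ _ _ _ _ HV r th H) as [CV [CVr [CVt _]]].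
    pose proof (cont_cos_th r th). pose proof (cont_sin_th r th).
    assert (continuity_2d_pt (fun r _ => / r) r th).
    { apply continuity_2d_pt_inv; [apply continuity_2d_pt_id1|lra]. }
    unfold A1, G1r, G1t, Rdiv.
    repeat first [ assumption | apply continuity_2d_pt_opp | apply continuity_2d_pt_plus
      | apply continuity_2d_pt_minus | apply continuity_2d_pt_mult ].
Qed.

Lemma incompressible_polar (r th : R) : O r th -> V r th + r * V_r r th + U_t r th = 0.
Proof. intros H; apply (pressure_gradient r th H). Qed.

Lemma pressure_polar (r th : R) : O r th ->
  is_derive (fun r => P (r * cos th) (r * sin th)) r
    (- (V r th * V_r r th + U r th * (V_t r th - U r th) / r)) /\
  is_derive (fun th => P (r * cos th) (r * sin th)) th
    (- (r * V r th * U_r r th + U r th * (V r th + U_t r th))).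
Proof.
intros H. pose proof (O_pos r th H) as Hr.
destruct (cartesian_differentiable P r th _ _ (pressure_differentiable r th H)) as [D1 D2].
pose proof (cos2_sin2 th) as HC.
split; [refine (d_eq _ _ _ _ _ D1)|refine (d_eq _ _ _ _ _ D2)];
  unfold A1, A2, G1r, G1t, G2r, G2t.
- transitivity (- (V r th * V_r r th + U r th * (V_t r th - U r th) / r)
    * (cos th * cos th + sin th * sin th)); [field; lra|rewrite HC; ring].
- transitivity (- (r * V r th * U_r r th + U r th * (V r th + U_t r th))
    * (cos th * cos th + sin th * sin th)); [field; lra|rewrite HC; ring].
Qed.

(** The vorticity, [(U + r * U_r - V_t) / r], has zero derivative along the flow. *)
Lemma vorticity_polar (r th : R) : O r th ->
  r * V r th * ((2 * U_r r th + r * U_rr r th - V_tr r th) / r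
    - (U r th + r * U_r r th - V_t r th) / (r * r))
  + U r th * ((U_t r th + r * U_rt r th - V_tt r th) / r) = 0.
Proof.
intros H. pose proof (O_pos r th H) as Hr.
assert (MU : U_rt r th = U_tr r th).
{ apply (mixed_partials O U U_r U_t); auto;
  try (intros; apply HU; assumption); intros x y K;
  destruct (C2_cont _ _ _ _ _ _ _ HU x y K); tauto. }
assert (MV : V_rt r th = V_tr r th).
{ apply (mixed_partials O V V_r V_t); auto;
  try (intros; apply HV; assumption); intros x y K;
  destruct (C2_cont _ _ _ _ _ _ _ HV x y K); tauto. }
set (prt r th := - (V_t r th * V_r r th + V r th * V_rt r th
  + (U_t r th * (V_t r th - U r th) + U r th * (V_tt r th - U_t r th)) * / r)).
set (ptr r th := - ((V r th + r * V_r r th) * U_r r th + r * V r th * U_rr r th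
  + (U_r r th * (V r th + U_t r th) + U r th * (V_r r th + U_tr r th)))).
assert (MP : prt r th = ptr r th).
{ apply (mixed_partials O (fun r th => P (r * cos th) (r * sin th))
    (fun r th => - (V r th * V_r r th + U r th * (V_t r th - U r th) * / r))
    (fun r th => - (r * V r th * U_r r th + U r th * (V r th + U_t r th)))); auto.
  - intros x y K; apply (pressure_polar x y K).
  - intros x y K; apply (pressure_polar x y K).
  - intros x y K. apply d_opp.
    apply (d_plus (fun y => V x y * V_r x y)
      (fun y => U x y * (V_t x y - U x y) * / x)).
    + apply (d_mult (fun y => V x y) (fun y => V_r x y));
        [apply (C2_t _ _ _ _ _ _ _ HV)|apply (C2_rt _ _ _ _ _ _ _ HV)]; exact K.
    + apply (d_eq _ _ ((U_t x y * (V_t x y - U x y) + U x y * (V_tt x y - U_t x y)) * / x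
        + U x y * (V_t x y - U x y) * 0)); [ring|].
      apply (d_mult (fun y => U x y * (V_t x y - U x y)) (fun _ => / x)); [|apply d_const].
      apply (d_mult (fun y => U x y) (fun y => V_t x y - U x y));
        [apply (C2_t _ _ _ _ _ _ _ HU); exact K|].
      apply (d_minus (fun y => V_t x y) (fun y => U x y));
        [apply (C2_tt _ _ _ _ _ _ _ HV)|apply (C2_t _ _ _ _ _ _ _ HU)]; exact K.
  - intros x y K. apply d_opp.
    apply (d_plus (fun x => x * V x y * U_r x y)
      (fun x => U x y * (V x y + U_t x y))).
    + apply (d_mult (fun x => x * V x y) (fun x => U_r x y));
        [|apply (C2_rr _ _ _ _ _ _ _ HU); exact K].
      apply (d_eq _ _ (1 * V x y + x * V_r x y)); [ring|].
      apply (d_mult (fun x => x) (fun x => V x y)); [apply d_id|].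
      apply (C2_r _ _ _ _ _ _ _ HV); exact K.
    + apply (d_mult (fun x => U x y) (fun x => V x y + U_t x y));
        [apply (C2_r _ _ _ _ _ _ _ HU); exact K|].
      apply (d_plus (fun x => V x y) (fun x => U_t x y));
        [apply (C2_r _ _ _ _ _ _ _ HV)|apply (C2_tr _ _ _ _ _ _ _ HU)]; exact K.
  - intros x y K. pose proof (O_pos x y K).
    destruct (C2_cont _ _ _ _ _ _ _ HU x y K) as [? [? [? [? [? [? ?]]]]]].
    destruct (C2_cont _ _ _ _ _ _ _ HV x y K) as [? [? [? [? [? [? ?]]]]]].
    assert (continuity_2d_pt (fun r _ => / r) x y).
    { apply continuity_2d_pt_inv; [apply continuity_2d_pt_id1|lra]. }
    unfold prt.
    repeat first [ assumption | apply continuity_2d_pt_opp | apply continuity_2d_pt_plus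
      | apply continuity_2d_pt_minus | apply continuity_2d_pt_mult ].
  - intros x y K.
    destruct (C2_cont _ _ _ _ _ _ _ HU x y K) as [? [? [? [? [? [? ?]]]]]].
    destruct (C2_cont _ _ _ _ _ _ _ HV x y K) as [? [? [? [? [? [? ?]]]]]].
    assert (continuity_2d_pt (fun r _ => r) x y) by apply continuity_2d_pt_id1.
    unfold ptr.
    repeat first [ assumption | apply continuity_2d_pt_opp | apply continuity_2d_pt_plus
      | apply continuity_2d_pt_minus | apply continuity_2d_pt_mult ]. }
pose proof (incompressible_polar r th H) as HD.
unfold prt, ptr in MP. rewrite MU, <- MV.
(* The curl of the momentum equation differs from the transport equation by
   multiples of the divergence. *)
transitivity ((V_t r th * V_r r th + V r th * V_rt r th
    + (U_t r th * (V_t r th - U r th) + U r th * (V_tt r th - U_t r th)) * / r) * -1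
  + ((V r th + r * V_r r th) * U_r r th + r * V r th * U_rr r th
    + (U_r r th * (V r th + U_t r th) + U r th * (V_r r th + U_tr r th)))
  - (V r th + r * V_r r th + U_t r th)
    * (U_r r th + U r th / r - V_t r th / r)).
- field. lra.
- rewrite HD. lra.
Qed.

End Open_polar_set.

(** * The flow of a solution of the Euler equations *)

Lemma cont2_inv (f : R -> R -> R) :
  cont2 f -> (forall x y, f x y <> 0) -> cont2 (fun x y => / f x y).
Proof. intros Hf Hn x y; apply continuity_2d_pt_inv; auto. Qed.

Lemma polar_domain_open (a : R) (b : Rbar) (L r th : R) :
  polar_domain a b L r th -> locally_2d (polar_domain a b L) r th.
Proof.
intros [H1 [H2 [H3 H4]]].
destruct (filter_and _ _ (open_Rbar_gt' r a H1) (open_Rbar_lt' r b H2)) as [d1 Hd1].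
destruct (filter_and _ _ (open_Rbar_gt' th 0 H3) (open_Rbar_lt' th L H4)) as [d2 Hd2].
assert (Hm : 0 < Rmin d1 d2) by (apply Rmin_glb_lt; apply cond_pos).
exists (mkposreal _ Hm). intros u v Hu Hv; simpl in Hu, Hv.
assert (K1 : ball r d1 u) by (eapply Rlt_le_trans; [exact Hu|apply Rmin_l]).
assert (K2 : ball th d2 v) by (eapply Rlt_le_trans; [exact Hv|apply Rmin_r]).
destruct (Hd1 u K1) as [J1 J2]. destruct (Hd2 v K2) as [J3 J4].
repeat split; assumption.
Qed.

Lemma domain_admissible (a : R) (b : Rbar) (r : R) :
  0 <= a -> a < r -> Rbar_lt r b -> admissible a b r.
Proof. intros H0 H1 H2; repeat split; try lra. apply Rbar_lt_le, H2. Qed.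

Section Sector_flow.

Context (a : R) (b : Rbar) (Ha : 0 <= a) (Hab : Rbar_lt a b) (L : R) (HL : 0 < L).

Let D := polar_closure a b L.

Lemma C2_data_of_Ck (f : R -> R -> R) : Ck 2 D f ->
  C2_data (polar_domain a b L) f (pd_r D f) (pd_theta D f)
    (pd_r D (pd_r D f)) (pd_theta D (pd_r D f))
    (pd_r D (pd_theta D f)) (pd_theta D (pd_theta D f)).
Proof.
intros [C [E [[Cr [Er [[Crr _] [Crt _]]]] [Ct [Et [[Ctr _] [Ctt _]]]]]]].
assert (HD : forall r th, polar_domain a b L r th -> D r th).
{ intros r th [H1 [H2 H3]]; split; [apply domain_admissible; auto|lra]. }
assert (Hr : forall g, (forall r th, D r th -> ex_pd_r D g r th /\ ex_pd_theta D g r th) ->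
  forall r th, polar_domain a b L r th -> is_derive (fun s => g s th) r (pd_r D g r th)).
{ intros g Hg r th H. pose proof (proj1 (Hg r th (HD r th H))) as Hex. destruct H as [H1 [H2 H3]].
  apply is_derive_pd_r; auto; lra. }
assert (Ht : forall g, (forall r th, D r th -> ex_pd_r D g r th /\ ex_pd_theta D g r th) ->
  forall r th, polar_domain a b L r th -> is_derive (fun s => g r s) th (pd_theta D g r th)).
{ intros g Hg r th H. pose proof (proj2 (Hg r th (HD r th H))) as Hex.
  pose proof (proj1 (HD r th H)) as Hadm. destruct H as [H1 [H2 H3]].
  apply is_derive_pd_theta; auto; lra. }
split; auto.
intros r th H.
repeat split; apply (cont_sector_inner a b Ha Hab L HL); auto.
Qed.

Context (U V : R -> R -> R) (u : R -> R -> R * R) (P : R -> R -> R) (c : R).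
Context (HU : Ck 2 D U) (HV : Ck 2 D V).
Context (Hu : forall r th, polar_domain a b L r th ->
  u (r * cos th) (r * sin th) = polar_vector (U r th) (V r th) th).
Context (Heuler : steady_euler (Omega a b L) u P).

Lemma Omega_polar (r th : R) :
  polar_domain a b L r th -> Omega a b L (r * cos th) (r * sin th).
Proof. intros H; exists r, th; auto. Qed.

Lemma sector_pressure (r th : R) : polar_domain a b L r th ->
  is_derive (fun r => P (r * cos th) (r * sin th)) r
    (- (V r th * pd_r D V r th + U r th * (pd_theta D V r th - U r th) / r)) /\
  is_derive (fun th => P (r * cos th) (r * sin th)) th
    (- (r * V r th * pd_r D U r th + U r th * (V r th + pd_theta D U r th))).
Proof.
intros H.
apply (pressure_polar (polar_domain a b L) (polar_domain_open a b L)
  (fun r th H => Rle_lt_trans _ _ _ Ha (proj1 H)) _ _ _ _ _ _ _ _ _ _ _ _ _ _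
  (C2_data_of_Ck U HU) (C2_data_of_Ck V HV) _ u P Omega_polar Hu Heuler r th H).
Qed.

Context (Hsides : forall r, admissible a b r -> U r 0 = c / r /\ U r L = c / r).
Context (Hper : forall r, admissible a b r -> V r 0 = V r L).
Context (Hnz : forall r th, D r th -> V r th <> 0).

(** In logarithmic polar coordinates, a solution is a flow on a strip. *)
Lemma sector_flow :
  exists F : strip_flow (ln_end a) (ln_end b) L c,
  forall t th, admissible a b (exp t) -> 0 <= th <= L ->
    rad F t th = exp t * V (exp t) th /\
    ang F t th = exp t * U (exp t) th /\
    vor F t th =
      (U (exp t) th + exp t * pd_r D U (exp t) th - pd_theta D V (exp t) th) / exp t /\
    rad_th F t th = exp t * pd_theta D V (exp t) th.
Proof.
pose proof HU as [CU [EU [[CUr [EUr [[CUrr _] [CUrt _]]]] [CUt [EUt [[CUtr _] [CUtt _]]]]]]].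
pose proof HV as [CV [EV [[CVr [EVr [[CVrr _] [CVrt _]]]] [CVt [EVt [[CVtr _] [CVtt _]]]]]]].
set (Ur := pd_r D U) in *. set (Ut := pd_theta D U) in *.
set (Vr := pd_r D V) in *. set (Vt := pd_theta D V) in *.
set (Urr := pd_r D Ur) in *. set (Urt := pd_theta D Ur) in *.
set (Vtr := pd_r D Vt) in *. set (Vtt := pd_theta D Vt) in *.
set (lo := ln_end a). set (hi := ln_end b).
set (pl := pull a b L).
set (rho := fun t (_ : R) => clamp_r a b (exp t)).
assert (Crho : cont2 rho).
{ apply (pull_cont a b Ha Hab L HL (fun r _ => r)). intros p _.
  apply filterlim_locally. intros eps. exists eps. intros q [Hq _] _. exact Hq. }
assert (Prho : forall t th, 0 < rho t th).
{ intros t th. destruct (clamp_r_admissible a b Ha Hab (exp t) (exp_pos t)) as [H _]; exact H. }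
assert (Irho : cont2 (fun t th => / rho t th)).
{ apply cont2_inv; [exact Crho|]. intros t th; pose proof (Prho t th); lra. }
assert (PC : forall f, cont_sector a b L f -> cont2 (pl f)) by (intros; apply pull_cont; auto).
pose proof (PC U CU) as PU. pose proof (PC V CV) as PV.
pose proof (PC Ur CUr) as PUr. pose proof (PC Ut CUt) as PUt.
pose proof (PC Vr CVr) as PVr. pose proof (PC Vt CVt) as PVt.
pose proof (PC Urr CUrr) as PUrr. pose proof (PC Urt CUrt) as PUrt.
pose proof (PC Vtr CVtr) as PVtr. pose proof (PC Vtt CVtt) as PVtt.
(* Derivatives of the velocity, one-sided in the angle on the sides. *)
assert (DR : forall g, (forall r th, D r th -> ex_pd_r D g r th /\ ex_pd_theta D g r th) ->
  forall r th, a < r -> Rbar_lt r b -> 0 <= th <= L ->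
  is_derive (fun s => g s th) r (pd_r D g r th)).
{ intros g Hg r th H1 H2 H3. apply is_derive_pd_r; auto.
  apply Hg; split; [apply domain_admissible|]; auto. }
assert (DT : forall g, (forall r th, D r th -> ex_pd_r D g r th /\ ex_pd_theta D g r th) ->
  forall r th, admissible a b r -> 0 < th < L ->
  is_derive (fun s => g r s) th (pd_theta D g r th)).
{ intros g Hg r th H1 H2. apply is_derive_pd_theta; auto. apply Hg; split; auto; lra. }
set (vort := fun r th => (U r th + r * Ur r th - Vt r th) / r).
set (vort_r := fun r th => (2 * Ur r th + r * Urr r th - Vtr r th) / r
  - (U r th + r * Ur r th - Vt r th) / (r * r)).
set (vort_th := fun r th => (Ut r th + r * Urt r th - Vtt r th) / r).
assert (Hin : forall t th, inside lo hi t -> 0 < th < L -> polar_domain a b L (exp t) th).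
{ intros t th Ht Hth. destruct (inside_exp a b Ha Hab t Ht); repeat split; auto; lra. }
assert (Hadm : forall t, within_ends lo hi t -> admissible a b (exp t)).
{ intros t Ht. apply (proj1 (within_exp a b Ha Hab t)), Ht. }
assert (Hrho : forall t th, within_ends lo hi t -> rho t th = exp t).
{ intros t th Ht. apply clamp_r_id; auto. }
assert (F1 : cont2 (pl (fun r th => r * V r th))).
{ change (cont2 (fun t th => rho t th * pl V t th)). apply cont2_mult; assumption. }
assert (F2 : cont2 (pl (fun r th => r * U r th))).
{ change (cont2 (fun t th => rho t th * pl U t th)). apply cont2_mult; assumption. }
assert (F4 : cont2 (pl (fun r th => r * Vt r th))).
{ change (cont2 (fun t th => rho t th * pl Vt t th)). apply cont2_mult; assumption. }
assert (F5 : cont2 (pl (fun r th => r * Ut r th))).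
{ change (cont2 (fun t th => rho t th * pl Ut t th)). apply cont2_mult; assumption. }
assert (F3 : cont2 (pl vort)).
{ change (cont2 (fun t th =>
    (pl U t th + rho t th * pl Ur t th - pl Vt t th) * / rho t th)).
  repeat first [assumption | apply cont2_mult | apply cont2_minus | apply cont2_plus]. }
assert (F6 : cont2 (pl (fun r th => r * vort_r r th))).
{ apply (cont2_ext (fun t th => rho t th *
    ((2 * pl Ur t th + rho t th * pl Urr t th - pl Vtr t th) * / rho t th
     - (pl U t th + rho t th * pl Ur t th - pl Vt t th) * (/ rho t th * / rho t th)))).
  - intros t th. pose proof (Prho t th). unfold pl, pull, vort_r, rho in *. field. lra.
  - repeat first [assumption | apply cont2_mult | apply cont2_minus | apply cont2_plus
      | apply cont2_const]. }
assert (F7 : cont2 (pl vort_th)).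
{ change (cont2 (fun t th =>
    (pl Ut t th + rho t th * pl Urt t th - pl Vtt t th) * / rho t th)).
  repeat first [assumption | apply cont2_mult | apply cont2_minus | apply cont2_plus]. }
(* Incompressibility extends by continuity to the sides. *)
assert (Hdiv : forall t th, inside lo hi t -> 0 <= th <= L ->
  pl V t th + rho t th * pl Vr t th + pl Ut t th = 0).
{ intros t th Ht. apply (zero_closed
    (fun th => pl V t th + rho t th * pl Vr t th + pl Ut t th) 0 L HL).
  - intros x. apply (cont2_slice2
      (fun t th => pl V t th + rho t th * pl Vr t th + pl Ut t th)).
    repeat first [assumption | apply cont2_mult | apply cont2_plus].
  - intros x Hx. pose proof (inside_within _ _ _ Ht) as Ht'.
    rewrite Hrho by exact Ht'. unfold pl.
    rewrite !(pull_in a b Ha Hab L HL) by (auto; lra).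
    apply (incompressible_polar (polar_domain a b L) (polar_domain_open a b L)
      (fun r th H => Rle_lt_trans _ _ _ Ha (proj1 H)) _ _ _ _ _ _ _ _ _ _ _ _ _ _
      (C2_data_of_Ck U HU) (C2_data_of_Ck V HV) _ u P Omega_polar Hu Heuler).
    apply Hin; assumption. }
assert (Dprod : forall g, (forall r th, D r th -> ex_pd_r D g r th /\ ex_pd_theta D g r th) ->
  forall t th, inside lo hi t -> 0 <= th <= L ->
  is_derive (fun t => pl (fun r th => r * g r th) t th) t
    (rho t th * (pl g t th + rho t th * pl (pd_r D g) t th))).
{ intros g Hg t th Ht Hth.
  apply (pull_derive_t a b Ha Hab L HL (fun r th => r * g r th)
    (fun r th => g r th + r * pd_r D g r th)); auto.
  intros r x H1 H2 H3. apply (d_eq _ _ (1 * g r x + r * pd_r D g r x)); [ring|].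
  apply (d_mult (fun r => r) (fun r => g r x)); [apply d_id|apply DR; auto]. }
assert (Dprodt : forall g, (forall r th, D r th -> ex_pd_r D g r th /\ ex_pd_theta D g r th) ->
  forall t th, inside lo hi t -> 0 < th < L ->
  is_derive (fun th => pl (fun r th => r * g r th) t th) th
    (pl (fun r th => r * pd_theta D g r th) t th)).
{ intros g Hg t th Ht Hth.
  apply (pull_derive_th a b Ha Hab L HL (fun r th => r * g r th)); auto.
  intros r x H1 H2. apply d_scal, DT; auto. }
unshelve eexists.
{ refine (Build_strip_flow lo hi L c
    (pl (fun r th => r * V r th)) (pl (fun r th => r * U r th)) (pl vort)
    (pl (fun r th => r * Vt r th)) (pl (fun r th => r * Ut r th))
    (pl (fun r th => r * vort_r r th)) (pl vort_th)
    F1 F2 F3 F4 F5 F6 F7 HL _ _ _ _ _ _ _ _ _ _ _).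
  - intros t th Ht Hth. refine (d_eq _ _ _ _ _ (Dprod V EV t th Ht Hth)).
    change (pl (fun r th => r * Ut r th) t th) with (rho t th * pl Ut t th).
    pose proof (Hdiv t th Ht Hth) as E. fold Vr. nra.
  - intros t th Ht Hth. refine (d_eq _ _ _ _ _ (Dprod U EU t th Ht Hth)).
    pose proof (Prho t th) as Hp.
    replace (exp (2 * t)) with (rho t th * rho t th).
    + change (pl (fun r th => r * Vt r th) t th) with (rho t th * pl Vt t th).
      change (pl vort t th) with ((pl U t th + rho t th * pl Ur t th - pl Vt t th) / rho t th).
      fold Ur. field. lra.
    + rewrite Hrho by (apply inside_within; exact Ht). rewrite <- exp_plus. f_equal; ring.
  - intros t th Ht Hth. apply (pull_derive_t a b Ha Hab L HL vort vort_r); auto.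
    intros r x H1 H2 H3. assert (Hr : 0 < r) by lra.
    apply (d_eq _ _ ((Ur r x + (1 * Ur r x + r * Urr r x) - Vtr r x) * / r
      + (U r x + r * Ur r x - Vt r x) * (- / (r * r)))).
    + unfold vort_r. field. lra.
    + apply (d_mult (fun r => U r x + r * Ur r x - Vt r x) (fun r => / r)).
      * apply (d_minus (fun r => U r x + r * Ur r x) (fun r => Vt r x)); [|apply DR; auto].
        apply (d_plus (fun r => U r x) (fun r => r * Ur r x)); [apply DR; auto|].
        apply (d_mult (fun r => r) (fun r => Ur r x)); [apply d_id|apply DR; auto].
      * auto_derive; [lra|]. field; lra.
  - intros t th Ht Hth. apply Dprodt; auto.
  - intros t th Ht Hth. apply Dprodt; auto.
  - intros t th Ht Hth. apply (pull_derive_th a b Ha Hab L HL vort vort_th); auto.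
    intros r x H1 H2. assert (Hr : 0 < r) by apply H1.
    apply (d_eq _ _ ((Ut r x + r * Urt r x - Vtt r x) * / r
      + (U r x + r * Ur r x - Vt r x) * 0)); [unfold vort_th, Rdiv; ring|].
    apply (d_mult (fun x => U r x + r * Ur r x - Vt r x) (fun _ => / r)); [|apply d_const].
    apply (d_minus (fun x => U r x + r * Ur r x) (fun x => Vt r x)); [|apply DT; auto].
    apply (d_plus (fun x => U r x) (fun x => r * Ur r x)); [apply DT; auto|].
    apply d_scal, DT; auto.
  - intros t th Ht Hth.
    pose proof (vorticity_polar (polar_domain a b L) (polar_domain_open a b L)
      (fun r th H => Rle_lt_trans _ _ _ Ha (proj1 H)) _ _ _ _ _ _ _ _ _ _ _ _ _ _
      (C2_data_of_Ck U HU) (C2_data_of_Ck V HV) _ u P Omega_polar Hu Heuler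
      (exp t) th (Hin t th Ht Hth)) as E.
    pose proof (inside_within _ _ _ Ht) as Ht'. unfold pl.
    rewrite !(pull_in a b Ha Hab L HL) by (auto; lra).
    transitivity (exp t * (exp t * V (exp t) th * vort_r (exp t) th
      + U (exp t) th * vort_th (exp t) th)); [ring|].
    unfold vort_r, vort_th, Urr, Urt, Vtr, Vtt, Ur, Ut, Vt.
    rewrite E. ring.
  - intros t Ht. unfold pl. rewrite (pull_in a b Ha Hab L HL) by (auto; lra).
    destruct (Hsides _ (Hadm t Ht)) as [E _]. rewrite E. pose proof (exp_pos t). field; lra.
  - intros t Ht. unfold pl. rewrite (pull_in a b Ha Hab L HL) by (auto; lra).
    destruct (Hsides _ (Hadm t Ht)) as [_ E]. rewrite E. pose proof (exp_pos t). field; lra.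
  - intros t Ht. unfold pl. rewrite !(pull_in a b Ha Hab L HL) by (auto; lra).
    rewrite (Hper _ (Hadm t Ht)). reflexivity.
  - intros t th Ht Hth. unfold pl. rewrite (pull_in a b Ha Hab L HL) by auto.
    pose proof (exp_pos t). apply Rmult_integral_contrapositive; split; [lra|].
    apply Hnz; split; auto. }
intros t th Ht Hth. simpl. unfold pl.
rewrite !(pull_in a b Ha Hab L HL) by auto. repeat split.
Qed.

End Sector_flow.

(** * Back to the plane *)

Lemma zero_within (lo hi : Rbar) (g : R -> R) : Rbar_lt lo hi ->
  (forall t, continuity_pt g t) -> (forall t, inside lo hi t -> g t = 0) ->
  forall t, within_ends lo hi t -> g t = 0.
Proof.
intros Hlt Hc H0 t Ht.
assert (Hs : exists s, within_ends lo hi s /\ s <> t).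
{ destruct Ht as [H1 H2]. destruct lo as [l| |], hi as [h| |]; simpl in *; try easy.
  - destruct (Req_dec t l); [exists h|exists l]; repeat split; simpl; lra.
  - exists (t + 1); repeat split; simpl; lra.
  - exists (t - 1); repeat split; simpl; lra.
  - exists (t - 1); repeat split; simpl; lra. }
destruct Hs as [s [Hs Hst]].
destruct (Rlt_dec s t).
- apply (zero_closed g s t); auto; [|lra].
  intros x Hx; apply H0, (inside_between lo hi s t); auto.
- apply (zero_closed g t s); auto; try lra.
  intros x Hx; apply H0, (inside_between lo hi t s); auto.
Qed.

Lemma ln_end_pos (x : R) : 0 < x -> ln_end (Finite x) = Finite (ln x).
Proof. intros H; simpl; destruct (Rle_dec x 0); [lra|reflexivity]. Qed.

Lemma ln_end_lt (a : R) (b : Rbar) : 0 <= a -> Rbar_lt a b -> Rbar_lt (ln_end a) (ln_end b).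
Proof.
intros Ha Hab. simpl. destruct b as [b| |]; simpl in *; try easy.
- destruct (Rle_dec b 0); [lra|]. destruct (Rle_dec a 0); simpl; [trivial|].
  apply ln_increasing; lra.
- destruct (Rle_dec a 0); simpl; trivial.
Qed.

Lemma constant_between (g : R -> R) (x y : R) :
  (forall z, Rmin x y <= z <= Rmax x y -> is_derive g z 0) -> g x = g y.
Proof.
intros H. destruct (Rtotal_order x y) as [E|[E|E]].
- rewrite Rmin_left, Rmax_right in H by lra. apply (eq_is_derive g x y H E).
- rewrite E; reflexivity.
- rewrite Rmin_right, Rmax_left in H by lra. symmetry; apply (eq_is_derive g y x H E).
Qed.

Section Conclusion.

Context (a : R) (b : Rbar) (Ha : 0 <= a) (Hab : Rbar_lt a b) (L : R) (HL : 0 < L).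

Let D := polar_closure a b L.

Context (U V : R -> R -> R) (u : R -> R -> R * R) (P : R -> R -> R) (c d : R).
Context (HU : Ck 2 D U) (HV : Ck 2 D V).
Context (Hu : forall r th, polar_domain a b L r th ->
  u (r * cos th) (r * sin th) = polar_vector (U r th) (V r th) th).
Context (Heuler : steady_euler (Omega a b L) u P).

(** The pressure of the homogeneous flow. *)
Lemma homogeneous_pressure :
  (forall r th, D r th -> U r th = c / r /\ V r th = d / r) ->
  exists K, forall r th, polar_domain a b L r th ->
    P (r * cos th) (r * sin th) = - (c ^ 2 + d ^ 2) / (2 * r ^ 2) + K.
Proof using Ha Hab HL HU HV Hu Heuler.
intros HUV.
assert (HD : forall r th, polar_domain a b L r th -> D r th).
{ intros r th [H1 [H2 H3]]; split; [apply domain_admissible; auto|lra]. }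
assert (Hpos : forall r th, polar_domain a b L r th -> 0 < r) by (intros r th [H _]; lra).
assert (Er : forall g k, Ck 2 D g -> (forall r th, D r th -> g r th = k / r) ->
  forall r th, polar_domain a b L r th ->
  pd_r D g r th = - k / (r * r) /\ pd_theta D g r th = 0).
{ intros g k Hg Eg r th H. pose proof (C2_data_of_Ck a b Ha Hab L HL g Hg) as G.
  pose proof (polar_domain_open a b L r th H) as [e He].
  assert (H0 : forall z, Rabs (z - z) < e)
    by (intros z; rewrite Rminus_diag, Rabs_R0; apply cond_pos).
  pose proof (Hpos r th H) as Hr. split.
  - transitivity (Derive (fun s => g s th) r).
    { symmetry; apply is_derive_unique, (C2_r _ _ _ _ _ _ _ _ G r th H). }
    apply is_derive_unique. apply (is_derive_ext_loc (fun s => k / s)).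
    + exists e. intros s Hs. symmetry; apply Eg, HD, He; [exact Hs|apply H0].
    + auto_derive; [lra|]. field; lra.
  - transitivity (Derive (fun s => g r s) th).
    { symmetry; apply is_derive_unique, (C2_t _ _ _ _ _ _ _ _ G r th H). }
    apply is_derive_unique. apply (is_derive_ext_loc (fun _ => k / r)); [|apply d_const].
    exists e. intros s Hs. symmetry; apply Eg, HD, He; [apply H0|exact Hs]. }
set (Q r th := P (r * cos th) (r * sin th) + (c ^ 2 + d ^ 2) / (2 * r ^ 2)).
assert (DQ : forall r th, polar_domain a b L r th ->
  is_derive (fun r => Q r th) r 0 /\ is_derive (fun th => Q r th) th 0).
{ intros r th H. pose proof (Hpos r th H) as Hr.
  destruct (sector_pressure a b Ha Hab L HL U V u P HU HV Hu Heuler r th H) as [D1 D2].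
  destruct (Er U c HU (fun r th H => proj1 (HUV r th H)) r th H) as [EUr EUt].
  destruct (Er V d HV (fun r th H => proj2 (HUV r th H)) r th H) as [EVr EVt].
  destruct (HUV r th (HD r th H)) as [EU EV].
  change (polar_closure a b L) with D in D1, D2.
  rewrite EVr, EVt, EU, EV in D1. rewrite EUr, EUt, EU, EV in D2. split.
  - apply (d_eq _ _ (- (d / r * (- d / (r * r)) + c / r * (0 - c / r) / r)
      + - (c ^ 2 + d ^ 2) / (r * r * r))); [field; lra|].
    apply (d_plus (fun r => P (r * cos th) (r * sin th))
      (fun r => (c ^ 2 + d ^ 2) / (2 * r ^ 2))); [exact D1|].
    auto_derive; [|field; lra]. assert (0 < r * r) by nra. lra.
  - apply (d_eq _ _ (- (r * (d / r) * (- c / (r * r)) + c / r * (d / r + 0)) + 0));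
      [field; lra|].
    apply (d_plus (fun th => P (r * cos th) (r * sin th))); [exact D2|apply d_const]. }
assert (Hr0 : exists r0, a < r0 /\ Rbar_lt r0 b).
{ destruct b as [b'| |]; simpl in *; try easy.
  - exists ((a + b') / 2); lra.
  - exists (a + 1); lra. }
destruct Hr0 as [r0 [Hr1 Hr2]].
exists (Q r0 (L / 2)). intros r th H.
assert (E : Q r th = Q r0 (L / 2)).
{ destruct H as [H1 [H2 H3]].
  assert (Hseg : forall z, Rmin r r0 <= z <= Rmax r r0 -> a < z /\ Rbar_lt z b).
  { intros z [Z1 Z2]. unfold Rmin, Rmax in *. split.
    - destruct Rle_dec; lra.
    - destruct Rle_dec; [apply (Rbar_le_lt_trans _ r0)|apply (Rbar_le_lt_trans _ r)]; simpl; auto. }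
  transitivity (Q r (L / 2)).
  - apply (constant_between (fun th => Q r th)). intros z Hz. refine (proj2 (DQ r z _)).
    repeat split; auto; unfold Rmin, Rmax in Hz; destruct Rle_dec; lra.
  - apply (constant_between (fun r => Q r (L / 2))). intros z Hz. refine (proj1 (DQ z (L / 2) _)).
    destruct (Hseg z Hz). repeat split; auto; lra. }
rewrite <- E. unfold Q. pose proof (Hpos r th H). field. lra.
Qed.

(** A flow rigid inside the strip is homogeneous on the closed sector. *)
Lemma homogeneous_velocity (F : strip_flow (ln_end a) (ln_end b) L c) :
  (forall t th, admissible a b (exp t) -> 0 <= th <= L ->
    rad F t th = exp t * V (exp t) th /\ ang F t th = exp t * U (exp t) th) ->
  (forall t th, inside (ln_end a) (ln_end b) t -> 0 <= th <= L ->
    ang F t th = c /\ rad F t th = d) ->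
  forall r th, D r th -> U r th = c / r /\ V r th = d / r.
Proof using Ha Hab HL.
intros HF Hrig r th [Hr Hth].
assert (Hr0 : 0 < r) by apply Hr.
assert (Hw : within_ends (ln_end a) (ln_end b) (ln r)).
{ apply (within_exp a b Ha Hab). rewrite exp_ln; assumption. }
assert (Hlt : Rbar_lt (ln_end a) (ln_end b)) by (apply ln_end_lt; assumption).
destruct (HF (ln r) th) as [E1 E2]; [rewrite exp_ln; assumption|exact Hth|].
rewrite exp_ln in E1, E2 by exact Hr0.
assert (Z1 : ang F (ln r) th - c = 0).
{ apply (zero_within (ln_end a) (ln_end b) (fun t => ang F t th - c)); auto.
  - intros t; apply (cont2_slice1 (fun t th => ang F t th - c)). solve_cont2.
  - intros t Ht; destruct (Hrig t th Ht Hth); lra. }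
assert (Z2 : rad F (ln r) th - d = 0).
{ apply (zero_within (ln_end a) (ln_end b) (fun t => rad F t th - d)); auto.
  - intros t; apply (cont2_slice1 (fun t th => rad F t th - d)). solve_cont2.
  - intros t Ht; destruct (Hrig t th Ht Hth); lra. }
split; apply (Rmult_eq_reg_l r); try lra.
- rewrite <- E2. replace (r * (c / r)) with c by (field; lra). lra.
- rewrite <- E1. replace (r * (d / r)) with d by (field; lra). lra.
Qed.

End Conclusion.

Lemma pd_r_mult (a : R) (b : Rbar) (L : R) (U : R -> R -> R) (r th : R) :
  0 <= a -> Rbar_lt a b -> 0 < L -> polar_closure a b L r th ->
  ex_pd_r (polar_closure a b L) U r th ->
  pd_r (polar_closure a b L) (fun r th => r * U r th) r th
  = U r th + r * pd_r (polar_closure a b L) U r th.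
Proof.
intros Ha Hab HL H Hex.
apply (pd_r_eq a b Ha Hab L HL); [exact H|].
apply (rel_derive_id_mult _ (fun s => U s th)).
apply (pd_r_spec a b Ha Hab L HL); assumption.
Qed.

Lemma pd_theta_mult (a : R) (b : Rbar) (L : R) (U : R -> R -> R) (r th : R) :
  0 <= a -> Rbar_lt a b -> 0 < L -> polar_closure a b L r th ->
  ex_pd_theta (polar_closure a b L) U r th ->
  pd_theta (polar_closure a b L) (fun r th => r * U r th) r th
  = r * pd_theta (polar_closure a b L) U r th.
Proof.
intros Ha Hab HL H Hex.
apply (pd_theta_eq a b Ha Hab L HL); [exact H|].
apply (rel_derive_scal _ (fun s => U r s)).
apply (pd_theta_spec a b Ha Hab L HL); assumption.
Qed.

Theorem corollary1
  (c a : R) (b : Rbar)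
  (hab : (a, b) = (1, Finite 2) \/ (a, b) = (0, Finite 1) \/
         (a, b) = (1, p_infty) \/ (a, b) = (0, p_infty))
  (utheta ur : R -> R -> R)
  (u : R -> R -> R * R) (P : R -> R -> R) :
  let dom := polar_domain a b (2 * PI) in
  let clo := polar_closure a b (2 * PI) in
  let adm := admissible a b in
  let angle theta := 0 <= theta <= 2 * PI in
  let rutheta r theta := r * utheta r theta in
  let rur r theta := r * ur r theta in
  forall
  (hC2_theta : Ck 2 clo utheta)
  (hC2_r : Ck 2 clo ur)
  (hu : forall r theta, dom r theta ->
     u (r * cos theta) (r * sin theta) =
     polar_vector (utheta r theta) (ur r theta) theta)
  (heuler : steady_euler (Omega a b (2 * PI)) u P)
  (hur : forall r theta, clo r theta -> Rabs (ur r theta) > 0)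
  (hper : forall r, adm r ->
     polar_vector (utheta r 0) (ur r 0) 0 =
     polar_vector (utheta r (2 * PI)) (ur r (2 * PI)) (2 * PI))
  (hside : forall r, adm r -> utheta r 0 = c / r /\ utheta r (2 * PI) = c / r)
  (h1 : (a, b) = (1, Finite 2) ->
     c = 0 /\
     forall theta, angle theta ->
       ur 1 theta = 2 * ur 2 theta /\
       utheta 1 theta = 2 * utheta 2 theta /\
       pd_r clo utheta 1 theta = 4 * pd_r clo utheta 2 theta)
  (h2 : forall nu : R -> R * R,
     ((a, b) = (0, Finite 1) /\ nu = e_r) \/
     ((a, b) = (1, p_infty) /\ nu = (fun theta => opp (e_r theta))) ->
     (forall theta, angle theta -> utheta 1 theta = c) /\
     ((c = 0 /\ (forall r theta, clo r theta -> ur r theta < 0) /\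
       (forall theta, angle theta ->
          pd_theta clo ur 1 theta >= pd_r clo rutheta 1 theta)) \/
      (c = 0 /\ (forall r theta, clo r theta -> ur r theta > 0) /\
       (forall theta, angle theta ->
          pd_theta clo ur 1 theta <= pd_r clo rutheta 1 theta)) \/
      ((forall theta, angle theta ->
          c * dot (polar_vector (utheta 1 theta) (ur 1 theta) theta) (nu theta) > 0) /\
       (exists A : R, forall r, adm r -> pd_theta clo rur r 0 = A)) \/
      ((forall theta, angle theta ->
          c * dot (polar_vector (utheta 1 theta) (ur 1 theta) theta) (nu theta) < 0) /\
       (exists A : R, forall r, adm r -> pd_theta clo rur r (2 * PI) = A))))
  (h3 : (a, b) = (0, p_infty) ->
     (c = 0 -> exists r0 : R, r0 > 0 /\
        (((forall r theta, clo r theta -> ur r theta < 0) /\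
          (forall theta, angle theta ->
             pd_theta clo ur r0 theta >= pd_r clo rutheta r0 theta)) \/
         ((forall r theta, clo r theta -> ur r theta > 0) /\
          (forall theta, angle theta ->
             pd_theta clo ur r0 theta <= pd_r clo rutheta r0 theta)))) /\
     (c <> 0 -> exists A : R,
        (forall r, adm r -> pd_theta clo rur r 0 = A) \/
        (forall r, adm r -> pd_theta clo rur r (2 * PI) = A))),
  minus1_homogeneous clo utheta ur /\
  minus2_homogeneous_upto_cst dom P /\
  exists d K : R, d <> 0 /\
    (forall r theta, clo r theta ->
       polar_vector (utheta r theta) (ur r theta) theta =
       polar_vector (c / r) (d / r) theta) /\
    (forall r theta, dom r theta ->
       P (r * cos theta) (r * sin theta) = - (c ^ 2 + d ^ 2) / (2 * r ^ 2) + K).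
Proof.
intros dom clo adm angle rutheta rur hC2_theta hC2_r hu heuler hur hper hside h1 h2 h3.
set (L := 2 * PI) in *.
assert (HL : 0 < L) by (unfold L; pose proof PI_RGT_0; lra).
assert (Ha : 0 <= a) by (destruct hab as [E|[E|[E|E]]]; injection E; intros; lra).
assert (Hab : Rbar_lt a b).
{ destruct hab as [E|[E|[E|E]]]; injection E; intros -> ->; simpl; auto; lra. }
assert (Hadm1 : adm 1).
{ destruct hab as [E|[E|[E|E]]]; injection E; intros -> ->; repeat split; simpl; lra. }
assert (Hnz : forall r th, clo r th -> ur r th <> 0).
{ intros r th H E. pose proof (hur r th H) as H0. rewrite E, Rabs_R0 in H0. lra. }
assert (Hper : forall r, adm r -> ur r 0 = ur r L).
{ intros r Hr. pose proof (f_equal fst (hper r Hr)) as E.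
  unfold polar_vector, e_theta, e_r in E. simpl in E.
  unfold plus, scal in E; simpl in E; unfold mult in E; simpl in E.
  unfold L in *. rewrite sin_0, cos_0, sin_2PI, cos_2PI in E. lra. }
destruct (sector_flow a b Ha Hab L HL utheta ur u P c hC2_theta hC2_r hu heuler
  hside Hper Hnz) as [F HF].
set (lo := ln_end a) in *. set (hi := ln_end b) in *.
pose proof hC2_theta as [_ [Exu _]]. pose proof hC2_r as [_ [Exv _]].
fold clo in Exu, Exv, HF.
assert (Hexp : forall t, within_ends lo hi t <-> adm (exp t))
  by apply (within_exp a b Ha Hab).
assert (H0 : within_ends lo hi 0) by (apply Hexp; rewrite exp_0; exact Hadm1).
assert (Hpdr : forall r th, clo r th -> pd_r clo rutheta r th
  = utheta r th + r * pd_r clo utheta r th).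
{ intros r th H. apply pd_r_mult; auto. apply Exu, H. }
assert (Hpdt : forall r th, clo r th -> pd_theta clo rur r th = r * pd_theta clo ur r th).
{ intros r th H. apply pd_theta_mult; auto. apply Exv, H. }
assert (Hvor : forall r th, clo r th ->
  r * vor F (ln r) th = pd_r clo rutheta r th - pd_theta clo ur r th).
{ intros r th H. assert (Hr : 0 < r) by apply H.
  destruct (HF (ln r) th) as [_ [_ [E _]]]; [rewrite exp_ln; [apply H|exact Hr]|apply H|].
  rewrite E, exp_ln, Hpdr by assumption. field. lra. }
assert (Hwln : forall r, adm r -> within_ends lo hi (ln r)).
{ intros r Hr. apply Hexp. rewrite exp_ln; [exact Hr|apply Hr]. }
assert (Hsign : forall r0, c = 0 -> adm r0 ->
  (((forall r theta, clo r theta -> ur r theta < 0) /\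
    (forall theta, angle theta -> pd_theta clo ur r0 theta >= pd_r clo rutheta r0 theta)) \/
   ((forall r theta, clo r theta -> ur r theta > 0) /\
    (forall theta, angle theta -> pd_theta clo ur r0 theta <= pd_r clo rutheta r0 theta))) ->
  calm_ends F -> forall t th, inside lo hi t -> 0 <= th <= L -> vor F t th = 0).
{ intros r0 Hc Hr0 Hs Hcalm.
  assert (Hk : exists k, k <> 0 /\ forall th, 0 <= th <= L -> 0 <= k * vor F (ln r0) th).
  { assert (Hr0' : 0 < r0) by apply Hr0.
    destruct Hs as [[_ Hs]|[_ Hs]]; [exists (-1)|exists 1]; (split; [lra|]); intros th Hth;
      pose proof (Hvor r0 th (conj Hr0 Hth)); pose proof (Hs th Hth); nra. }
  destruct Hk as [k [Hk0 Hk]]. clear Hvor HF.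
  revert F Hcalm Hk. rewrite Hc. intros F Hcalm Hk.
  apply (vor_zero_of_sign F k Hk0 Hcalm).
  intros t th Ht Hth. apply (vor_sign_spreads F k (ln r0)); auto using inside_within. }
assert (Hrad : forall t th, within_ends lo hi t -> 0 <= th <= L ->
  0 < ur 1 0 * rad F t th).
{ intros t th Ht Hth. pose proof (rad_same_sign F 0 0 t th H0 Ht) as H.
  destruct (HF 0 0) as [E _]; [rewrite exp_0; exact Hadm1|lra|].
  rewrite E, exp_0, Rmult_1_l in H. apply H; lra. }
assert (Hradth : forall t th, inside lo hi t -> 0 <= th <= L ->
  rad_th F t th = pd_theta clo rur (exp t) th).
{ intros t th Ht Hth. pose proof (proj1 (Hexp t) (inside_within _ _ _ Ht)) as Ha'.
  rewrite Hpdt by (split; assumption). apply (HF t th Ha' Hth). }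
assert (Hang1 : (forall th, angle th -> utheta 1 th = c) ->
  forall th, 0 <= th <= L -> ang F (ln 1) th = c).
{ intros H th Hth. rewrite ln_1. destruct (HF 0 th) as [_ [E _]];
    [rewrite exp_0; exact Hadm1|exact Hth|].
  rewrite E, exp_0, Rmult_1_l. apply H, Hth. }
assert (Hdot : forall s th,
  dot (polar_vector (utheta 1 th) (ur 1 th) th) (s * cos th, s * sin th) = s * ur 1 th).
{ intros s th. unfold dot, polar_vector, e_theta, e_r. simpl.
  unfold plus, scal; simpl; unfold mult; simpl.
  transitivity (s * ur 1 th * (cos th * cos th + sin th * sin th)); [ring|].
  rewrite cos2_sin2; ring. }
assert (Hside : forall A e d, c <> 0 -> calm_ends F ->
  (d = 1 /\ lo = m_infty \/ d = -1 /\ hi = p_infty) ->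
  (e = 0 /\ 0 < d * c * ur 1 0 \/ e = L /\ 0 < - (d * c) * ur 1 0) ->
  (forall r, adm r -> pd_theta clo rur r e = A) ->
  forall t th, inside lo hi t -> 0 <= th <= L -> vor F t th = 0).
{ intros A e d Hc Hcalm Hd He HA.
  apply (vor_zero_from_side F A e d 0); auto.
  - assert (Hu0 : ur 1 0 <> 0) by (apply Hnz; split; [exact Hadm1|lra]).
    assert (Hp : forall k x, 0 < k * ur 1 0 -> 0 < ur 1 0 * x -> 0 < k * x).
    { intros k x K1 K2. pose proof (Rmult_lt_0_compat _ _ K1 K2) as K3.
      apply (Rmult_lt_reg_r (ur 1 0 * ur 1 0)); [nra|]. lra. }
    destruct He as [[-> He]|[-> He]]; [left|right]; (split; [reflexivity|]);
      intros t th Ht Hth; apply Hp; auto.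
  - intros t Ht. rewrite Hradth; [|exact Ht|destruct He as [[-> _]|[-> _]]; lra].
    apply HA, Hexp, inside_within, Ht. }
assert (Hclaim : (calm_ends F \/
   exists l h, lo = Finite l /\ hi = Finite h /\ l <= h /\
     forall th, 0 <= th <= L -> rad F l th = rad F h th /\ ang F l th = ang F h th) /\
  forall t th, inside lo hi t -> 0 <= th <= L -> vor F t th = 0).
{ assert (Hln : forall x, 0 < x -> ln_end (Finite x) = Finite (ln x)) by apply ln_end_pos.
  destruct hab as [E|[E|[E|E]]].
  - (* 1 < r < 2: the values on the two circles agree up to scaling *)
    destruct (h1 E) as [Hc Hcirc]. injection E; intros Eb Ea.
    assert (Hlo : lo = Finite (ln 1)) by (unfold lo; rewrite Ea; apply Hln; lra).
    assert (Hhi : hi = Finite (ln 2)) by (unfold hi; rewrite Eb; apply Hln; lra).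
    assert (Hadm2 : adm 2) by (unfold adm; rewrite Ea, Eb; repeat split; simpl; lra).
    assert (Hln12 : ln 1 <= ln 2) by (apply ln_le; lra).
    assert (Hends : forall th, 0 <= th <= L ->
      rad F (ln 1) th = rad F (ln 2) th /\ ang F (ln 1) th = ang F (ln 2) th).
    { intros th Hth. destruct (Hcirc th Hth) as [E1 [E2 _]].
      destruct (HF (ln 1) th) as [R1 [A1 _]]; [rewrite exp_ln; auto; lra|exact Hth|].
      destruct (HF (ln 2) th) as [R2 [A2 _]]; [rewrite exp_ln; auto; lra|exact Hth|].
      rewrite R1, A1, R2, A2, !exp_ln, E1, E2 by lra. lra. }
    assert (Hvends : forall th, 0 <= th <= L -> vor F (ln 1) th = 4 * vor F (ln 2) th).
    { intros th Hth. destruct (Hcirc th Hth) as [E1 [E2 E3]].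
      assert (C1 : clo 1 th) by (split; assumption).
      assert (C2 : clo 2 th) by (split; assumption).
      pose proof (Hvor 1 th C1) as V1. pose proof (Hvor 2 th C2) as V2.
      rewrite Hpdr in V1, V2 by assumption.
      assert (ET : pd_theta clo ur 1 th = 2 * pd_theta clo ur 2 th).
      { apply (pd_theta_eq a b Ha Hab L HL); [exact C1|].
        apply (rel_derive_ext _ (fun s => 2 * ur 2 s)); [exact C1| |].
        - intros y [_ Hy]. symmetry; apply Hcirc, Hy.
        - apply rel_derive_scal.
          assert (Ex : ex_pd_theta clo ur 2 th) by apply (Exv 2 th C2).
          pose proof (pd_theta_spec a b Ha Hab L HL ur 2 th C2 Ex) as S.
          rewrite rel_derive_eps in S |- *. intros eps. destruct (S eps) as [dl Hdl].
          exists dl. intros y Hy Hn [_ Sy]. apply Hdl; auto. split; assumption. }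
      rewrite E2, E3, ET in V1. lra. }
    split; [right; exists (ln 1), (ln 2); auto|].
    clear Hvor HF Hsign Hside Hrad Hradth Hang1.
    revert F Hends Hvends. rewrite Hc. intros F Hends Hvends t th Ht Hth.
    apply (vor_zero_scaled F (ln 1) (ln 2) 4); auto using inside_within; try lra.
    intros x Hx; apply Hends, Hx.
  - (* 0 < r < 1 *)
    destruct (h2 e_r (or_introl (conj E eq_refl))) as [Hu1 Hcases].
    injection E; intros Eb Ea.
    assert (Hlo : lo = m_infty)
      by (unfold lo; rewrite Ea; simpl; destruct (Rle_dec 0 0); [reflexivity|lra]).
    assert (Hhi : hi = Finite (ln 1)) by (unfold hi; rewrite Eb; apply Hln; lra).
    assert (Hcalm : calm_ends F) by (split; [auto|right; exists (ln 1); auto]).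
    assert (Hd : forall th, dot (polar_vector (utheta 1 th) (ur 1 th) th) (e_r th) = ur 1 th).
    { intros th. rewrite <- (Rmult_1_l (ur 1 th)) at 2. rewrite <- Hdot.
      unfold e_r; rewrite !Rmult_1_l; reflexivity. }
    split; [left; exact Hcalm|].
    assert (Hangle0 : angle 0) by (unfold angle; lra).
    destruct Hcases as [[Hc [Hn Hs]]|[[Hc [Hn Hs]]|[[Hn [A HA]]|[Hn [A HA]]]]].
    + apply (Hsign 1); auto.
    + apply (Hsign 1); auto.
    + pose proof (Hn 0 Hangle0) as Hn0. rewrite Hd in Hn0.
      apply (Hside A 0 1); auto; [intros Ec; rewrite Ec in Hn0|left; split]; lra.
    + pose proof (Hn 0 Hangle0) as Hn0. rewrite Hd in Hn0.
      apply (Hside A L 1); auto; [intros Ec; rewrite Ec in Hn0|right; split]; lra.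
  - (* 1 < r *)
    destruct (h2 (fun theta => opp (e_r theta)) (or_intror (conj E eq_refl))) as [Hu1 Hcases].
    injection E; intros Eb Ea.
    assert (Hlo : lo = Finite (ln 1)) by (unfold lo; rewrite Ea; apply Hln; lra).
    assert (Hhi : hi = p_infty) by (unfold hi; rewrite Eb; reflexivity).
    assert (Hcalm : calm_ends F) by (split; [right; exists (ln 1); auto|auto]).
    assert (Hd : forall th,
      dot (polar_vector (utheta 1 th) (ur 1 th) th) (opp (e_r th)) = - ur 1 th).
    { intros th. replace (- ur 1 th) with (-1 * ur 1 th) by ring. rewrite <- Hdot.
      f_equal. unfold opp, e_r; simpl; unfold prod_opp, opp; simpl. f_equal; ring. }
    split; [left; exact Hcalm|].
    assert (Hangle0 : angle 0) by (unfold angle; lra).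
    destruct Hcases as [[Hc [Hn Hs]]|[[Hc [Hn Hs]]|[[Hn [A HA]]|[Hn [A HA]]]]].
    + apply (Hsign 1); auto.
    + apply (Hsign 1); auto.
    + pose proof (Hn 0 Hangle0) as Hn0. rewrite Hd in Hn0.
      apply (Hside A 0 (-1)); auto; [intros Ec; rewrite Ec in Hn0|left; split]; lra.
    + pose proof (Hn 0 Hangle0) as Hn0. rewrite Hd in Hn0.
      apply (Hside A L (-1)); auto; [intros Ec; rewrite Ec in Hn0|right; split]; lra.
  - (* 0 < r *)
    destruct (h3 E) as [Hc0 Hc1]. injection E; intros Eb Ea.
    assert (Hlo : lo = m_infty)
      by (unfold lo; rewrite Ea; simpl; destruct (Rle_dec 0 0); [reflexivity|lra]).
    assert (Hhi : hi = p_infty) by (unfold hi; rewrite Eb; reflexivity).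
    assert (Hcalm : calm_ends F) by (split; auto).
    split; [left; exact Hcalm|].
    destruct (Req_dec c 0) as [Hc|Hc].
    + destruct (Hc0 Hc) as [r0 [Hr0 Hs]]. apply (Hsign r0); auto.
      unfold adm; rewrite Ea, Eb; repeat split; simpl; lra.
    + assert (Hu0 : ur 1 0 <> 0) by (apply Hnz; split; [exact Hadm1|lra]).
      assert (Hcu : c * ur 1 0 <> 0) by (apply Rmult_integral_contrapositive; auto).
      (* The stream lines cross the whole strip, towards larger or smaller radii. *)
      destruct (Hc1 Hc) as [A [HA|HA]]; destruct (Rlt_dec 0 (c * ur 1 0)).
      * apply (Hside A 0 1); auto. left; split; lra.
      * apply (Hside A 0 (-1)); auto. left; split; lra.
      * apply (Hside A L (-1)); auto. right; split; lra.
      * apply (Hside A L 1); auto. right; split; lra. }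
destruct Hclaim as [Hends Hvor0].
set (d := - (stream F 0 L / L)).
pose proof (rigid_of_vor_zero F 0 H0 Hends Hvor0) as Hrig.
assert (HUV : forall r th, clo r th -> utheta r th = c / r /\ ur r th = d / r).
{ apply (homogeneous_velocity a b Ha Hab L HL utheta ur c d F); [|exact Hrig].
  intros t th Ht Hth; destruct (HF t th Ht Hth) as [E1 [E2 _]]; auto. }
destruct (homogeneous_pressure a b Ha Hab L HL utheta ur u P c d hC2_theta hC2_r hu heuler HUV)
  as [K HK].
assert (Hd0 : d <> 0).
{ intros E. apply (Hnz 1 0); [split; [exact Hadm1|lra]|].
  destruct (HUV 1 0) as [_ E2]; [split; [exact Hadm1|lra]|]. rewrite E2, E. field. }
assert (Hvec : forall r theta, clo r theta ->
  polar_vector (utheta r theta) (ur r theta) theta = polar_vector (c / r) (d / r) theta).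
{ intros r th H. destruct (HUV r th H) as [E1 E2]. rewrite E1, E2. reflexivity. }
split; [exists (fun _ => c), (fun _ => d); exact Hvec|split].
- exists K, (fun _ => - (c ^ 2 + d ^ 2) / 2). intros r th H.
  rewrite (HK r th H). destruct H as [H _]. field. lra.
- exists d, K. auto.
Qed.
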